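(* Let $p>1$ and let $w$ be a weight on $\mathcal{H}^n$. Suppose that (i) $w\in A_{p,loc}(\mathcal{H}^n)$; (ii) there exist $0<\beta<1$ and $\beta\le\alpha<p$ such that for every $r\ge 1$ $$ \int_F A_r(\chi_E)(y)\,w(y)\,d\mu_n(y)\lesssim e^{(n-1)r(\beta-1)}\,w(E)^{\frac{\alpha}{p}}\,w(F)^{1-\frac{\alpha}{p}} $$ for any pair of measurable subsets $E,F\subseteq\mathcal{H}^n$ (with implicit constant independent of $r$, $E$, $F$). Then $$\|Mf\|_{L^{p,\infty}(w)}\lesssim \|f\|_{L^p(w)}.$$ Furthermore, if $\beta<\alpha$, then for each fixed $\gamma\ge 0$ $$\sum_{j=1}^{\infty} j^{\gamma}\,\|A_j f\|_{L^p(w)}\lesssim \|f\|_{L^p(w)},$$ and therefore $$\|Mf\|_{L^p(w)}\lesssim\|f\|_{L^p(w)},\qquad \|Mf\|_{L^{p'}(\sigma)}\lesssim\|f\|_{L^{p'}(\sigma)},$$ where $\sigma=w^{1-p'}$ and $p'=\frac{p}{p-1}$. Here the implicit constants in the conclusions are independent of $f$.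
   Context: $\mathcal{H}^n$ ($n\ge2$) denotes the $n$-dimensional hyperbolic space, i.e. the unique (up to isometries) $n$-dimensional complete simply connected Riemannian manifold of constant sectional curvature $-1$; $\mu_n$ is its volume measure, $d_n$ its distance, and $B_H(x,r)=\{y: d_n(x,y)<r\}$. For $r>0$ the averaging operator is $$A_r f(x)=\frac{1}{\mu_n(B_H(x,r))}\int_{B_H(x,r)}|f(y)|\,d\mu_n(y),$$ and the centered Hardy–Littlewood maximal function is $Mf(x)=\sup_{r>0}A_rf(x)$. A weight is a non-negative measurable function $w$ on $\mathcal{H}^n$; $w(E)=\int_E w\,d\mu_n$ for measurable $E$. $L^p(w)$ is $L^p$ with respect to the measure $w\,d\mu_n$, and $\|g\|_{L^{p,\infty}(w)}=\sup_{\lambda>0}\lambda\, w(\{|g|>\lambda\})^{1/p}$. For $p>1$, $w\in A_{p,loc}(\mathcal{H}^n)$ means $$\sup_{0<r(B)\le 1}\left(\frac{1}{\mu_n(B)}\int_B w\,d\mu_n\right)\left(\frac{1}{\mu_n(B)}\int_B w^{-\frac{1}{p-1}}\,d\mu_n\right)^{p-1}<\infty,$$ the supremum being over all hyperbolic balls $B$ of radius $r(B)\le 1$. $X\lesssim Y$ means $X\le CY$ for a finite constant $C$. *)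

(* Defs.v *)
From HB Require Import structures.
From mathcomp Require Import all_boot all_order all_algebra.
From mathcomp Require Import all_classical all_reals all_analysis.
From mathcomp Require Import measurable_realfun.

Set Implicit Arguments.
Unset Strict Implicit.
Unset Printing Implicit Defensive.
Import Order.TTheory GRing.Theory Num.Theory.
Import numFieldNormedType.Exports.

Local Open Scope classical_set_scope.
Local Open Scope ring_scope.
Local Open Scope ereal_scope.

Section real_lebesgue.
Context (R : realType).

(* lebesgue_measure, with domain the canonical measurable type R rather than
   the alias measurableTypeR R: the two have the same measurable sets but
   different displays. *)
Definition real_lebesgue : set R -> \bar R := @lebesgue_measure R.

Let real_lebesgue0 : real_lebesgue set0 = 0.
Proof. exact: (measure0 (@lebesgue_measure R)). Qed.

Let real_lebesgue_ge0 A : 0 <= real_lebesgue A.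
Proof. exact: (measure_ge0 (@lebesgue_measure R)). Qed.

Let real_lebesgue_sigma_additive : semi_sigma_additive real_lebesgue.
Proof. exact: (@measure_semi_sigma_additive _ _ _ (@lebesgue_measure R)). Qed.

HB.instance Definition _ := isMeasure.Build _ _ _ real_lebesgue
  real_lebesgue0 real_lebesgue_ge0 real_lebesgue_sigma_additive.

Let real_lebesgue_sigma_finite : sigma_finite setT real_lebesgue.
Proof. exact: (sigma_finiteT (@lebesgue_measure R)). Qed.

HB.instance Definition _ := Measure_isSigmaFinite.Build _ _ _
  real_lebesgue real_lebesgue_sigma_finite.
End real_lebesgue.
Arguments real_lebesgue : clear implicits.

Section tuple_lebesgue.
Context (R : realType).

Definition cons_pair m (p : R * m.-tuple R) : m.+1.-tuple R :=
  [tuple of p.1 :: p.2].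

Definition uncons m (t : m.+1.-tuple R) : R * m.-tuple R :=
  (thead t, [tuple of behead t]).

Lemma cons_pairK m : cancel (@cons_pair m) (@uncons m).
Proof.
move=> [x t]; congr pair; exact/val_inj.
Qed.

Lemma unconsK m : cancel (@uncons m) (@cons_pair m).
Proof. by move=> t; rewrite [RHS]tuple_eta. Qed.

Lemma measurable_cons_pair m : measurable_fun setT (@cons_pair m).
Proof. exact: (measurable_cons measurable_fst measurable_snd). Qed.

Lemma measurable_uncons m : measurable_fun setT (@uncons m).
Proof.
apply: measurable_fun_pair; first exact: measurable_tnth.
exact: measurable_behead.
Qed.

Section step.
Variables (m : nat) (mu : {sigma_finite_measure set (m.-tuple R) -> \bar R}).

Definition tuple_lebesgue_step : set (m.+1.-tuple R) -> \bar R :=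
  pushforward (real_lebesgue R \x mu) (@cons_pair m).

Let step0 : tuple_lebesgue_step set0 = 0.
Proof. by rewrite /tuple_lebesgue_step /pushforward preimage_set0 measure0. Qed.

Let step_ge0 A : 0 <= tuple_lebesgue_step A.
Proof. exact: (measure_ge0 (real_lebesgue R \x mu)). Qed.

Let mpre A : measurable A -> measurable (@cons_pair m @^-1` A).
Proof.
by move=> mA; rewrite -[X in measurable X]setTI; exact: measurable_cons_pair.
Qed.

Let step_sigma_additive : semi_sigma_additive tuple_lebesgue_step.
Proof.
move=> F mF tF mUF; rewrite /tuple_lebesgue_step /pushforward preimage_bigcup.
apply: (measure_semi_sigma_additive (s := real_lebesgue R \x mu)).
- by move=> n; exact: mpre.
- apply/trivIsetP => /= i j _ _ ij; rewrite -preimage_setI.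
  by move/trivIsetP : tF => /(_ _ _ _ _ ij) ->//; rewrite preimage_set0.
- by rewrite -preimage_bigcup; exact: mpre.
Qed.

HB.instance Definition _ := isMeasure.Build _ _ _
  tuple_lebesgue_step step0 step_ge0 step_sigma_additive.

Let step_sigma_finite : sigma_finite setT tuple_lebesgue_step.
Proof.
have /sigma_finiteP[F [TF ndF Foo]] := sigma_finiteT (real_lebesgue R).
have /sigma_finiteP[G [TG ndG Goo]] := sigma_finiteT mu.
exists (fun k => @uncons m @^-1` (F k `*` G k)).
  rewrite -preimage_bigcup (_ : \bigcup_k _ = setT) ?preimage_setT//.
  rewrite -subTset => -[x t] _.
  have [i _ Fix] : (\bigcup_k F k) x by rewrite -TF.
  have [j _ Gjt] : (\bigcup_k G k) t by rewrite -TG.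
  exists (maxn i j) => //; split.
  - by move: x Fix; exact/subsetPset/ndF/leq_maxl.
  - by move: t Gjt; exact/subsetPset/ndG/leq_maxr.
move=> k; have [mF Fk] := Foo k; have [mG Gk] := Goo k; split.
  rewrite -[X in measurable X]setTI; apply: measurable_uncons => //.
  exact: measurableX.
rewrite /tuple_lebesgue_step /pushforward -comp_preimage.
rewrite (_ : _ \o _ = id); last by apply/funext => x /=; rewrite cons_pairK.
by rewrite preimage_id product_measure1E// lte_mul_pinfty// ge0_fin_numE.
Qed.

HB.instance Definition _ := Measure_isSigmaFinite.Build _ _ _
  tuple_lebesgue_step step_sigma_finite.
End step.

(* n-dimensional Lebesgue measure on the Borel sets of R^n. *)
Fixpoint tuple_lebesgue m : {sigma_finite_measure set (m.-tuple R) -> \bar R} :=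
  match m with
  | 0%N => \d_([tuple])
  | m'.+1 => tuple_lebesgue_step (tuple_lebesgue m')
  end.
End tuple_lebesgue.

(* Hyperbolic n-space is modelled by the upper half-space of points (x, t) with
   x in R^(n-1) and t > 0, carrying the Riemannian metric
   (dx_1^2 + ... + dx_(n-1)^2 + dt^2) / t^2; meaningful for n >= 1. *)
Definition hyp (R : realType) (n : nat) :=
  {p : n.-1.-tuple R * R | (0 < p.2)%R}.

Section hyperbolic_space.
Context (R : realType) (n : nat).
Local Notation H := (hyp R n).
Local Notation half := (n.-1.-tuple R * R)%type.
Implicit Types (x y : H) (A : set H).

Definition hyp_base : H := exist _ ([tuple of nseq n.-1 0%R], 1%R) ltr01.

HB.instance Definition _ := SubChoice.copy H {p : half | (0 < p.2)%R}.
HB.instance Definition _ := isPointed.Build H hyp_base.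

Let toE : H -> half := val.

(* Borel sets of the half-space. *)
HB.instance Definition _ := Measurable.copy H (g_sigma_algebra_preimageType toE).

Lemma measurable_hyp_val : measurable_fun setT (val : H -> half).
Proof. by move=> _ B mB; exists B. Qed.

Lemma measurable_half : measurable [set p : half | (0 < p.2)%R].
Proof.
rewrite (_ : mkset _ = setT `&` snd @^-1` `]0%R, +oo[%classic).
  by apply: measurable_snd => //; exact: measurable_itv.
by apply/seteqP; split => p /=; rewrite in_itv/= andbT; [split|case].
Qed.

Lemma measurable_hyp_image A : measurable A -> measurable (toE @` A).
Proof.
move=> [B mB <-]; rewrite setTI.
rewrite (_ : _ @` _ = B `&` [set p : half | (0 < p.2)%R]).
  by apply: measurableI => //; exact: measurable_half.
apply/seteqP; split => [_ [p Bp <-]|p [Bp p0]]; first by split => //; exact: (valP p).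
by exists (exist _ p p0).
Qed.

(* The Riemannian volume dx_1 ... dx_(n-1) dt / t^n. *)
Definition hvol A : \bar R :=
  \int[tuple_lebesgue R n.-1 \x real_lebesgue R]_(p in toE @` A)
    (p.2 ^- n)%:E.

Let hvol0 : hvol set0 = 0.
Proof. by rewrite /hvol image_set0 integral_set0. Qed.

Let dens_ge0 (B : set half) :
  B `<=` [set p : half | (0 < p.2)%R] -> forall p, B p -> 0 <= (p.2 ^- n)%:E.
Proof.
by move=> sB p /sB /= p0; rewrite lee_fin invr_ge0 exprn_ge0// ltW.
Qed.

Let image_half A : toE @` A `<=` [set p : half | (0 < p.2)%R].
Proof. by move=> _ [p _ <-]; exact: (valP p). Qed.

Let hvol_ge0 A : 0 <= hvol A.
Proof. by apply: integral_ge0; apply: dens_ge0; exact: image_half. Qed.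

Let measurable_dens :
  measurable_fun [set p : half | (0 < p.2)%R] (fun p : half => p.2 ^- n)%R.
Proof.
apply: (@eq_measurable_fun _ _ _ _ _ (fun p : half => (p.2 `^ (- n%:R))%R)).
  by move=> p; rewrite inE /= => p0; rewrite powRN powR_mulrn// ltW.
apply: (measurable_funS measurableT) => //.
exact: (measurableT_comp (measurable_powR _) measurable_snd).
Qed.

Let hvol_sigma_additive : semi_sigma_additive hvol.
Proof.
move=> F mF tF mUF.
have mG k : measurable (toE @` F k) by exact: measurable_hyp_image.
have sG : \bigcup_k (toE @` F k) `<=` [set p : half | (0 < p.2)%R].
  by move=> p [k _]; exact: image_half.
have mh : measurable_fun (\bigcup_k (toE @` F k)) (EFin \o (fun p : half => p.2 ^- n)%R).
  by apply/measurable_EFinP; exact: (measurable_funS measurable_half sG measurable_dens).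
have tG : trivIset setT (fun k => toE @` F k).
  apply/trivIsetP => i j _ _ ij.
  rewrite -subset0 => p [[x Fx <-] [y Fy /val_inj xy]].
  have /trivIsetP/(_ i j Logic.I Logic.I ij) := tF.
  by rewrite -subset0 => /(_ x); apply; split => //; rewrite -xy.
have -> : hvol (\bigcup_k F k) = \sum_(k <oo) hvol (F k).
  rewrite /hvol image_bigcup.
  exact: (ge0_integral_bigcup _ mG mh (dens_ge0 sG) tG).
by apply: is_cvg_nneseries => k _ _; exact: hvol_ge0.
Qed.

HB.instance Definition _ := isMeasure.Build _ _ _ hvol
  hvol0 hvol_ge0 hvol_sigma_additive.
End hyperbolic_space.
Arguments hvol {R n} A.

Section maximal_function.
Context (R : realType) (n : nat).
Local Notation H := (hyp R n).
Implicit Types (x y : H) (E F : set H) (w v : H -> \bar R) (g : H -> \bar R).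

(* cosh d(x, y) = 1 + |x - y|^2 / (2 t_x t_y), with |.| the Euclidean norm of
   R^n, and arcosh c = ln (c + sqrt (c^2 - 1)). *)
Definition hdist x y : R :=
  let: (a, t) := val x in
  let: (b, s) := val y in
  let c := (1 + (\sum_(i < n.-1) (tnth a i - tnth b i) ^+ 2 + (t - s) ^+ 2)
                / (2 * t * s))%R in
  ln (c + Num.sqrt (c ^+ 2 - 1))%R.

Definition hball x (r : R) : set H := [set y | (hdist x y < r)%R].

Definition havg (r : R) (f : H -> R) x : \bar R :=
  (hvol (hball x r))^-1 * \int[hvol]_(y in hball x r) `|(f y)%:E|.

Definition hmaximal (f : H -> R) x : \bar R :=
  ereal_sup [set havg r f x | r in [set r : R | (0 < r)%R]].

Definition wvol w E : \bar R := \int[hvol]_(x in E) w x.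

(* The norm of L^p(w), with respect to the measure w dmu. *)
Definition wLnorm w (p : R) g : \bar R :=
  (\int[hvol]_x (`|g x| `^ p * w x)) `^ p^-1.

Definition wweakLnorm w (p : R) g : \bar R :=
  ereal_sup [set l%:E * wvol w [set x | l%:E < `|g x|] `^ p^-1
            | l in [set l : R | (0 < l)%R]].

(* w^a for a real-valued weight w >= 0; unlike powR, a negative power of 0
   is +oo. *)
Definition wpow (w : H -> R) (a : R) x : \bar R :=
  if (w x == 0%R) && (a < 0)%R then +oo else (w x `^ a)%:E.

Definition Ap_loc (p : R) (w : H -> R) : Prop :=
  ereal_sup [set ((hvol (hball z.1 z.2))^-1
                    * \int[hvol]_(x in hball z.1 z.2) (w x)%:E)
                 * ((hvol (hball z.1 z.2))^-1
                    * \int[hvol]_(x in hball z.1 z.2) wpow w (- (p - 1)^-1) x)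
                   `^ (p - 1)
            | z in [set z : H * R | (0 < z.2 <= 1)%R]] < +oo.
End maximal_function.

(* Main.v *)
(** Small and large radii are treated separately.

    For radii below 1/6 the maximal function is dominated by a maximal function
    over countably many balls, to which Lerner's argument applies: it is bounded
    by the composition of two weighted maximal functions, one for [w] and one
    for its dual weight [sigma], each bounded with respect to its own measure by
    a Vitali covering argument.

    For integer radii [j >= 1], the testing condition is a restricted weak type
    inequality for the averages.  Let [h] be the unnormalized average of [f]
    over balls of radius 1/2, and [b = exp (n - 1)].  Following Naor and Tao, if
    the integral of [f] over the ball of radius [j] is large compared with
    [l b^j], then for some [k <= j] the ball of radius [j + 1] carries a large
    part of the level set [{h > l b^k}].  Summing the restricted weak type
    inequalities over [k] and [j] bounds the weighted measure of the level sets
    of the averages by those of [h], because [p beta / alpha <= p]; if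
    [beta < alpha], the [j]-th average has a norm on [L^p(w)] which decays
    geometrically in [j].  The local condition bounds [h] in [L^p(w)].

    The averages are symmetric, so the decay passes to [L^p'(sigma)] by duality.
    Finally, if [w] vanishes on a set of positive measure, the testing condition
    forces [w = 0] almost everywhere. *)

From HB Require Import structures.
Require Import Defs.
From mathcomp Require Import all_boot all_order all_algebra.
From mathcomp Require Import all_classical all_reals all_analysis.
From mathcomp Require Import measurable_realfun.
From mathcomp Require Import ring lra.

Set Implicit Arguments.
Unset Strict Implicit.
Unset Printing Implicit Defensive.
Import Order.TTheory GRing.Theory Num.Theory.
Import numFieldNormedType.Exports.

Local Open Scope classical_set_scope.
Local Open Scope ring_scope.
Local Open Scope ereal_scope.

(** * Level sets and maximal functions *)

(** Doubling fails at large radii, so the covering argument is confined to small ones. The large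
    scale argument spends the gain of the testing condition in two halves. Put [B = exp(kappa beta)]
    with [kappa = n - 1], and [th = (B / b)^(1/2) < 1]. A level set {h > l b^k} counts as large when
    its integral over the ball of radius j + 1 exceeds c0 (b th)^(j-k). If none is large, the levels
    sum to l b^j times a series in th^(j-k): this uses one factor [th]. The restricted weak type
    inequality at that threshold costs, up to constants, (th^(j-k) B^k)^(1/a) with [a = alpha / p],
    because B / (b th) = th: this is the other factor, and it makes the sum over j >= k converge.
    What remains compares B^(k/a) with b^(p k), that is, beta with alpha.

    Two obstacles shape the statements. The maximal function is nowhere shown to be measurable, so
    integrals are compared without measurability and the strong bounds produce a measurable
    majorant. The weight may vanish on a null set, where its dual power is infinite; there it is
    replaced by 1. *)

Lemma eq_leW disp (T : porderType disp) (x y : T) : x = y -> (x <= y)%O.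
Proof. by move=> ->. Qed.

Lemma powR_lt1 (R : realType) (x e : R) :
  (0 < x)%R -> (x < 1)%R -> (0 < e)%R -> (x `^ e < 1)%R.
Proof.
move=> x0 x1 e0; have : (x `^ e < 1 `^ e)%R by rewrite gt0_ltr_powR ?nnegrE ?(ltW x0).
by rewrite powR1.
Qed.

Section nonnegative_integrals.
Context d (T : measurableType d) (R : realType).
Variable mu : {measure set T -> \bar R}.
Import HBNNSimple.

(** A simple function below [f] is below [g], and the integral of a nonnegative function is the
    supremum over such functions; hence neither function has to be measurable. This matters for
    maximal functions, which are uncountable suprema. *)
Lemma ge0_le_integralW (D : set T) (f g : T -> \bar R) :
  (forall x, D x -> 0 <= f x) -> (forall x, D x -> f x <= g x) ->
  \int[mu]_(x in D) f x <= \int[mu]_(x in D) g x.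
Proof.
move=> f0 fg; rewrite ge0_integralE// ge0_integralE; last first.
  by move=> x Dx; exact: le_trans (f0 _ Dx) (fg _ Dx).
apply: ereal_sup_le => _ /= [h hf <-]; exists h => //.
move=> x; apply: le_trans (hf x) _; rewrite /patch; case: ifPn => // xD.
by apply: fg; rewrite inE in xD.
Qed.

Lemma ge0_subset_integralW (A B : set T) (f : T -> \bar R) :
  (forall x, B x -> 0 <= f x) -> A `<=` B ->
  \int[mu]_(x in A) f x <= \int[mu]_(x in B) f x.
Proof.
move=> f0 AB; rewrite integral_mkcond [leRHS]integral_mkcond.
apply: ge0_le_integralW => x _; rewrite /patch.
  by case: ifPn => //; rewrite inE => /AB /f0.
case: ifPn; first by rewrite inE => /AB Bx; rewrite ifT// inE.
by move=> _; case: ifPn => //; rewrite inE => /f0.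
Qed.

End nonnegative_integrals.

Section dyadic_levels.
Context (R : realType).
Implicit Types (b q l x : R) (X : \bar R).

Lemma sum_levels_le b q l X : (1 < b)%R -> (0 < q)%R -> (0 < l)%R -> 0 <= X ->
  \sum_(j <oo) (if (l * b ^+ j)%:E < X then ((l * b ^+ j) `^ q)%:E else 0)
  <= ((1 - b `^ (- q))^-1)%:E * X `^ q.
Proof.
move=> b1 q0 l0 X0.
have b0 : (0 < b)%R by lra.
have bq : (0 < 1 - b `^ (- q))%R.
  rewrite subr_gt0 powRN invf_lt1 ?powR_gt0//.
  have : (1 `^ q < b `^ q)%R by rewrite gt0_ltr_powR ?nnegrE ?ltW.
  by rewrite powR1.
set C := ((1 - b `^ (- q))^-1)%R.
have C0 : (0 < C)%R by rewrite invr_gt0.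
have CE : (C * b `^ (- q) + 1 = C)%R.
  by rewrite /C; field; rewrite gt_eqF.
have lb j : (0 < l * b ^+ j)%R by rewrite mulr_gt0// exprn_gt0.
case: X X0 => [x| |//]; last first.
  by move=> _; rewrite poweRyr ?gt_eqF// gt0_muley ?lte_fin// leey.
rewrite lee_fin => x0.
apply: lime_le; first by apply: is_cvg_nneseries => j _ _; case: ifP; rewrite // lee_fin powR_ge0.
apply: nearW => N; rewrite poweR_EFin -EFinM.
(* The second bound, independent of [x], drives the induction: when level [N] lies below [x] it
   yields the first bound for [N + 1], since [C * b ^ (- q) + 1 = C]. *)
suff [] : (\sum_(0 <= j < N) (if (l * b ^+ j)%:E < x%:E then ((l * b ^+ j) `^ q)%:E else 0) <= (C * x `^ q)%:E /\
  \sum_(0 <= j < N) (if (l * b ^+ j)%:E < x%:E then ((l * b ^+ j) `^ q)%:E else 0) <= (C * b `^ (- q) * (l * b ^+ N) `^ q)%:E) by [].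
elim: N => [|N [IH1 IH2]].
  rewrite big_geq//; split; rewrite lee_fin; do ?apply: mulr_ge0 => //; rewrite ?powR_ge0 ?ltW//.
have shift : (C * b `^ (- q) * (l * b ^+ N.+1) `^ q = C * (l * b ^+ N) `^ q)%R.
  rewrite exprSr mulrA powRM ?(ltW (lb _))// ?ltW//.
  by rewrite mulrACA powRN mulVf ?mulr1// gt_eqF// powR_gt0.
rewrite !big_nat_recr//= shift.
case: ifPn; rewrite lte_fin.
  move=> lx.
  have key : \sum_(0 <= j < N) (if (l * b ^+ j)%:E < x%:E then ((l * b ^+ j) `^ q)%:E else 0) + ((l * b ^+ N) `^ q)%:E <= (C * (l * b ^+ N) `^ q)%:E.
    apply: le_trans (leeD IH2 (lexx _)) _.
    by rewrite -EFinD lee_fin -[in leRHS]CE mulrDl mul1r.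
  split=> //; apply: le_trans key _.
  rewrite lee_fin ler_pM2l// ge0_ler_powR ?nnegrE// ?ltW//.
move=> _; rewrite !adde0; split=> //; apply: le_trans IH2 _; rewrite lee_fin.
rewrite ler_pM2r ?powR_gt0// -[in leRHS]CE lerDl//.
Qed.

Lemma bernoulli_le b n : (1 < b)%R -> (1 + n%:R * (b - 1) <= b ^+ n)%R.
Proof.
move=> b1; elim: n => [|n IH]; first by rewrite mul0r addr0 expr0.
rewrite exprSr -natr1; apply: (@le_trans _ _ ((1 + n%:R * (b - 1)) * b)%R).
  have : (0 <= n%:R * (b - 1) * (b - 1) :> R)%R.
    by rewrite !mulr_ge0// subr_ge0 ltW.
  lra.
by rewrite ler_wpM2r//; lra.
Qed.

Lemma exprn_unbounded b x : (1 < b)%R -> exists n, (x < b ^+ n)%R.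
Proof.
move=> b1; have b10 : (0 < b - 1)%R by rewrite subr_gt0.
exists (Num.truncn `|x / (b - 1)|%R).+1; apply: lt_le_trans (bernoulli_le _ b1).
have : (`|x / (b - 1)| < (Num.truncn `|x / (b - 1)|).+1%:R)%R.
  by apply: truncnS_gt.
move/(le_lt_trans (ler_norm _)); rewrite ltr_pdivrMr// => /lt_trans; apply.
by rewrite ltrDr.
Qed.

Lemma exists_level b l x : (1 < b)%R -> (0 < l)%R -> (l < x)%R ->
  exists2 j : nat, (l * b ^+ j < x)%R & (x <= l * b ^+ j.+1)%R.
Proof.
move=> b1 l0 lx.
have ex : exists j, (x <= l * b ^+ j)%R.
  have [N HN] := exprn_unbounded (x / l) b1.
  by exists N; rewrite mulrC -ler_pdivrMr// ltW.
case: (ex_minnP ex) => -[|j] xj minj; first by move: xj; rewrite expr0 mulr1 leNgt lx.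
exists j => //; rewrite ltNge; apply/negP => /minj; rewrite ltnn//.
Qed.

Lemma nneseries_ge_term (u : nat -> \bar R) k : (forall n, 0 <= u n) ->
  u k <= \sum_(n <oo) u n.
Proof.
move=> u0; apply: le_trans (nneseries_lim_ge k.+1 _) => //.
by rewrite big_nat_recr//= leeDr// sume_ge0.
Qed.

(** One term is enough: [X] is at most [b] times some level below it. For [X = +oo] the same is
    applied to arbitrarily large reals. *)
Lemma le_sum_levels b q l X : (1 < b)%R -> (0 < q)%R -> (0 < l)%R -> l%:E < X ->
  X `^ q <= (b `^ q)%:E *
    \sum_(j <oo) (if (l * b ^+ j)%:E < X then ((l * b ^+ j) `^ q)%:E else 0).
Proof.
move=> b1 q0 l0 lX; have b0 : (0 < b)%R by lra.
set S := \sum_(j <oo) _.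
have key y : (l < y)%R -> y%:E <= X -> (y `^ q)%:E <= (b `^ q)%:E * S.
  move=> ly yX; have [j ljy ylj] := exists_level b1 l0 ly.
  apply: (@le_trans _ _ ((b `^ q)%:E * ((l * b ^+ j) `^ q)%:E)).
    rewrite -EFinM lee_fin -powRM ?(ltW b0)//; last by rewrite mulr_ge0 ?exprn_ge0 ?ltW.
    rewrite mulrCA -exprS ge0_ler_powR ?nnegrE// ?ltW//.
      exact: lt_trans ly.
    exact: lt_le_trans (lt_trans l0 ly) ylj.
  apply: lee_pmul => //; rewrite ?lee_fin ?powR_ge0//.
  have := @nneseries_ge_term (fun j => if (l * b ^+ j)%:E < X then ((l * b ^+ j) `^ q)%:E else 0) j.
  rewrite /= (lt_le_trans _ yX) ?lte_fin//; apply=> n.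
  by case: ifP => // _; rewrite lee_fin powR_ge0.
case: X lX @S key => [x| |//] lX S key.
  by rewrite poweR_EFin; exact: key.
rewrite poweRyr ?gt_eqF// leye_eq; apply/eqP/eqyP => A A0.
pose y := Num.max (l + 1)%R (A `^ q^-1)%R.
apply: le_trans (key y _ (leey _)); last by rewrite /y lt_max ltrDl ltr01.
rewrite lee_fin; apply: (@le_trans _ _ ((A `^ q^-1) `^ q)%R).
  by rewrite -powRrM mulVf ?gt_eqF// powRr1// ltW.
have Ay : (A `^ q^-1 <= y)%R by rewrite /y le_max lexx orbT.
apply: ge0_ler_powR => //; first exact: ltW.
  by rewrite nnegrE powR_ge0.
by rewrite nnegrE (le_trans _ Ay)// powR_ge0.
Qed.

Lemma nneseriesZr_ereal (u : nat -> \bar R) (c : \bar R) :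
  (forall n, 0 <= u n) -> 0 <= c ->
  (\sum_(n <oo) u n) * c = \sum_(n <oo) (u n * c).
Proof.
move=> u0; case: c => [c| |//] c0.
  by rewrite muleC -nneseriesZl//; apply: eq_eseriesr => n _; rewrite muleC.
have [S0|S0] := eqVneq (\sum_(n <oo) u n) 0.
  rewrite S0 mul0e eseries0// => n _ _.
  suff -> : u n = 0 by rewrite mul0e.
  by apply/eqP; rewrite eq_le u0 -S0 nneseries_ge_term.
have [n un] : exists n, 0 < u n.
  apply: contrapT => /forallNP H; move/eqP : S0; apply; rewrite eseries0// => n _ _.
  by apply/eqP; rewrite eq_le u0 andbT leNgt; apply/negP.
have Sp : 0 < \sum_(n <oo) u n by rewrite lt0e S0 nneseries_ge0.
rewrite gt0_muley//; apply/esym/eqP; rewrite -leye_eq.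
apply: le_trans (nneseries_ge_term n _); first by rewrite gt0_muley.
by move=> k; rewrite mule_ge0.
Qed.

Lemma nneseries_geometric_le (q : R) : (0 <= q)%R -> (q < 1)%R ->
  \sum_(j <oo) (q ^+ j)%:E <= ((1 - q)^-1)%:E.
Proof.
move=> q0 q1; apply: lime_le.
  by apply: is_cvg_nneseries => j _ _; rewrite lee_fin exprn_ge0.
apply: nearW => N; rewrite sumEFin lee_fin big_mkord.
have q10 : (0 < 1 - q)%R by lra.
rewrite -[leRHS]mul1r ler_pdivlMr// mulrC.
suff -> : ((1 - q) * \sum_(i < N) q ^+ i = 1 - q ^+ N)%R.
  by have := exprn_ge0 N q0; lra.
elim: N => [|N IH]; first by rewrite big_ord0 mulr0 expr0 subrr.
by rewrite big_ord_recr/= mulrDr IH exprS; ring.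
Qed.

End dyadic_levels.

Section level_sets.
Context d (T : measurableType d) (R : realType).
Variable mu : {measure set T -> \bar R}.
Variables (b q : R) (b1 : (1 < b)%R) (q0 : (0 < q)%R).
Variables (X w : T -> \bar R).
Hypotheses (X0 : forall x, 0 <= X x) (w0 : forall x, 0 <= w x).
Hypotheses (mX : measurable_fun setT X) (mw : measurable_fun setT w).

Lemma measurable_lte_set (Y : T -> \bar R) (c : \bar R) :
  measurable_fun setT Y -> measurable [set x | c < Y x].
Proof.
by move=> mY; rewrite -[X in measurable X]setTI; exact: emeasurable_fun_o_infty.
Qed.

Let levelE (l : R) j :
  ((l * b ^+ j) `^ q)%:E * \int[mu]_(x in [set x | (l * b ^+ j)%:E < X x]) w x =
  \int[mu]_x ((if (l * b ^+ j)%:E < X x then ((l * b ^+ j) `^ q)%:E else 0) * w x).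
Proof.
have mA : measurable [set x | (l * b ^+ j)%:E < X x] by exact: measurable_lte_set.
rewrite -ge0_integralZl//; last 2 first.
- exact: measurable_funTS.
- by rewrite lee_fin powR_ge0.
rewrite integral_mkcond; apply: eq_integral => x _; rewrite /patch; case: ifPn.
  by rewrite inE/= => ->.
by rewrite notin_setE/= => /negP/negbTE ->; rewrite mul0e.
Qed.

Let mlevel (l : R) j : measurable_fun setT
  (fun x => (if (l * b ^+ j)%:E < X x then ((l * b ^+ j) `^ q)%:E else 0) * w x).
Proof.
apply: emeasurable_funM => //; apply: measurable_fun_ifT => //.
exact: measurable_fun_lte.
Qed.

Let level0 (l : R) j x :
  0 <= (if (l * b ^+ j)%:E < X x then ((l * b ^+ j) `^ q)%:E else 0) :> \bar R.
Proof. by case: ifP => // _; rewrite lee_fin powR_ge0. Qed.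

Let sumE (l : R) :
  \sum_(j <oo) (((l * b ^+ j) `^ q)%:E *
     \int[mu]_(x in [set x | (l * b ^+ j)%:E < X x]) w x) =
  \int[mu]_x ((\sum_(j <oo)
    (if (l * b ^+ j)%:E < X x then ((l * b ^+ j) `^ q)%:E else 0)) * w x).
Proof.
under eq_eseriesr do rewrite levelE.
rewrite -integral_nneseries//; last by move=> *; rewrite mule_ge0.
by apply: eq_integral => x _; rewrite nneseriesZr_ereal.
Qed.

Let mXq : measurable_fun setT (fun x => X x `^ q).
Proof. exact: measurableT_comp (measurable_poweR _) mX. Qed.

Lemma sum_level_sets_le (l : R) : (0 < l)%R ->
  \sum_(j <oo) (((l * b ^+ j) `^ q)%:E *
     \int[mu]_(x in [set x | (l * b ^+ j)%:E < X x]) w x)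
  <= ((1 - b `^ (- q))^-1)%:E * \int[mu]_x (X x `^ q * w x).
Proof.
move=> l0; rewrite sumE -ge0_integralZl//; last 3 first.
- exact: emeasurable_funM.
- by move=> x _; rewrite mule_ge0 ?poweR_ge0.
- rewrite lee_fin invr_ge0 subr_ge0 powRN invf_le1 ?powR_gt0 ?(lt_trans _ b1)//.
  by rewrite -(powRr0 b) ler_powR ?ltW.
apply: ge0_le_integralW => x _; first by rewrite mule_ge0// nneseries_ge0.
by rewrite muleA lee_wpmul2r// sum_levels_le.
Qed.

(** [X ^ q] is controlled by its levels only where [X > l], so [K] has to serve every [l]. With
    [l = 1 / (i + 1)] the sets {X > l} exhaust {X > 0}, off which the integrand is zero. *)
Lemma le_sum_level_sets (K : \bar R) :
  (forall l : R, (0 < l)%R -> \sum_(j <oo) (((l * b ^+ j) `^ q)%:E *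
     \int[mu]_(x in [set x | (l * b ^+ j)%:E < X x]) w x) <= K) ->
  \int[mu]_x (X x `^ q * w x) <= (b `^ q)%:E * K.
Proof.
move=> HK; pose F (i : nat) := [set x | (i.+1%:R^-1)%:E < X x].
have mF i : measurable (F i) by exact: measurable_lte_set.
have f0 x : 0 <= X x `^ q * w x by rewrite mule_ge0 ?poweR_ge0.
have mf : measurable_fun setT (fun x => X x `^ q * w x) by exact: emeasurable_funM.
have -> : \int[mu]_x (X x `^ q * w x) = \int[mu]_(x in \bigcup_i F i) (X x `^ q * w x).
  rewrite [RHS]integral_mkcond; apply: eq_integral => x _; rewrite /patch.
  case: ifPn => //; rewrite notin_setE => /= nFx.
  suff -> : X x = 0 by rewrite poweR0r ?gt_eqF// mul0e.
  apply/eqP; rewrite eq_le X0 andbT leNgt; apply/negP => Xp; apply: nFx.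
  case Xx : (X x) Xp => [r| |//] r0; last first.
    by exists 0%N => //; rewrite /F/= Xx ltry.
  rewrite lte_fin in r0.
  exists (Num.truncn r^-1) => //; rewrite /F/= Xx lte_fin.
  by rewrite invf_plt ?posrE// truncnS_gt.
have ndF : nondecreasing_seq F.
  move=> m n mn; rewrite subsetEset => x; rewrite /F/=; apply: le_lt_trans.
  by rewrite lee_fin lef_pV2 ?posrE ?ler_nat// ltr0n.
have cv := ge0_nondecreasing_set_cvg_integral (mu := mu) ndF mF
  (fun i => measurable_funTS (D := F i) mf) (fun i x _ => f0 x).
rewrite -(cvg_lim _ cv)//; apply: lime_le; first by apply/cvg_ex; eexists; exact: cv.
apply: nearW => i; have l0 : (0 < i.+1%:R^-1 :> R)%R by [].
apply: le_trans (lee_wpmul2l _ (HK _ l0)); last by rewrite lee_fin powR_ge0.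
rewrite sumE -ge0_integralZl//; last 3 first.
- apply: emeasurable_funM => //; apply: ge0_emeasurable_sum => // k _.
  by apply: measurable_fun_ifT => //; exact: measurable_fun_lte.
- by move=> x _; rewrite mule_ge0// nneseries_ge0.
- by rewrite lee_fin powR_ge0.
apply: (@le_trans _ _ (\int[mu]_(x in F i) ((b `^ q)%:E * ((\sum_(j <oo)
    (if (i.+1%:R^-1 * b ^+ j)%:E < X x then ((i.+1%:R^-1 * b ^+ j) `^ q)%:E else 0)) * w x)))).
  apply: ge0_le_integralW => x Fx; first exact: f0.
  by rewrite muleA lee_wpmul2r// le_sum_levels.
apply: ge0_subset_integralW => // x _.
by rewrite mule_ge0// ?lee_fin ?powR_ge0// mule_ge0// nneseries_ge0.
Qed.

End level_sets.

Section integral_subadditivity.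
Context d (T : measurableType d) (R : realType).
Variable mu : {measure set T -> \bar R}.
Variable f : T -> \bar R.
Hypotheses (mf : measurable_fun setT f) (f0 : forall x, 0 <= f x).

Lemma ge0_integral_bigcup_le (F : nat -> set T) : (forall n, measurable (F n)) ->
  \int[mu]_(x in \bigcup_n F n) f x <= \sum_(n <oo) \int[mu]_(x in F n) f x.
Proof.
move=> mF; rewrite integral_mkcond.
under eq_eseriesr do rewrite integral_mkcond.
rewrite -integral_nneseries//; last 2 first.
- by move=> n; apply/(measurable_restrictT _ (mF n)); exact: measurable_funTS.
- by move=> n x _; exact: erestrict_ge0.
apply: ge0_le_integralW => x _; first exact: erestrict_ge0.
rewrite {1}/patch; case: ifPn => [|_]; last first.
  by apply: nneseries_ge0 => n _ _; exact: erestrict_ge0.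
rewrite inE => -[n _ Fnx]; apply: le_trans (nneseries_ge_term n _).
  by rewrite /patch mem_set.
by move=> k; exact: erestrict_ge0.
Qed.

Lemma ge0_integral_setU_le (A B : set T) : measurable A -> measurable B ->
  \int[mu]_(x in A `|` B) f x <=
  \int[mu]_(x in A) f x + \int[mu]_(x in B) f x.
Proof.
move=> mA mB; rewrite integral_mkcond [X in _ <= X + _]integral_mkcond.
rewrite [X in _ <= _ + X]integral_mkcond -ge0_integralD//; last 4 first.
- by move=> x _; exact: erestrict_ge0.
- by apply/(measurable_restrictT _ mA); exact: measurable_funTS.
- by move=> x _; exact: erestrict_ge0.
- by apply/(measurable_restrictT _ mB); exact: measurable_funTS.
apply: ge0_le_integralW => x _; first exact: erestrict_ge0.
rewrite /patch in_setU; case: (x \in A) => /=; case: (x \in B) => //=.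
- by rewrite leeDl.
- by rewrite adde0.
- by rewrite add0e.
- by rewrite adde0.
Qed.

Lemma ge0_integral_bigsetU_le (I : Type) (s : seq I) (F : I -> set T) :
  (forall n, measurable (F n)) ->
  \int[mu]_(x in \big[setU/set0]_(i <- s) F i) f x <=
  \sum_(i <- s) \int[mu]_(x in F i) f x.
Proof.
move=> mF; elim: s => [|i s IH]; first by rewrite !big_nil integral_set0.
rewrite !big_cons; apply: le_trans (ge0_integral_setU_le _ _) _ => //.
  exact: bigsetU_measurable.
exact: leeD.
Qed.

End integral_subadditivity.

(* Choosing greedily an index of largest radius. *)
Lemma finite_vitali (R : realType) (T : Type) (I : eqType) (B : I -> set T)
    (rho : I -> R) (s : seq I) : (forall i, B i !=set0) ->
  exists D : seq I, [/\ {subset D <= s}, uniq D, trivIset [set` D] B &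
    forall i, i \in s -> exists2 j, j \in D &
      (rho i <= rho j)%R /\ B i `&` B j !=set0].
Proof.
move=> B0.
have [n sn] := ubnP (size s); elim: n s sn => // n IH s; rewrite ltnS => sn.
case: s sn => [|i0 s0] sn; first by exists [::]; split.
set s := i0 :: s0.
have [m ms mmax] : exists2 m, m \in s & forall i, i \in s -> (rho i <= rho m)%R.
  have : (0 < size s)%N by [].
  elim: (s) => // a t IHt _; case: t IHt => [|c t] IHt.
    by exists a; rewrite ?mem_head// => i; rewrite inE => /eqP ->.
  have [m mt mmax] := IHt isT.
  have [am|ma] := leP (rho a) (rho m).
    exists m; first by rewrite inE mt orbT.
    by move=> i; rewrite inE => /predU1P[->//|/mmax].
  exists a; first by rewrite mem_head.
  move=> i; rewrite inE => /predU1P[->//|/mmax im].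
  exact: le_trans im (ltW ma).
pose s' := [seq i <- s | `[< B i `&` B m = set0 >]].
(* [B m] is nonempty, hence meets itself, so the filtered list is shorter. Every discarded ball
   meets [B m], whose radius is largest. *)
have ms' : m \notin s'.
  rewrite mem_filter negb_and; apply/orP; left; apply/asboolPn.
  by rewrite setIid; apply/eqP/set0P.
have /IH [D [Ds uD tD cD]] : (size s' < n)%N.
  rewrite (leq_trans _ sn)// size_filter -[ltnRHS](count_predC (fun i => `[< B i `&` B m = set0 >])).
  rewrite -[ltnLHS]addn0 ltn_add2l -has_count; apply/hasP; exists m => //=.
  by move: ms'; rewrite mem_filter ms andbT.
have Dm i : i \in D -> B i `&` B m = set0.
  by move/Ds; rewrite mem_filter => /andP[/asboolP].
exists (m :: D); split.
- move=> i; rewrite inE => /predU1P[->//|/Ds].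
  by rewrite mem_filter => /andP[].
- by rewrite /= uD andbT; apply: contra ms'; exact: Ds.
- move=> i j /=; rewrite !inE => /predU1P[->|iD] /predU1P[->|jD]//.
  + by rewrite setIC Dm// => -[].
  + by rewrite Dm// => -[].
  + exact: tD.
- move=> i si; have [im0|im0] := pselect (B i `&` B m = set0).
    have /cD [j jD H] : i \in s' by rewrite mem_filter si andbT; apply/asboolP.
    by exists j; rewrite // inE jD orbT.
  by exists m; rewrite ?mem_head//; split; [exact: mmax|exact/set0P/eqP].
Qed.

Section weighted_maximal_function.
Context d (T : measurableType d) (R : realType).
Variable mu : {measure set T -> \bar R}.
Variables (B B' : nat -> set T) (rho : nat -> R).
Hypotheses (mB : forall i, measurable (B i)) (mB' : forall i, measurable (B' i)).
Hypothesis B0 : forall i, B i !=set0.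
Hypothesis BB' : forall i j, (rho i <= rho j)%R -> B i `&` B j !=set0 ->
  B i `<=` B' j.
Variables (v : T -> R) (V : nat -> R) (K : R).
Hypotheses (mv : measurable_fun setT v) (v0 : forall x, (0 <= v x)%R).
Hypotheses (VE : forall i, \int[mu]_(x in B i) (v x)%:E = (V i)%:E)
  (V0 : forall i, (0 < V i)%R) (K0 : (0 < K)%R).
Hypothesis VK : forall i, \int[mu]_(x in B' i) (v x)%:E <= (K * V i)%:E.

(** The family is countable so that the supremum is measurable. [V i] stands for the [v]-mass of
    [B i]; with [v = 1] and the volumes for [V] this is the unweighted maximal function. *)
Definition wmax (g : T -> \bar R) (x : T) : \bar R :=
  ereal_sup (range (fun i : nat => if x \in B i then
    ((V i)^-1)%:E * \int[mu]_(y in B i) (g y * (v y)%:E) else 0)).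

Variable g : T -> \bar R.
Hypotheses (mg : measurable_fun setT g) (g0 : forall x, 0 <= g x).

Let gv0 x : 0 <= g x * (v x)%:E.
Proof. by rewrite mule_ge0// lee_fin. Qed.

Let mgv : measurable_fun setT (fun x => g x * (v x)%:E).
Proof. by apply: emeasurable_funM => //; exact/measurable_EFinP. Qed.

Lemma wmax_ge0 x : 0 <= wmax g x.
Proof.
apply: (@le_trans _ _ (if x \in B 0%N then
    ((V 0%N)^-1)%:E * \int[mu]_(y in B 0%N) (g y * (v y)%:E) else 0)).
  case: ifP => // _; apply: mule_ge0; first by rewrite lee_fin invr_ge0 ltW.
  exact: integral_ge0.
by apply: ereal_sup_ubound; exists 0%N.
Qed.

Lemma wmax_ge i x : B i x ->
  \int[mu]_(y in B i) (g y * (v y)%:E) <= (V i)%:E * wmax g x.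
Proof.
move=> Bix; rewrite -lee_pdivrMl//; apply: ereal_sup_ubound => /=.
by exists i => //; rewrite mem_set.
Qed.

Lemma measurable_wmax : measurable_fun setT (wmax g).
Proof.
pose h (i : nat) x : \bar R := if x \in B i then
    ((V i)^-1)%:E * \int[mu]_(y in B i) (g y * (v y)%:E) else 0.
have -> : wmax g = fun x => esups (h ^~ x) 0%N.
  apply/funext => x; rewrite /wmax /esups /=; congr ereal_sup.
  by apply/seteqP; split => [_ [n _ <-]|_ [n _ <-]]; exists n.
apply: measurable_fun_esups => n; rewrite /h.
exact/(measurable_restrictT (cst _) (mB n)).
Qed.

(** On each selected ball the part of [g] below [l / 2] accounts for at most half of the required
    mass [l V j], so the other half is paid by the integral of [g] over [G]. The truncation to [G]
    is what allows the bound to be summed over levels in [wmax_strong]. *)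
Lemma wmax_weak (l : R) : (0 < l)%R ->
  l%:E * \int[mu]_(x in [set x | l%:E < wmax g x]) (v x)%:E <=
  (2 * K)%:E * \int[mu]_(x in [set x | l%:E < 2%:E * g x]) (g x * (v x)%:E).
Proof.
move=> l0; set G := [set x | l%:E < 2%:E * g x].
have mG : measurable G.
  by apply: measurable_lte_set; exact: emeasurable_funM.
pose P i := `[< (l * V i)%:E < \int[mu]_(y in B i) (g y * (v y)%:E) >].
(* Only the first [n] balls are kept, so that the finite covering lemma applies; the bound is
   uniform in [n]. *)
pose U n := \big[setU/set0]_(i <- [seq i <- iota 0 n | P i]) B i.
have mU n : measurable (U n) by exact: bigsetU_measurable.
have mv' D : measurable_fun D (fun x => (v x)%:E).
  by apply: measurable_funTS; exact/measurable_EFinP.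
have v0' x : 0 <= (v x)%:E by rewrite lee_fin.
have Ux n x : U n x <-> exists2 i, (i < n)%N & P i /\ B i x.
  rewrite /U -bigcup_seq; split=> [[i /=]|[i ni [Pi Bi]]].
    by rewrite mem_filter mem_iota add0n => /andP[Pi ni] Bi; exists i.
  by exists i => //=; rewrite mem_filter mem_iota Pi.
have -> : [set x | l%:E < wmax g x] = \bigcup_n U n.
  apply/seteqP; split => x /=.
    move=> /ereal_sup_gt [_ [i _ <-]]; case: ifPn; last first.
      by move=> _; rewrite lte_fin ltNge (ltW l0).
    rewrite inE => Bix; rewrite lte_pdivlMl// => H; exists i.+1 => //; apply/Ux.
    exists i => //; split=> //; apply/asboolP; rewrite EFinM muleC//.
  move=> [n _ /Ux [i _ [/asboolP Pi Bi]]].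
  apply: (@lt_le_trans _ _ (((V i)^-1)%:E * \int[mu]_(y in B i) (g y * (v y)%:E))).
    by rewrite lte_pdivlMl// -EFinM mulrC.
  by apply: ereal_sup_ubound; exists i => //; rewrite mem_set.
have ndU : nondecreasing_seq U.
  move=> m n mn; rewrite subsetEset => x /Ux [i im H]; apply/Ux; exists i => //.
  exact: leq_trans mn.
have cv := ge0_nondecreasing_set_cvg_integral (mu := mu) ndU mU
  (fun i => mv' (U i)) (fun i x _ => v0' x).
rewrite -(cvg_lim _ cv)// -limeMl//; last by apply/cvg_ex; eexists; exact: cv.
apply: lime_le; first by apply: is_cvgeMl => //; apply/cvg_ex; eexists; exact: cv.
apply: nearW => n.
have [D [Ds uD tD cD]] := finite_vitali rho [seq i <- iota 0 n | P i] B0.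
have UD : U n `<=` \big[setU/set0]_(j <- D) B' j.
  rewrite /U -!bigcup_seq => x [i /= /cD [j jD [rij Bij]] Bix].
  by exists j => //; exact: BB' rij Bij _ Bix.
have key j : j \in D ->
    l%:E * (K * V j)%:E <= (2 * K)%:E * \int[mu]_(x in B j `&` G) (g x * (v x)%:E).
  move=> /Ds; rewrite mem_filter => /andP[/asboolP Pj _].
  have : (l * V j)%:E <= \int[mu]_(x in B j `&` G) (g x * (v x)%:E) + (l / 2 * V j)%:E.
    apply: le_trans (ltW Pj) _.
    have -> : B j = (B j `&` G) `|` (B j `\` G) by rewrite setDE -setIUr setUv setIT.
    rewrite [in X in _ <= X + _](_ : (B j `&` G) `|` (B j `\` G) = B j); last first.
      by rewrite setDE -setIUr setUv setIT.
    apply: le_trans (ge0_integral_setU_le _ _ _ _ _) _ => //.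
    - exact: measurableI.
    - exact: measurableD.
    apply: leeD => //.
    apply: (@le_trans _ _ (\int[mu]_(x in B j `\` G) ((l / 2)%:E * (v x)%:E))).
      apply: ge0_le_integralW => // x [_ /negP]; rewrite -leNgt => gl.
      rewrite lee_wpmul2r//; move: gl; rewrite muleC -lee_pdivlMr//.
    rewrite ge0_integralZl// ?lee_fin ?divr_ge0 ?(ltW l0)//; last exact: measurableD.
    rewrite (EFinM (l / 2)) -VE lee_wpmul2l// ?lee_fin ?divr_ge0 ?(ltW l0)//.
    by apply: ge0_subset_integralW => // x [].
  case: (\int[mu]_(x in B j `&` G) _) => [r| |].
  - rewrite -EFinD -!EFinM !lee_fin => H.
    have : (0 <= K * (r - l / 2 * V j))%R by rewrite mulr_ge0 ?(ltW K0)//; lra.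
    lra.
  - by move=> _; rewrite gt0_muley ?leey// lte_fin mulr_gt0.
  - by rewrite addNye.
apply: (@le_trans _ _ (l%:E * \sum_(j <- D) (K * V j)%:E)).
  rewrite lee_wpmul2l// ?lee_fin ?(ltW l0)//.
  apply: le_trans (ge0_subset_integralW _ _ UD) _ => //.
  apply: le_trans (ge0_integral_bigsetU_le _ _ _ _ _) _ => //.
  exact: lee_sum.
rewrite ge0_sume_distrr; last by move=> j _; rewrite lee_fin mulr_ge0// ltW.
apply: (@le_trans _ _ (\sum_(j <- D) ((2 * K)%:E * \int[mu]_(x in B j `&` G) (g x * (v x)%:E)))).
  by rewrite big_seq [leRHS]big_seq; apply: lee_sum => j; exact: key.
rewrite -ge0_sume_distrr; last by move=> j _; exact: integral_ge0.
rewrite lee_wpmul2l// ?lee_fin ?mulr_ge0 ?(ltW K0)//.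
rewrite -(@ge0_integral_bigsetU _ _ _ _ _ (fun j => B j `&` G))//.
- apply: ge0_subset_integralW => // x; rewrite -bigcup_seq => -[j _ []//].
- by move=> j; exact: measurableI.
- exact: trivIset_setIr.
- exact: measurable_funTS.
Qed.

Lemma mule_poweRB1 (x : \bar R) (q : R) : (1 < q)%R -> 0 <= x ->
  x `^ (q - 1) * x = x `^ q.
Proof.
move=> q1; case: x => [x| |//] x0.
  rewrite !poweR_EFin -EFinM mulrC mulr_powRB1//.
  exact: lt_trans q1.
by rewrite !poweRyr ?mulyy// gt_eqF ?subr_gt0// (lt_trans _ q1).
Qed.

(** Marcinkiewicz interpolation with the trivial bound at infinity: [wmax_weak] at level l 2^j,
    multiplied by (l 2^j)^(q - 1), is summed over j, and the truncated integrals add up to the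
    integral of (2 g)^(q - 1) g v. In the constant, [2 ^ q] is the loss between consecutive levels,
    [2 * K] the weak type constant, and the last two factors come from the level sum at exponent
    [q - 1] and from the factor 2 in [2 g]. *)
Lemma wmax_strong (q : R) : (1 < q)%R ->
  \int[mu]_x (wmax g x `^ q * (v x)%:E) <=
  (2 `^ q * (2 * K * ((1 - 2 `^ (- (q - 1)))^-1 * 2 `^ (q - 1))))%:E *
  \int[mu]_x (g x `^ q * (v x)%:E).
Proof.
move=> q1; have q0 : (0 < q)%R by exact: lt_trans q1.
rewrite EFinM -muleA; apply: le_sum_level_sets => //.
- by rewrite ltr1n.
- exact: wmax_ge0.
- exact: measurable_wmax.
- exact/measurable_EFinP.
move=> l l0.
have lj0 j : (0 < l * 2 ^+ j)%R by rewrite mulr_gt0// exprn_gt0.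
have m2g : measurable_fun setT (fun x => 2%:E * g x) by exact: emeasurable_funM.
have g20 x : 0 <= 2%:E * g x by rewrite mule_ge0.
have q10 : (0 < q - 1)%R by rewrite subr_gt0.
have lt12 : (1 < 2 :> R)%R by rewrite ltr1n.
apply: (@le_trans _ _ (\sum_(j <oo) ((2 * K)%:E * (((l * 2 ^+ j) `^ (q - 1))%:E *
    \int[mu]_(x in [set x | (l * 2 ^+ j)%:E < 2%:E * g x]) (g x * (v x)%:E))))).
  apply: lee_nneseries => [j _ _|j _].
    rewrite mule_ge0 ?lee_fin ?powR_ge0//.
    by apply: integral_ge0 => x _; rewrite lee_fin.
  rewrite -(@mulr_powRB1 _ (l * 2 ^+ j) q)// ?(ltW (lj0 _))// mulrC EFinM -muleA.
  by rewrite [leRHS]muleCA lee_wpmul2l ?lee_fin ?powR_ge0//; exact: wmax_weak.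
rewrite nneseriesZl; last first.
  by move=> j _; rewrite mule_ge0 ?lee_fin ?powR_ge0//; exact: integral_ge0.
rewrite (EFinM (2 * K)) -muleA lee_wpmul2l ?lee_fin ?mulr_ge0 ?(ltW K0)//.
apply: le_trans (sum_level_sets_le _ _ _ _ _ _ _ _) _ => //.
have C0 : (0 <= ((1 - 2 `^ (- (q - 1)))^-1 : R)%:E).
  rewrite lee_fin invr_ge0 subr_ge0 powRN invf_le1 ?powR_gt0//.
  by rewrite -[leLHS](powRr0 2) ler_powR ?ler1n// ltW.
rewrite EFinM -muleA lee_wpmul2l//.
rewrite -ge0_integralZl//; last 2 first.
- apply: emeasurable_funM; last exact/measurable_EFinP.
  exact: measurableT_comp (measurable_poweR _) mg.
- by move=> x _; rewrite mule_ge0 ?poweR_ge0 ?lee_fin.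
apply: ge0_le_integralW => x _.
  by rewrite mule_ge0 ?poweR_ge0.
rewrite poweRM// poweR_EFin -!muleA lee_wpmul2l ?lee_fin ?powR_ge0//.
by rewrite muleA mule_poweRB1.
Qed.

End weighted_maximal_function.

(** * Muckenhoupt weights *)

Lemma lee_poweR (R : realType) (r : R) (x y : \bar R) :
  (0 <= r)%R -> 0 <= x -> x <= y -> x `^ r <= y `^ r.
Proof.
move=> r0 x0 xy; apply: gt0_ler_poweR => //.
  by rewrite in_itv/= x0 leey.
by rewrite in_itv/= leey (le_trans x0 xy).
Qed.

Lemma invr_powR (R : realType) (x r : R) : (0 <= x)%R -> ((x^-1) `^ r = (x `^ r)^-1)%R.
Proof. by move=> x0; rewrite -powR_inv1// powRAC powR_inv1// powR_ge0. Qed.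

Lemma integral_poweR_scale d (T : measurableType d) (R : realType)
    (mu : {measure set T -> \bar R}) (k p : R) (X : T -> \bar R) (w : T -> R) :
  (0 <= k)%R -> measurable_fun setT X -> (forall x, 0 <= X x) ->
  measurable_fun setT w -> (forall x, (0 <= w x)%R) ->
  \int[mu]_x ((k%:E * X x) `^ p * (w x)%:E) =
  (k `^ p)%:E * \int[mu]_x (X x `^ p * (w x)%:E).
Proof.
move=> k0 mX X0 mw w0; rewrite -ge0_integralZl//.
- apply: eq_integral => x _; rewrite -poweR_EFin muleA poweRM// lee_fin//.
- apply: emeasurable_funM; last exact/measurable_EFinP.
  exact: measurableT_comp (measurable_poweR _) mX.
- by move=> x _; rewrite mule_ge0 ?poweR_ge0 ?lee_fin.
- by rewrite lee_fin powR_ge0.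
Qed.

(** Real-valued, hence meaningful for positive weights only: at a zero of [w] this power is 0,
    whereas [wpow] is [+oo] there. *)
Definition dual_weight (R : realType) (T : Type) (p : R) (w : T -> R) (x : T) : R :=
  (w x `^ (- (p - 1)^-1))%R.

Section dual_weight.
Context d (T : measurableType d) (R : realType) (p : R) (p1 : (1 < p)%R).
Variable w : T -> R.
Hypotheses (mw : measurable_fun setT w) (w0 : forall x, (0 < w x)%R).

Let p10 : (0 < p - 1)%R. Proof. by rewrite subr_gt0. Qed.
Let p0 : (0 < p)%R. Proof. exact: lt_trans p1. Qed.

Lemma dual_weight_gt0 x : (0 < dual_weight p w x)%R.
Proof. exact: powR_gt0. Qed.

Lemma measurable_dual_weight : measurable_fun setT (dual_weight p w).
Proof. exact: (measurableT_comp (measurable_powR _)). Qed.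

Lemma dual_weightK x : (dual_weight p w x `^ (p - 1) = (w x)^-1)%R.
Proof.
by rewrite -powRrM mulNr mulVf ?gt_eqF// powR_inv1// ltW.
Qed.

Lemma conj_expo1 : (1 < p / (p - 1))%R.
Proof. by rewrite ltr_pdivlMr// mul1r gtrDl oppr_lt0. Qed.

Lemma conj_expo_sub1 : (p / (p - 1) - 1 = (p - 1)^-1)%R.
Proof. by field; rewrite gt_eqF. Qed.

(** Raising the A_p condition to the power 1 / (p - 1) exchanges the roles of the weight and its
    dual, and gives the condition for the conjugate exponent. *)
Lemma dual_muckenhoupt (A : R) (W S V : \bar R) : (0 <= A)%R -> 0 <= W -> 0 <= S ->
  W * S `^ (p - 1) <= A%:E * V `^ p ->
  S * W `^ (p / (p - 1) - 1) <= (A `^ (p - 1)^-1)%:E * V `^ (p / (p - 1)).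
Proof.
move=> A0 W0 S0; have e0 : (0 <= (p - 1)^-1)%R by rewrite invr_ge0 ltW.
have AE : 0 <= A%:E by rewrite lee_fin.
move=> /(lee_poweR e0 (mule_ge0 W0 (poweR_ge0 _ _))).
rewrite (poweRM _ W0 (poweR_ge0 _ _)) -poweRrM mulfV ?gt_eqF// (poweRe1 S0) muleC.
by rewrite (poweRM _ AE (poweR_ge0 _ _)) poweR_EFin -poweRrM conj_expo_sub1.
Qed.

Lemma dual_dual_weight : dual_weight (p / (p - 1)) (dual_weight p w) = w.
Proof.
apply/funext => x; rewrite {1}/dual_weight conj_expo_sub1 invrK powRN dual_weightK.
by rewrite invrK.
Qed.

Variable mu : {measure set T -> \bar R}.

(** L^p(w) and L^p'(sigma) are dual under the unweighted pairing: Hoelder's inequality is applied to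
    u w^(1/p) and f w^(-1/p). *)
Lemma weighted_hoelder2 (f u : T -> R) :
  measurable_fun setT f -> (forall x, (0 <= f x)%R) ->
  measurable_fun setT u -> (forall x, (0 <= u x)%R) ->
  \int[mu]_x (f x * u x)%:E <=
  (\int[mu]_x (u x `^ p * w x)%:E) `^ p^-1 *
  (\int[mu]_x (f x `^ (p / (p - 1)) * dual_weight p w x)%:E) `^ (p / (p - 1))^-1.
Proof.
move=> mf f0 mu_ u0.
have q0 : (0 < p / (p - 1))%R by rewrite divr_gt0.
pose F x := (u x * w x `^ p^-1)%R.
pose G x := (f x * w x `^ (- p^-1))%R.
have mpow r : measurable_fun setT (fun x => w x `^ r)%R.
  exact: (measurableT_comp (measurable_powR _)).
have mF : measurable_fun setT F by exact: measurable_funM.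
have mG : measurable_fun setT G by exact: measurable_funM.
have pq : (p^-1 + (p / (p - 1))^-1 = 1)%R by field; rewrite !gt_eqF.
have := hoelder mu mF mG p0 q0 pq.
rewrite Lnorm1 unlock.
have -> : \int[mu]_x `|(EFin \o (F \* G)%R) x| = \int[mu]_x (f x * u x)%:E.
  apply: eq_integral => x _; rewrite /= /F /G mulrACA -powRD; last first.
    by rewrite (gt_eqF (w0 x)) implybT.
  by rewrite subrr powRr0 mulr1 ger0_norm ?mulr_ge0// mulrC.
have -> : \int[mu]_x `|(EFin \o F) x| `^ p = \int[mu]_x (u x `^ p * w x)%:E.
  apply: eq_integral => x _; rewrite /= /F ger0_norm ?mulr_ge0 ?powR_ge0//.
  by rewrite powRM ?powR_ge0// -powRrM mulVf ?gt_eqF// powRr1// ltW.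
have -> // : \int[mu]_x `|(EFin \o G) x| `^ (p / (p - 1)) =
    \int[mu]_x (f x `^ (p / (p - 1)) * dual_weight p w x)%:E.
apply: eq_integral => x _; rewrite /= /G ger0_norm ?mulr_ge0 ?powR_ge0//.
rewrite powRM ?powR_ge0// -powRrM; congr (_ * _ `^ _)%:E.
by field; rewrite !gt_eqF.
Qed.

(** The previous inequality with the indicator of [A] as the function in L^p'(sigma), raised to the
    power [p]. *)
Lemma weighted_hoelder (A : set T) (f : T -> R) : measurable A ->
  measurable_fun setT f -> (forall x, (0 <= f x)%R) ->
  (\int[mu]_(x in A) (f x)%:E) `^ p <=
  \int[mu]_(x in A) (f x `^ p * w x)%:E *
  (\int[mu]_(x in A) (dual_weight p w x)%:E) `^ (p - 1).
Proof.
move=> mA mf f0; have q0 : (0 < p / (p - 1))%R by rewrite divr_gt0.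
have mI : measurable_fun setT (\1_A : T -> R) by exact: measurable_indic.
have fI x : (0 <= (f \* \1_A) x)%R by rewrite mulr_ge0.
have := weighted_hoelder2 mI (fun x => ler0n R (x \in A)) (measurable_funM mf mI) fI.
have -> : \int[mu]_x (\1_A x * (f \* \1_A) x)%:E = \int[mu]_(x in A) (f x)%:E.
  rewrite [RHS]integral_mkcond; apply: eq_integral => x _.
  by rewrite /patch /= indicE; case: ifP; rewrite ?mul1r ?mulr1 ?mul0r.
have -> : \int[mu]_x ((f \* \1_A) x `^ p * w x)%:E = \int[mu]_(x in A) (f x `^ p * w x)%:E.
  rewrite [RHS]integral_mkcond; apply: eq_integral => x _.
  by rewrite /patch /= indicE; case: ifP; rewrite ?mulr1// mulr0 powR0 ?mul0r ?gt_eqF.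
have -> : \int[mu]_x (\1_A x `^ (p / (p - 1)) * dual_weight p w x)%:E =
    \int[mu]_(x in A) (dual_weight p w x)%:E.
  rewrite [RHS]integral_mkcond; apply: eq_integral => x _.
  by rewrite /patch indicE; case: ifP; rewrite ?powR1 ?mul1r ?powR0 ?mul0r ?gt_eqF.
have I0 : 0 <= \int[mu]_(x in A) (f x)%:E by apply: integral_ge0 => x _; rewrite lee_fin.
have X0 : 0 <= \int[mu]_(x in A) (f x `^ p * w x)%:E.
  by apply: integral_ge0 => x _; rewrite lee_fin mulr_ge0 ?powR_ge0// ltW.
move=> /(lee_poweR (ltW p0) I0)/le_trans; apply.
rewrite poweRM ?poweR_ge0// -!poweRrM mulVf ?gt_eqF// poweRe1//.
by rewrite invf_div divfK ?gt_eqF.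
Qed.

End dual_weight.

Section muckenhoupt_doubling.
Context d (T : measurableType d) (R : realType) (p : R) (p1 : (1 < p)%R).
Variable w : T -> R.
Hypotheses (mw : measurable_fun setT w) (w0 : forall x, (0 < w x)%R).
Variable mu : {measure set T -> \bar R}.
Variables (B B' : set T) (m A : R).
Hypotheses (mB : measurable B) (mB' : measurable B') (BB' : B `<=` B').
Hypotheses (muB : mu B = m%:E) (m0 : (0 < m)%R) (A0 : (0 < A)%R).
Hypothesis Ap : \int[mu]_(x in B') (w x)%:E *
  (\int[mu]_(x in B') (dual_weight p w x)%:E) `^ (p - 1) <= (A * m `^ p)%:E.

Let p10 : (0 < p - 1)%R. Proof. by rewrite subr_gt0. Qed.

(** Hoelder's inequality for the constant 1 gives m^p <= w(B) sigma(B)^(p-1), and sigma(B) <=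
    sigma(B'). Compared with the condition on [B'], the factor sigma(B')^(p-1) cancels. It may be
    cancelled because the two inequalities also force all these masses to be positive, and w(B') and
    sigma(B')^(p-1) to be finite. *)
Lemma muckenhoupt_doubling : exists2 W : R, (0 < W)%R &
  \int[mu]_(x in B) (w x)%:E = W%:E /\
  \int[mu]_(x in B') (w x)%:E <= (A * W)%:E.
Proof.
have w0' x : 0 <= (w x)%:E by rewrite lee_fin ltW.
have s0' x : 0 <= (dual_weight p w x)%:E by rewrite lee_fin ltW// dual_weight_gt0.
have := weighted_hoelder p1 mw w0 mu mB (measurable_cst (1 : R)%R) (fun=> ler01).
have -> : \int[mu]_(x in B) ((cst 1 x : R) `^ p * w x)%:E = \int[mu]_(x in B) (w x)%:E.
  by apply: eq_integral => x _; rewrite powR1 mul1r.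
have -> : \int[mu]_(x in B) (cst 1 x : R)%:E = m%:E.
  by rewrite -muB -[RHS]mul1e -integral_cst.
rewrite poweR_EFin.
have WW' := ge0_subset_integralW mu (fun x _ => w0' x) BB'.
have SS' := ge0_subset_integralW mu (fun x _ => s0' x) BB'.
have W0 : 0 <= \int[mu]_(x in B) (w x)%:E by exact: integral_ge0.
have S0 : 0 <= \int[mu]_(x in B) (dual_weight p w x)%:E by exact: integral_ge0.
set W := \int[mu]_(x in B) (w x)%:E in WW' W0 *.
set S := \int[mu]_(x in B) _ in SS' S0 *.
move: Ap WW' SS'; set W' := \int[mu]_(x in B') (w x)%:E.
set S' := \int[mu]_(x in B') _ => AP WW' SS' H.
have mp0 : (0 < m `^ p)%R by exact: powR_gt0.
have Wp : 0 < W.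
  rewrite lt0e W0 andbT; apply/eqP => Wz; move: H.
  by rewrite Wz mul0e lee_fin leNgt mp0.
have Sp : 0 < S.
  rewrite lt0e S0 andbT; apply/eqP => Sz; move: H.
  by rewrite Sz poweR0r ?gt_eqF// mule0 lee_fin leNgt mp0.
have W'p : 0 < W' by exact: lt_le_trans WW'.
have S'p : 0 < S' `^ (p - 1) by rewrite poweR_gt0// (lt_le_trans _ SS').
have S'fin : S' `^ (p - 1) < +oo.
  rewrite ltey; apply/eqP => E; move: AP.
  by rewrite E gt0_muley// leye_eq.
have W'fin : W' < +oo.
  rewrite ltey; apply/eqP => E; move: AP.
  by rewrite E gt0_mulye// leye_eq.
have Wfin : W < +oo by exact: le_lt_trans WW' W'fin.
have K : W' * S' `^ (p - 1) <= A%:E * (W * S' `^ (p - 1)).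
  apply: (le_trans AP); rewrite EFinM lee_wpmul2l ?lee_fin ?(ltW A0)//.
  apply: (le_trans H); rewrite lee_wpmul2l//.
  by apply: lee_poweR => //; exact: ltW.
case: W Wp Wfin {H WW' W0} K => [W| |//] Wp Wfin K //.
exists W => //; split=> //.
case: (S' `^ (p - 1)) S'p S'fin K => [s| |//] s0 _ //.
by rewrite muleA lee_pmul2r// EFinM.
Qed.

End muckenhoupt_doubling.

Section muckenhoupt_maximal.
Context d (T : measurableType d) (R : realType) (p : R) (p1 : (1 < p)%R).
Variable w : T -> R.
Hypotheses (mw : measurable_fun setT w) (w0 : forall x, (0 < w x)%R).
Variable mu : {measure set T -> \bar R}.
Variables (B B' : nat -> set T) (rho : nat -> R).
Hypotheses (mB : forall i, measurable (B i)) (mB' : forall i, measurable (B' i)).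
Hypothesis B0 : forall i, B i !=set0.
Hypothesis BB' : forall i j, (rho i <= rho j)%R -> B i `&` B j !=set0 ->
  B i `<=` B' j.
Variables (m : nat -> R) (A : R).
Hypotheses (muB : forall i, mu (B i) = (m i)%:E) (m0 : forall i, (0 < m i)%R).
Hypothesis A0 : (0 < A)%R.
Hypothesis Ap : forall i, \int[mu]_(x in B' i) (w x)%:E *
  (\int[mu]_(x in B' i) (dual_weight p w x)%:E) `^ (p - 1)
  <= (A * m i `^ p)%:E.

Let p10 : (0 < p - 1)%R. Proof. by rewrite subr_gt0. Qed.
Let p0 : (0 < p)%R. Proof. exact: lt_trans p1. Qed.
Let q := (p / (p - 1))%R.
Let q1 : (1 < q)%R. Proof. exact: conj_expo1. Qed.
Let q0 : (0 < q)%R. Proof. exact: lt_trans q1. Qed.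
Let s := dual_weight p w.
Let s0 x : (0 < s x)%R. Proof. exact: dual_weight_gt0. Qed.
Let ms : measurable_fun setT s. Proof. exact: measurable_dual_weight. Qed.

Let BsubB' i : B i `<=` B' i.
Proof. by apply: (BB' (lexx _)); rewrite setIid. Qed.

Let dbl_w i := muckenhoupt_doubling p1 mw w0 (mB i) (@BsubB' i) (muB i) (m0 i)
  A0 (@Ap i).

Let A' := (A `^ (p - 1)^-1)%R.
Let A'0 : (0 < A')%R. Proof. exact: powR_gt0. Qed.

Let Ap_dual i : \int[mu]_(x in B' i) (s x)%:E *
  (\int[mu]_(x in B' i) (dual_weight q s x)%:E) `^ (q - 1)
  <= (A' * m i `^ q)%:E.
Proof.
rewrite /s dual_dual_weight// EFinM -(poweR_EFin (m i)).
apply: dual_muckenhoupt => //; first exact: ltW.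
- by apply: integral_ge0 => x _; rewrite lee_fin ltW.
- by apply: integral_ge0 => x _; rewrite lee_fin ltW// dual_weight_gt0.
Qed.

Let dbl_s i := muckenhoupt_doubling q1 ms s0 (mB i) (@BsubB' i) (muB i) (m0 i)
  A'0 (@Ap_dual i).

Let W i := sval (cid2 (dbl_w i)).
Let W0 i : (0 < W i)%R. Proof. by rewrite /W; case: cid2. Qed.
Let WE i : \int[mu]_(x in B i) (w x)%:E = (W i)%:E.
Proof. by rewrite /W; case: cid2 => ? ? []. Qed.
Let W' i : \int[mu]_(x in B' i) (w x)%:E <= (A * W i)%:E.
Proof. by rewrite /W; case: cid2 => ? ? []. Qed.

Let S i := sval (cid2 (dbl_s i)).
Let S0 i : (0 < S i)%R. Proof. by rewrite /S; case: cid2. Qed.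
Let SE i : \int[mu]_(x in B i) (s x)%:E = (S i)%:E.
Proof. by rewrite /S; case: cid2 => ? ? []. Qed.
Let S' i : \int[mu]_(x in B' i) (s x)%:E <= (A' * S i)%:E.
Proof. by rewrite /S; case: cid2 => ? ? []. Qed.

Let WS i : (W i * S i `^ (p - 1) <= A * m i `^ p)%R.
Proof.
rewrite -lee_fin EFinM -poweR_EFin -WE -SE; apply: le_trans (@Ap i).
apply: lee_pmul.
- by apply: integral_ge0 => x _; rewrite lee_fin ltW.
- exact: poweR_ge0.
- by apply: ge0_subset_integralW => // x _; rewrite lee_fin ltW.
- apply: lee_poweR; first exact: ltW.
    by apply: integral_ge0 => x _; rewrite lee_fin ltW.
  by apply: ge0_subset_integralW => // x _; rewrite lee_fin ltW.
Qed.

Section pointwise_domination.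
Variable g : T -> \bar R.
Hypotheses (mg : measurable_fun setT g) (g0 : forall x, 0 <= g x).

(** Dividing by [s] makes the [s]-integral of [gs] the plain integral of [g], so [N] sees the
    averages of [g] with the [s]-mass in the denominator. Likewise dividing by [w] in [G] makes its
    [w]-integral the plain integral of N^(p-1). *)
Let gs x := g x * ((s x)^-1)%:E.
Let N := wmax mu B s S gs.
Let G x := N x `^ (p - 1) * ((w x)^-1)%:E.

Let gs0 x : 0 <= gs x.
Proof. by rewrite mule_ge0// lee_fin invr_ge0 ltW. Qed.

Let mgs : measurable_fun setT gs.
Proof.
apply: emeasurable_funM => //; apply/measurable_EFinP.
under eq_fun do rewrite -powR_inv1 ?(ltW (s0 _))//.
exact: (measurableT_comp (measurable_powR _)).
Qed.

Let N0 x : 0 <= N x.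
Proof. by apply: wmax_ge0 => // y; exact: ltW. Qed.
Let mN : measurable_fun setT N. Proof. exact: measurable_wmax. Qed.

Let mG : measurable_fun setT G.
Proof.
apply: emeasurable_funM.
  exact: measurableT_comp (measurable_poweR _) mN.
apply/measurable_EFinP.
under eq_fun do rewrite -powR_inv1 ?(ltW (w0 _))//.
exact: (measurableT_comp (measurable_powR _)).
Qed.

Let G0 x : 0 <= G x.
Proof. by rewrite mule_ge0 ?poweR_ge0// lee_fin invr_ge0 ltW. Qed.

(* Lerner's argument: the unweighted maximal function is controlled by two
   weighted ones, each bounded with respect to its own measure. *)
Lemma wmax_le_wmax x : wmax mu B (cst 1%R) m g x <=
  (A%:E * wmax mu B w W G x) `^ (p - 1)^-1.
Proof.
apply: ge_ereal_sup => _ [i _ <-]; case: ifPn => [|_]; last exact: poweR_ge0.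
rewrite inE => Bix.
have -> : \int[mu]_(y in B i) (g y * (cst 1%R y)%:E) = \int[mu]_(y in B i) (gs y * (s y)%:E).
  apply: eq_integral => y _; rewrite mule1 /gs -muleA -EFinM mulVf ?mule1//.
  by rewrite gt_eqF.
set I := \int[mu]_(y in B i) _.
have I0 : 0 <= I by apply: integral_ge0 => y _; rewrite mule_ge0// lee_fin ltW.
have IN y : B i y -> I `^ (p - 1) <= (S i `^ (p - 1))%:E * N y `^ (p - 1).
  move=> Biy; rewrite -poweR_EFin -poweRM//; last by rewrite lee_fin ltW.
  apply: lee_poweR => //; first exact: ltW.
  exact: wmax_ge.
(* The bound [IN] holds at every point of [B i] while its left side is constant, so it can be
   integrated over the ball; [WS] then trades the masses of [s] and [w] for the volume. *)
have : I `^ (p - 1) * (m i)%:E <= (A * m i `^ p)%:E * wmax mu B w W G x.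
  rewrite -muB -integral_cst//.
  apply: (@le_trans _ _ (\int[mu]_(y in B i) ((S i `^ (p - 1))%:E * (G y * (w y)%:E)))).
    apply: ge0_le_integralW => y Biy; first exact: poweR_ge0.
    apply: le_trans (IN y Biy) _.
    by rewrite /G -muleA -EFinM mulVf ?mule1// gt_eqF.
  rewrite ge0_integralZl//; last 3 first.
  - apply: measurable_funTS; apply: emeasurable_funM => //; exact/measurable_EFinP.
  - by move=> y _; rewrite mule_ge0// lee_fin ltW.
  - by rewrite lee_fin powR_ge0.
  apply: (@le_trans _ _ ((S i `^ (p - 1))%:E * ((W i)%:E * wmax mu B w W G x))).
    apply: lee_wpmul2l; first by rewrite lee_fin powR_ge0.
    exact: wmax_ge.
  rewrite muleA -EFinM mulrC; apply: lee_wpmul2r; first by apply: wmax_ge0 => // y; exact: ltW.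
  by rewrite lee_fin WS.
have -> : (m i `^ p = m i * m i `^ (p - 1))%R by rewrite mulr_powRB1// ltW.
rewrite mulrCA (EFinM (m i)) -muleA (muleC _ (m i)%:E) lee_pmul2l ?lte_fin// => H.
have xE (y : \bar R) : 0 <= y -> y = (y `^ (p - 1)) `^ (p - 1)^-1.
  by move=> y0; rewrite -poweRrM mulfV ?gt_eqF// poweRe1.
rewrite [leLHS]xE; last by rewrite mule_ge0// lee_fin invr_ge0 ltW.
apply: lee_poweR.
- by rewrite invr_ge0 ltW.
- exact: poweR_ge0.
rewrite poweRM//; last by rewrite lee_fin invr_ge0 ltW.
rewrite poweR_EFin -(@lee_pmul2l _ (m i `^ (p - 1))%:E)//; last by rewrite lte_fin powR_gt0.
rewrite muleA -EFinM -powRM ?invr_ge0 ?(ltW (m0 i))// mulfV ?gt_eqF// powR1 mul1e.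
by apply: le_trans H _; rewrite EFinM -muleA muleCA.
Qed.

(** The exponents match: the power 1 / (p - 1) of the domination turns L^p(w) into L^q(w) for the
    [w]-maximal function; then G^q w = N^p s, because w^(1-q) = s, and finally (g / s)^p s = g^p w.
    Each of the two weighted maximal functions contributes one constant of [wmax_strong]. *)
Lemma muckenhoupt_wmax_le :
  \int[mu]_x (wmax mu B (cst 1%R) m g x `^ p * (w x)%:E) <=
  (A `^ q * ((2 `^ q * (2 * A * ((1 - 2 `^ (- (q - 1)))^-1 * 2 `^ (q - 1)))) *
     (2 `^ p * (2 * A' * ((1 - 2 `^ (- (p - 1)))^-1 * 2 `^ (p - 1))))))%:E *
  \int[mu]_x (g x `^ p * (w x)%:E).
Proof.
have mWG : measurable_fun setT (wmax mu B w W G) by exact: measurable_wmax.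
have WG0 x : 0 <= wmax mu B w W G x by apply: wmax_ge0 => // y; exact: ltW.
apply: (@le_trans _ _ (\int[mu]_x ((A%:E * wmax mu B w W G x) `^ q * (w x)%:E))).
  apply: ge0_le_integralW => x _.
    by rewrite mule_ge0 ?poweR_ge0// lee_fin ltW.
  apply: lee_wpmul2r; first by rewrite lee_fin ltW.
  rewrite (_ : q = ((p - 1)^-1 * p)%R); last by rewrite /q mulrC.
  rewrite poweRrM; apply: lee_poweR; [exact: ltW| |exact: wmax_le_wmax].
  by apply: wmax_ge0 => //; exact: ler01.
rewrite (integral_poweR_scale _ _ (ltW A0) mWG WG0 mw (fun x => ltW (w0 x))).
rewrite EFinM -muleA; apply: lee_wpmul2l; first by rewrite lee_fin powR_ge0.
apply: le_trans (wmax_strong mB mB' B0 BB' mw _ WE W0 A0 W' mG G0 q1) _.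
  by move=> x; exact: ltW.
rewrite [in leRHS]EFinM -[leRHS]muleA; apply: lee_wpmul2l.
  rewrite lee_fin !mulr_ge0 ?powR_ge0 ?(ltW A0)// invr_ge0 subr_ge0 powRN.
  rewrite invf_le1 ?powR_gt0// -[leLHS](powRr0 2) ler_powR ?ler1n//.
  by rewrite subr_ge0 ltW.
have -> : \int[mu]_x (G x `^ q * (w x)%:E) = \int[mu]_x (N x `^ p * (s x)%:E).
  apply: eq_integral => x _; rewrite /G poweRM ?poweR_ge0//; last by rewrite lee_fin invr_ge0 ltW.
  rewrite -poweRrM mulrC /q mulfVK ?gt_eqF// -muleA poweR_EFin -EFinM.
  congr (_ * _%:E); rewrite -powR_inv1 ?(ltW (w0 x))// -powRrM mulN1r.
  rewrite -[X in (_ * X)%R](@powRr1 _ (w x)) ?(ltW (w0 x))// -powRD; last first.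
    by rewrite (gt_eqF (w0 x)) implybT.
  rewrite /s /dual_weight; congr (_ `^ _)%R.
  by rewrite -[in RHS]conj_expo_sub1// opprB addrC.
apply: le_trans (wmax_strong mB mB' B0 BB' ms _ SE S0 A'0 S' mgs gs0 p1) _.
  by move=> x; exact: ltW.
apply: eq_leW; congr (_ * _).
apply: eq_integral => x _; rewrite /gs poweRM//; last by rewrite lee_fin invr_ge0 ltW.
rewrite -muleA poweR_EFin -EFinM; congr (_ * _%:E).
rewrite -powR_inv1 ?(ltW (s0 x))// -powRrM mulN1r.
rewrite -[X in (_ * X)%R](@powRr1 _ (s x)) ?(ltW (s0 x))// -powRD; last first.
  by rewrite (gt_eqF (s0 x)) implybT.
by rewrite addrC -opprB powRN /s dual_weightK// invrK.
Qed.

End pointwise_domination.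
End muckenhoupt_maximal.

(** * Averages over balls *)

Definition dball (R : realType) (T : Type) (dist : T -> T -> R) (x : T) (r : R) : set T :=
  [set y | (dist x y < r)%R].

(* Hyperbolic [n]-space enters the argument only through these properties, with
   [kappa = n - 1]. *)
Record growth_space d (T : measurableType d) (R : realType)
    (mu : {measure set T -> \bar R}) (dist : T -> T -> R) (kappa : R) : Prop :=
  GrowthSpace {
  dist_xx : forall x, dist x x = 0%R;
  dist_sym : forall x y, dist x y = dist y x;
  dist_triangle : forall x y z, (dist x z <= dist x y + dist y z)%R;
  measurable_dist_lt : forall r, measurable [set z : T * T | (dist z.1 z.2 < r)%R];
  dist_separable : exists c : nat -> T,
    forall x e, (0 < e)%R -> exists i, (dist x (c i) < e)%R;
  growth_rate_gt0 : (0 < kappa)%R;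
  small_balls : exists c C : R, exists nu : nat, (0 < c)%R /\
    forall x r, (0 < r <= 1)%R ->
    (c * r ^+ nu)%:E <= mu (dball dist x r) <= (C * r ^+ nu)%:E;
  large_balls : exists c C : R, (0 < c)%R /\
    forall x r, (1 <= r)%R ->
    (c * expR (kappa * r))%:E <= mu (dball dist x r) <= (C * expR (kappa * r))%:E
}.

Section growth_space.
Context d (T : measurableType d) (R : realType).
Variables (mu : {sigma_finite_measure set T -> \bar R}) (dist : T -> T -> R).
Variables (kappa : R) (GS : growth_space mu dist kappa).
Local Notation ball := (dball dist).

Lemma dball_center x r : (0 < r)%R -> ball x r x.
Proof. by rewrite /dball/= (dist_xx GS). Qed.

Lemma dball_sub x y r s : (dist x y + r <= s)%R -> ball y r `<=` ball x s.
Proof.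
move=> xys z; rewrite /dball/= => yz.
by have := dist_triangle GS x y z; lra.
Qed.

Lemma dball_subr x r s : (r <= s)%R -> ball x r `<=` ball x s.
Proof. by move=> rs y /lt_le_trans; exact. Qed.

Lemma measurable_dball x r : measurable (ball x r).
Proof.
have := measurable_xsection x (measurable_dist_lt GS r).
rewrite (_ : xsection _ _ = ball x r)//.
by apply/seteqP; split => y; rewrite /xsection/= inE.
Qed.

(** Radii between [r0] and 1 are handled by monotonicity: from below by the ball of radius
    [min r0 1], from above by the unit ball. There exp(kappa r) varies only between 1 and
    exp(kappa), which the constants absorb. *)
Lemma ball_growth (r0 : R) : (0 < r0)%R -> exists c C : R,
  [/\ (0 < c)%R, (0 < C)%R & forall x r, (r0 <= r)%R ->
   (c * expR (kappa * r))%:E <= mu (ball x r) <= (C * expR (kappa * r))%:E].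
Proof.
move=> r00.
have [c1 [C1 [nu [c10 small]]]] := small_balls GS.
have [c2 [C2 [c20 large]]] := large_balls GS.
have k0 := growth_rate_gt0 GS.
pose r1 := Num.min r0 1%R.
have r10 : (0 < r1 <= 1)%R by rewrite lt_min r00 ltr01 ge_min lexx orbT.
have r1r0 : (r1 <= r0)%R by rewrite ge_min lexx.
have e0 : (0 < expR kappa)%R by exact: expR_gt0.
have cr0 : (0 < c1 * r1 ^+ nu)%R by rewrite mulr_gt0 ?exprn_gt0//; case/andP: r10.
exists (Num.min c2 (c1 * r1 ^+ nu / expR kappa))%R, (C2 * expR kappa)%R.
have x0 : T by exact: point.
have C20 : (0 < C2)%R.
  have /andP[+ _] := large x0 1%R (lexx _); have /andP[_ +] := large x0 1%R (lexx _).
  move=> /[swap] /le_trans /[apply]; rewrite lee_fin ler_pM2r ?expR_gt0//.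
  exact: lt_le_trans.
split.
- by rewrite lt_min c20 divr_gt0.
- by rewrite mulr_gt0.
move=> x r r0r; have [r1'|r1'] := leP 1%R r.
  have /andP[H1 H2] := large x r r1'.
  rewrite (le_trans _ H1)/= ?(le_trans H2)//.
    rewrite lee_fin ler_pM2r ?expR_gt0// ler_peMr ?(ltW C20)//.
    by rewrite -expR0 ler_expR ltW.
  by rewrite lee_fin ler_pM2r ?expR_gt0// ge_min lexx.
apply/andP; split.
  have /andP[H1 _] := small x r1 r10.
  have sub : mu (ball x r1) <= mu (ball x r).
    apply: le_measure; rewrite ?inE; [exact: measurable_dball..|].
    by apply: dball_subr; lra.
  apply: le_trans sub; apply: le_trans H1; rewrite lee_fin.
  apply: (@le_trans _ _ (c1 * r1 ^+ nu / expR kappa * expR (kappa * r)))%R.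
    by rewrite ler_pM2r ?expR_gt0// ge_min lexx orbT.
  rewrite -mulrA ler_piMr ?(ltW cr0)// mulrC ler_pdivrMr// mul1r ler_expR.
  by rewrite ler_piMr// ltW.
have /andP[_ H2] := large x 1%R (lexx _).
have sub : mu (ball x r) <= mu (ball x 1%R).
  apply: le_measure; rewrite ?inE; [exact: measurable_dball..|].
  by apply: dball_subr; lra.
apply: le_trans sub _; apply: le_trans H2 _; rewrite lee_fin mulr1 -mulrA.
rewrite ler_pM2l// ler_peMr ?(ltW e0)// -expR0 ler_expR.
by rewrite mulr_ge0 ?(ltW k0)//; lra.
Qed.

Lemma dball_measure_gt0 x r : (0 < r)%R -> 0 < mu (ball x r).
Proof.
move=> r0; have [c [C [c0 C0 H]]] := ball_growth r0.
have /andP[+ _] := H x r (lexx _); apply: lt_le_trans.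
by rewrite lte_fin mulr_gt0// expR_gt0.
Qed.

Lemma dball_measure_lty x r : mu (ball x r) < +oo.
Proof.
have [r0|r0] := ltP 0%R r.
  have [c [C [c0 C0 H]]] := ball_growth r0.
  by have /andP[_ /le_lt_trans] := H x r (lexx _); apply; exact: ltry.
have [c [C [c0 C0 H]]] := ball_growth (ltr01 : (0 < 1 :> R)%R).
have /andP[_ H1] := H x 1%R (lexx _); apply: le_lt_trans (ltry _).
apply: le_trans H1; apply: le_measure; rewrite ?inE; [exact: measurable_dball..|].
by apply: dball_subr; lra.
Qed.

(** Left unnormalized, the operator is self-adjoint by the symmetry of [dist] alone, without knowing
    that balls of equal radius have equal volume. *)
Definition ball_int (r : R) (f : T -> \bar R) (x : T) : \bar R :=
  \int[mu]_(y in ball x r) f y.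

Section ball_int.
Implicit Types f g : T -> \bar R.

Let kern r f (z : T * T) : \bar R := if (dist z.1 z.2 < r)%R then f z.2 else 0.

Let mkern r f : measurable_fun setT f -> measurable_fun setT (kern r f).
Proof.
move=> mf; apply: (measurable_fun_ifT (f := fun z : T * T => (dist z.1 z.2 < r)%R)) => //.
  apply: (measurable_fun_bool true); rewrite setTI; exact: (measurable_dist_lt GS r).
exact: (measurableT_comp mf measurable_snd).
Qed.

Let ball_intE r f x : ball_int r f x = \int[mu]_y kern r f (x, y).
Proof.
rewrite /ball_int integral_mkcond; apply: eq_integral => y _.
rewrite /patch /kern/=; case: ifPn; first by rewrite inE /dball/= => ->.
by rewrite notin_setE /dball/= => /negP/negbTE ->.
Qed.

Let kern_ge0 r f z : (forall x, 0 <= f x) -> 0 <= kern r f z.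
Proof. by move=> f0; rewrite /kern; case: ifP. Qed.

Lemma ball_int_ge0 r f x : (forall x, 0 <= f x) -> 0 <= ball_int r f x.
Proof. by move=> f0; exact: integral_ge0. Qed.

Lemma measurable_ball_int r f : measurable_fun setT f -> (forall x, 0 <= f x) ->
  measurable_fun setT (ball_int r f).
Proof.
move=> mf f0; rewrite (_ : ball_int r f = fubini_F mu (kern r f)).
  apply: measurable_fun_fubini_tonelli_F; first exact: mkern.
  by move=> z; exact: kern_ge0.
by apply/funext => x; rewrite ball_intE.
Qed.

Lemma ball_int_sym r f g :
  measurable_fun setT f -> (forall x, 0 <= f x) ->
  measurable_fun setT g -> (forall x, 0 <= g x) ->
  \int[mu]_x (ball_int r f x * g x) = \int[mu]_x (f x * ball_int r g x).
Proof.
move=> mf f0 mg g0.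
pose h (z : T * T) := kern r f z * g z.1.
have mh : measurable_fun setT h.
  by apply: emeasurable_funM; [exact: mkern|exact: (measurableT_comp mg measurable_fst)].
have h0 z : 0 <= h z by rewrite mule_ge0// kern_ge0.
have := @fubini_tonelli _ _ _ _ _ mu mu h mh h0; rewrite /fubini_F /fubini_G => E.
transitivity (\int[mu]_x \int[mu]_y h (x, y)).
  apply: eq_integral => x _; rewrite ball_intE -ge0_integralZr.
  - by [].
  - exact: measurableT.
  - exact: measurableT_comp (mkern r mf) (measurable_pair1 x).
  - by move=> y _; exact: kern_ge0.
  - exact: g0.
rewrite E; apply: eq_integral => y _; rewrite ball_intE -ge0_integralZl; last 4 first.
- exact: measurableT.
- exact: measurableT_comp (mkern r mg) (measurable_pair1 y).
- by move=> x _; exact: kern_ge0.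
- exact: f0.
apply: eq_integral => x _; rewrite /h /kern/= (dist_sym GS x y).
by case: ifP => _; rewrite ?mule0 ?mul0e.
Qed.

(** By symmetry the inner average is moved to the indicator of the ball of radius [r + s]. At a
    point of [ball x r] that average is the volume of a whole ball of radius [s], which is at least
    [v]. *)
Lemma ball_int_comp (r s v : R) f x : (forall z, v%:E <= mu (ball z s)) ->
  (0 <= v)%R -> measurable_fun setT f -> (forall x, 0 <= f x) ->
  v%:E * ball_int r f x <= ball_int (r + s) (ball_int s f) x.
Proof.
move=> vs v0 mf f0.
pose g y : \bar R := (\1_(ball x (r + s)) y)%:E.
have mg : measurable_fun setT g.
  by apply/measurable_EFinP; exact: measurable_indic (measurable_dball _ _).
have g0 y : 0 <= g y by rewrite lee_fin.
have -> : ball_int (r + s) (ball_int s f) x = \int[mu]_y (ball_int s f y * g y).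
  rewrite /ball_int integral_mkcond; apply: eq_integral => y _.
  by rewrite /patch /g indicE; case: ifP; rewrite ?mule1 ?mule0.
rewrite ball_int_sym// -ge0_integralZl//; last 2 first.
- exact: measurable_dball.
- exact: measurable_funTS.
rewrite integral_mkcond; apply: ge0_le_integralW => y _.
  by apply: erestrict_ge0 => z _; rewrite mule_ge0.
rewrite /patch; case: ifPn => [|_]; last by rewrite mule_ge0// ball_int_ge0.
rewrite inE => xy; rewrite muleC lee_wpmul2l//.
rewrite /ball_int (eq_integral (cst 1)).
  by rewrite integral_cst; [rewrite mul1e; exact: vs|exact: measurable_dball].
move=> z; rewrite inE => yz; rewrite /g indicE mem_set//.
by apply: (dball_sub _ yz); rewrite lerD2r ltW.
Qed.

End ball_int.
End growth_space.

(** * Averages and maximal function at small radii *)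

Section local_theory.
Context d (T : measurableType d) (R : realType).
Variables (mu : {sigma_finite_measure set T -> \bar R}) (dist : T -> T -> R).
Variables (kappa : R) (GS : growth_space mu dist kappa).
Local Notation ball := (dball dist).
Local Notation ball_int := (ball_int mu dist).
Variables (p : R) (w : T -> R) (A : R).
Hypotheses (p1 : (1 < p)%R) (mw : measurable_fun setT w).
Hypotheses (w0 : forall x, (0 < w x)%R) (A0 : (0 < A)%R).
Hypothesis Ap : forall x r, (0 < r <= 1)%R ->
  \int[mu]_(y in ball x r) (w y)%:E *
  (\int[mu]_(y in ball x r) (dual_weight p w y)%:E) `^ (p - 1)
  <= A%:E * mu (ball x r) `^ p.

Let p10 : (0 < p - 1)%R. Proof. by rewrite subr_gt0. Qed.
Let p0 : (0 < p)%R. Proof. exact: lt_trans p1. Qed.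
Let s := dual_weight p w.
Let s0 x : (0 < s x)%R. Proof. exact: dual_weight_gt0. Qed.
Let ms : measurable_fun setT s. Proof. exact: measurable_dual_weight. Qed.

(** Hoelder's inequality on [ball x r] bounds the integrand by the average of [F] times [S]. By
    symmetry the average is moved to [S], where it is bounded: the balls of radius [r] about points
    of [ball x r] lie in [ball x (2 * r)], whose radius is at most 1, so the local condition applies
    to it. *)
Lemma local_average_bound (r : R) : (0 < r)%R -> (r <= 2^-1)%R ->
  exists2 C : R, (0 < C)%R & forall f : T -> R, measurable_fun setT f ->
    (forall x, (0 <= f x)%R) ->
    \int[mu]_x (ball_int r (EFin \o f) x `^ p * (w x)%:E) <=
    C%:E * \int[mu]_x ((f x)%:E `^ p * (w x)%:E).
Proof.
move=> r0 r12.
have r20 : (0 < 2 * r)%R by rewrite mulr_gt0.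
have [c [C [c0 C0 HV]]] := ball_growth GS r20.
pose V := (C * expR (kappa * (2 * r)))%R.
have V0 : (0 < V)%R by rewrite mulr_gt0// expR_gt0.
exists (A * V `^ p)%R; first by rewrite mulr_gt0// powR_gt0.
move=> f mf f0.
pose S x := ball_int r (EFin \o s) x `^ (p - 1) * (w x)%:E.
pose F x := (f x `^ p * w x)%:E.
have mS : measurable_fun setT S.
  apply: emeasurable_funM; last exact/measurable_EFinP.
  apply: (measurableT_comp (measurable_poweR _)).
  apply: (measurable_ball_int GS); first exact/measurable_EFinP.
  by move=> x; rewrite lee_fin ltW.
have S0 x : 0 <= S x by rewrite mule_ge0 ?poweR_ge0// lee_fin ltW.
have mF : measurable_fun setT F.
  apply/measurable_EFinP; apply: measurable_funM => //.
  exact: (measurableT_comp (measurable_powR _)).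
have F0 x : 0 <= F x by rewrite lee_fin mulr_ge0 ?powR_ge0// ltW.
apply: (@le_trans _ _ (\int[mu]_x (ball_int r F x * S x))).
  apply: ge0_le_integralW => x _; first by rewrite mule_ge0 ?poweR_ge0// lee_fin ltW.
  rewrite /S muleA; apply: lee_wpmul2r; first by rewrite lee_fin ltW.
  exact: (weighted_hoelder p1 mw w0 mu (measurable_dball GS x r) mf f0).
rewrite (ball_int_sym GS)//.
have SB x : ball_int r S x <= (A * V `^ p)%:E.
  have [I1 I0] : \int[mu]_(y in ball x (2 * r)) (s y)%:E = \int[mu]_(y in ball x (2 * r)) (s y)%:E
    /\ 0 <= \int[mu]_(y in ball x (2 * r)) (s y)%:E.
    by split=> //; apply: integral_ge0 => y _; rewrite lee_fin ltW.
  apply: (@le_trans _ _ (\int[mu]_(y in ball x r)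
     ((\int[mu]_(y in ball x (2 * r)) (s y)%:E) `^ (p - 1) * (w y)%:E))).
    apply: ge0_le_integralW => y xy //.
    apply: lee_wpmul2r; first by rewrite lee_fin ltW.
    apply: lee_poweR; first exact: ltW.
      by apply: integral_ge0 => z _; rewrite lee_fin ltW.
    apply: ge0_subset_integralW; first by move=> z _; rewrite lee_fin ltW.
    by apply: (dball_sub GS); move: xy; rewrite /dball/=; lra.
  rewrite ge0_integralZl; last 4 first.
  - exact: (measurable_dball GS).
  - by apply: measurable_funTS; exact/measurable_EFinP.
  - by move=> y _; rewrite lee_fin ltW.
  - exact: poweR_ge0.
  apply: (@le_trans _ _ (\int[mu]_(y in ball x (2 * r)) (w y)%:E *
    (\int[mu]_(y in ball x (2 * r)) (s y)%:E) `^ (p - 1))).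
    rewrite muleC; apply: lee_wpmul2r; first exact: poweR_ge0.
    apply: ge0_subset_integralW; first by move=> z _; rewrite lee_fin ltW.
    by apply: dball_subr; lra.
  apply: le_trans (Ap _ _) _; first by rewrite r20/=; lra.
  rewrite EFinM; apply: lee_wpmul2l; first by rewrite lee_fin ltW.
  rewrite -poweR_EFin; apply: lee_poweR => //; first exact: ltW.
  by have /andP[] := HV x (2 * r)%R (lexx _).
apply: (@le_trans _ _ (\int[mu]_x ((A * V `^ p)%:E * F x))).
  apply: ge0_le_integralW => x _.
    by rewrite mule_ge0//; exact: ball_int_ge0.
  by rewrite muleC; apply: lee_wpmul2r.
rewrite ge0_integralZl//.
by rewrite lee_fin mulr_ge0 ?powR_ge0// ltW.
Qed.

(** Countably many balls suffice up to a constant: centres in a dense sequence and radii 2^-k / 3.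
    Two such balls that meet satisfy the engulfing property with the enlarged radius 2^-k, which
    stays at most 1, within reach of the local condition. *)
Lemma local_maximal_bound : exists (M : (T -> \bar R) -> T -> \bar R) (C : R),
  (0 < C)%R /\ forall g, measurable_fun setT g -> (forall x, 0 <= g x) ->
  [/\ measurable_fun setT (M g), forall x, 0 <= M g x,
    forall x r, (0 < r < 6^-1)%R -> (mu (ball x r))^-1 * ball_int r g x <= M g x
  & \int[mu]_x (M g x `^ p * (w x)%:E) <= C%:E * \int[mu]_x (g x `^ p * (w x)%:E)].
Proof.
have [c1 [C1 [nu [c10 small]]]] := small_balls GS.
have [c csep] := dist_separable GS.
have C10 : (0 < C1)%R.
  have x0 : T by exact: point.
  have /andP[a b] := small x0 1%R (introT andP (conj ltr01 (lexx _))).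
  have := le_trans a b; rewrite lee_fin !expr1n !mulr1; exact: lt_le_trans.
(* Enumerates the pairs (centre, scale). The default value at integers that encode no pair only
   repeats a ball. *)
pose ik (n : nat) : nat * nat := odflt (0%N, 0%N) (unpickle n).
have ikK i k : ik (pickle (i, k)) = (i, k) by rewrite /ik pickleK.
pose rho' n : R := (2^-1 ^+ (ik n).2)%R.
have rho'0 n : (0 < rho' n)%R by rewrite exprn_gt0.
have rho'1 n : (rho' n <= 1)%R by rewrite exprn_ile1//; lra.
pose rho n : R := (rho' n / 3)%R.
have rho0 n : (0 < rho n)%R by rewrite divr_gt0.
pose B n := ball (c (ik n).1) (rho n).
pose B' n := ball (c (ik n).1) (rho' n).
have mB n : measurable (B n) by exact: (measurable_dball GS).
have mB' n : measurable (B' n) by exact: (measurable_dball GS).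
have B0 n : B n !=set0 by exists (c (ik n).1); exact: (dball_center GS).
have BB' i j : (rho i <= rho j)%R -> B i `&` B j !=set0 -> B i `<=` B' j.
  move=> rij [y []]; rewrite /B /B' /dball/= => iy jy.
  apply: (dball_sub GS); rewrite (dist_sym GS) in iy.
  have := dist_triangle GS (c (ik j).1) y (c (ik i).1).
  by rewrite /rho in iy jy rij *; lra.
pose m n := fine (mu (B n)).
have muB n : mu (B n) = (m n)%:E.
  by rewrite fineK// ge0_fin_numE// (dball_measure_lty GS).
have m0 n : (0 < m n)%R by rewrite -lte_fin -muB; exact: (dball_measure_gt0 GS).
have mlow n : (c1 * rho n ^+ nu <= m n)%R.
  rewrite -lee_fin -muB; have := rho'1 n => r1.
  have /(small (c (ik n).1))/andP[] // : (0 < rho n <= 1)%R.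
  by rewrite rho0/= /rho; lra.
have mup n : (m n <= C1 * rho n ^+ nu)%R.
  rewrite -lee_fin -muB; have := rho'1 n => r1.
  have /(small (c (ik n).1))/andP[] // : (0 < rho n <= 1)%R.
  by rewrite rho0/= /rho; lra.
(* Bounds the volume of the tripled ball [B' n] by that of [B n], so that the local condition on
   [B' n] can be expressed by [m n]. *)
pose D : R := (C1 * 3 ^+ nu / c1)%R.
have D0 : (0 < D)%R by rewrite divr_gt0// mulr_gt0// exprn_gt0.
pose A1 := (A * D `^ p)%R.
have A10 : (0 < A1)%R by rewrite mulr_gt0// powR_gt0.
have Ap' n : \int[mu]_(y in B' n) (w y)%:E *
  (\int[mu]_(y in B' n) (dual_weight p w y)%:E) `^ (p - 1) <= (A1 * m n `^ p)%:E.
  apply: le_trans (Ap _ _) _; first by rewrite rho'0 rho'1.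
  rewrite /A1 -mulrA EFinM; apply: lee_wpmul2l; first by rewrite lee_fin ltW.
  rewrite -powRM ?(ltW D0)// ?(ltW (m0 n))// -poweR_EFin.
  apply: lee_poweR => //; first exact: ltW.
  have /(small (c (ik n).1))/andP[_ H] : (0 < rho' n <= 1)%R by rewrite rho'0 rho'1.
  apply: le_trans H _; rewrite lee_fin /D mulrAC ler_pdivlMr//.
  apply: (@le_trans _ _ (C1 * 3 ^+ nu * (c1 * rho n ^+ nu))%R); last first.
    by rewrite ler_pM2l// mulr_gt0// exprn_gt0.
  rewrite /rho expr_div_n (_ : (C1 * 3 ^+ nu * _ = C1 * rho' n ^+ nu * c1 * (3 ^+ nu / 3 ^+ nu))%R); last by ring.
  by rewrite mulfV ?mulr1// expf_neq0.
have [K K0 HK] : exists2 K : R, (0 < K)%R & forall g, measurable_fun setT g ->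
    (forall x, 0 <= g x) ->
    \int[mu]_x (wmax mu B (cst 1%R) m g x `^ p * (w x)%:E) <=
    K%:E * \int[mu]_x (g x `^ p * (w x)%:E).
  have lt12 : (1 < 2 :> R)%R by rewrite ltr1n.
  eexists; last first.
    by move=> g mg g0; exact: (muckenhoupt_wmax_le p1 mw w0 mB mB' B0 BB' muB m0 A10 Ap' mg g0).
  have pos (e : R) : (0 < e)%R -> (0 < (1 - 2 `^ (- e))^-1)%R.
    move=> e0; rewrite invr_gt0 subr_gt0 powRN invf_lt1 ?powR_gt0//.
    have : (1 `^ e < 2 `^ e)%R by rewrite gt0_ltr_powR ?nnegrE.
    by rewrite powR1.
  have q1 : (0 < p / (p - 1) - 1)%R by rewrite subr_gt0 conj_expo1.
  by rewrite !mulr_gt0 ?powR_gt0 ?pos.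
pose E : R := (C1 * 4 ^+ nu / c1)%R.
have E0 : (0 < E)%R by rewrite divr_gt0// mulr_gt0// exprn_gt0.
exists (fun g x => E%:E * wmax mu B (cst 1%R) m g x), (E `^ p * K)%R.
split; first by rewrite mulr_gt0// powR_gt0.
move=> g mg g0.
have W0 x : 0 <= wmax mu B (cst 1%R) m g x by apply: wmax_ge0 => //= y; exact: ler01.
have mW : measurable_fun setT (wmax mu B (cst 1%R) m g) by exact: measurable_wmax.
split.
- exact: emeasurable_funM.
- by move=> x; rewrite mule_ge0// lee_fin ltW.
- move=> x r /andP[r0 r6].
  (* 2^-k lies between 6 r and 12 r. A centre within 2^-k / 6 of [x] then puts [ball x r] inside a
     ball of radius 2^-k / 3 <= 4 r, of comparable volume. The choice needs 6 r < 1, whence the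
     limit 1/6. *)
  have [k] : exists2 k : nat, (6 * r * 2 ^+ k < 1)%R & (1 <= 6 * r * 2 ^+ k.+1)%R.
    by apply: exists_level; rewrite ?ltr1n//; lra.
  rewrite exprS => lk uk.
  have tk0 : (0 < 2 ^+ k :> R)%R by rewrite exprn_gt0.
  pose t : R := ((2 ^+ k)^-1)%R.
  have rt : (6 * r <= t)%R by rewrite -[leRHS]mul1r ler_pdivlMr// ltW.
  have tr : (t <= 12 * r)%R.
    rewrite -[leLHS]mul1r ler_pdivrMr// (le_trans uk)//; apply: eq_leW; ring.
  have e0 : (0 < (2 ^+ k)^-1 / 6 :> R)%R by rewrite divr_gt0// invr_gt0.
  have [i xi] := csep x _ e0.
  pose n := pickle (i, k).
  have rhoE : rho n = ((2 ^+ k)^-1 / 3)%R by rewrite /rho /rho' /n ikK/= exprVn.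
  have Bx : ball x r `<=` B n.
    rewrite /B; apply: (dball_sub GS); rewrite {1}/n ikK/= (dist_sym GS) rhoE.
    by move: xi rt; rewrite -/t => xi rt; lra.
  have xB : B n x by apply: Bx; exact: (dball_center GS).
  have rB : (rho n <= 4 * r)%R.
    by rewrite rhoE -/t; lra.
  have vol : (m n)%:E <= E%:E * mu (ball x r).
    have /(small x)/andP[H _] : (0 < r <= 1)%R by rewrite r0/=; lra.
    apply: le_trans (lee_wpmul2l _ H); last by rewrite lee_fin ltW.
    rewrite -EFinM lee_fin; apply: le_trans (mup n) _.
    rewrite /E [leRHS](_ : _ = C1 * (4 * r) ^+ nu)%R; last first.
      by rewrite exprMn; field; rewrite gt_eqF.
    rewrite ler_pM2l//; apply: lerXn2r => //; rewrite nnegrE; first exact: ltW.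
    by rewrite mulr_ge0 // ltW.
  have gB : ball_int r g x <= (m n)%:E * wmax mu B (cst 1%R) m g x.
    apply: le_trans (ge0_subset_integralW mu (fun y _ => g0 y) Bx) _.
    have := @wmax_ge _ _ _ mu B (cst 1%R) m m0 g n x xB.
    by under eq_integral do rewrite mule1.
  have mu0 : 0 < mu (ball x r) by exact: (dball_measure_gt0 GS).
  have muoo : mu (ball x r) < +oo by exact: (dball_measure_lty GS).
  case: (mu (ball x r)) mu0 muoo vol => [v| |//]// v0 _ vol.
  rewrite inver (gt_eqF (v0 : (0 < v)%R)) lee_pdivrMl//.
  apply: (le_trans gB); rewrite muleA; apply: lee_wpmul2r => //.
  by rewrite muleC.
- rewrite (integral_poweR_scale _ _ (ltW E0) mW W0 mw (fun x => ltW (w0 x))).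
  rewrite EFinM -muleA; apply: lee_wpmul2l; first by rewrite lee_fin powR_ge0.
  exact: HK.
Qed.

End local_theory.

(** * Averages at large scales *)

Lemma expn_powR (R : realType) (x r : R) (n : nat) :
  (0 <= x)%R -> ((x ^+ n) `^ r = (x `^ r) ^+ n)%R.
Proof.
by move=> x0; rewrite -(powR_mulrn n x0) -(powR_mulrn n (powR_ge0 _ _)) -!powRrM mulrC.
Qed.

Lemma powR_expR (R : realType) (x r : R) : ((expR x) `^ r = expR (x * r))%R.
Proof. by rewrite /powR gt_eqF ?expR_gt0// expRK mulrC. Qed.

Section far_theory.
Context d (T : measurableType d) (R : realType).
Variables (mu : {sigma_finite_measure set T -> \bar R}) (dist : T -> T -> R).
Variables (kappa : R) (GS : growth_space mu dist kappa).
Local Notation ball := (dball dist).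
Local Notation ball_int := (ball_int mu dist).

(** A truncation device: on each [S i] a weight bounded by [i] has finite mass, so that a mass
    occurring on both sides of an inequality can be cancelled before passing to the limit. *)
Lemma exhaustion (u v : T -> R) : measurable_fun setT u -> measurable_fun setT v ->
  exists (S : nat -> set T), [/\ forall i, measurable (S i), nondecreasing_seq S,
    \bigcup_i S i = setT, forall i, mu (S i) < +oo &
    forall i x, S i x -> (u x <= i%:R)%R /\ (v x <= i%:R)%R].
Proof.
move=> mu_ mv.
pose S i := ball point i%:R `&` ([set x | (u x <= i%:R)%R] `&` [set x | (v x <= i%:R)%R]).
have mle (g : T -> R) i : measurable_fun setT g -> measurable [set x | (g x <= i%:R :> R)%R].
  move=> mg; rewrite -[X in measurable X]setTI.
  rewrite (_ : [set x | _] = g @^-1` `]-oo, i%:R]%classic); first exact: mg.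
  by apply/seteqP; split => x /=; rewrite in_itv.
have mb i := measurable_dball GS point i%:R.
exists S; split.
- by move=> i; apply: measurableI => //; apply: measurableI; exact: mle.
- move=> i j ij; rewrite subsetEset => x [].
  have ijR : (i%:R <= j%:R :> R)%R by rewrite ler_nat.
  rewrite /dball/= => xi [ui vi]; split; first by rewrite /dball/=; lra.
  by split => /=; lra.
- rewrite -subTset => x _.
  pose N := (Num.truncn (`|dist point x| + `|u x| + `|v x|)%R).+1.
  have NN : (`|dist point x| + `|u x| + `|v x| < N%:R)%R by exact: truncnS_gt.
  have := ler_norm (dist point x); have := ler_norm (u x); have := ler_norm (v x).
  have := normr_ge0 (dist point x); have := normr_ge0 (u x); have := normr_ge0 (v x).
  move=> *; exists N => //; split; first by rewrite /dball/=; lra.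
  by split => /=; lra.
- move=> i; apply: le_lt_trans (dball_measure_lty GS point i%:R).
  apply: le_measure; rewrite ?inE//; last by move=> x [].
  by apply: measurableI => //; apply: measurableI; exact: mle.
- by move=> i x [_ []].
Qed.

Variables (p beta a C1 : R) (w : T -> R).
Hypotheses (p1 : (1 < p)%R) (mw : measurable_fun setT w).
Hypotheses (w0 : forall x, (0 <= w x)%R).
Hypotheses (beta1 : (beta < 1)%R) (a0 : (0 < a)%R) (C10 : (0 < C1)%R).
Hypothesis testing : forall r, (1 <= r)%R -> forall E F, measurable E -> measurable F ->
  \int[mu]_(y in F) (ball_int r (EFin \o \1_E) y * (w y)%:E) <=
  (C1 * expR (kappa * r * beta))%:E *
  ((\int[mu]_(y in E) (w y)%:E) `^ a * (\int[mu]_(y in F) (w y)%:E) `^ (1 - a)).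

Let k0 : (0 < kappa)%R. Proof. exact: growth_rate_gt0 GS. Qed.

Let mwE D : measurable_fun D (fun x => (w x)%:E).
Proof. by apply: measurable_funTS; exact/measurable_EFinP. Qed.

Let w0E x : 0 <= (w x)%:E. Proof. by rewrite lee_fin. Qed.

Let mind E : measurable E -> measurable_fun setT (EFin \o (\1_E : T -> R)).
Proof. by move=> mE; apply/measurable_EFinP; exact: measurable_indic. Qed.

Let ind0 (E : set T) x : 0 <= (EFin \o (\1_E : T -> R)) x.
Proof. by rewrite /= lee_fin. Qed.

Let mT r E : measurable E -> measurable_fun setT (ball_int r (EFin \o \1_E)).
Proof. by move=> mE; apply: (measurable_ball_int GS); [exact: mind|exact: ind0]. Qed.

(** Testing on F = {T 1_E > tau} gives tau w(F) <= K w(E)^a w(F)^(1-a), where the power of w(F) is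
    cancelled and the rest raised to 1 / a. As w(F) could be infinite, this is done on F intersected
    with [S i]. *)
Lemma restricted_weak_type r tau E : (1 <= r)%R -> (0 < tau)%R -> measurable E ->
  \int[mu]_(y in [set y | tau%:E < ball_int r (EFin \o \1_E) y]) (w y)%:E <=
  ((C1 * expR (kappa * r * beta) / tau) `^ a^-1)%:E * \int[mu]_(y in E) (w y)%:E.
Proof.
move=> r1 tau0 mE; set F := [set y | _].
set K := (C1 * _)%R.
have K0 : (0 < K)%R by rewrite mulr_gt0// expR_gt0.
have Kt : (0 < (K / tau) `^ a^-1)%R by rewrite powR_gt0// divr_gt0.
have mF : measurable F by apply: measurable_lte_set; exact: mT.
have [S [mS ndS ST Sfin Sw]] := exhaustion mw mw.
have W0 : 0 <= \int[mu]_(y in E) (w y)%:E by exact: integral_ge0.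
have [Woo|Wfin] := eqVneq (\int[mu]_(y in E) (w y)%:E) +oo.
  by rewrite Woo gt0_muley ?lte_fin// leey.
have key i : \int[mu]_(y in F `&` S i) (w y)%:E <=
    ((K / tau) `^ a^-1)%:E * \int[mu]_(y in E) (w y)%:E.
  have mFS : measurable (F `&` S i) by exact: measurableI.
  have fS0 : 0 <= \int[mu]_(y in F `&` S i) (w y)%:E by exact: integral_ge0.
  have fin : \int[mu]_(y in F `&` S i) (w y)%:E < +oo.
    apply: (@le_lt_trans _ _ (\int[mu]_(y in S i) (cst (i%:R%:E) y))).
      apply: (@le_trans _ _ (\int[mu]_(y in S i) (w y)%:E)).
        by apply: ge0_subset_integralW => // y [].
      by apply: ge0_le_integralW => // y Sy; rewrite lee_fin; have [] := Sw i y Sy.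
    rewrite integral_cst; last exact: mS.
    by apply: lte_mul_pinfty; rewrite ?lee_fin//; exact: Sfin.
  have H := testing r1 mE mFS.
  have L : tau%:E * \int[mu]_(y in F `&` S i) (w y)%:E <=
      \int[mu]_(y in F `&` S i) (ball_int r (EFin \o \1_E) y * (w y)%:E).
    rewrite -ge0_integralZl//; last by rewrite lee_fin ltW.
    apply: ge0_le_integralW => y; first by rewrite mule_ge0// lee_fin ltW.
    by case=> /ltW Fy _; apply: lee_wpmul2r.
  have := le_trans L H; move: W0 Wfin fS0 fin.
  case: (\int[mu]_(y in E) (w y)%:E) => [om| |]//.
  case: (\int[mu]_(y in F `&` S i) (w y)%:E) => [f| |]//.
  rewrite !lee_fin => om0 _ f0 _; rewrite -/K => LH.
  have [fz|fz] := eqVneq f 0%R; first by rewrite fz mulr_ge0// powR_ge0.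
  have fp : (0 < f)%R by rewrite lt0r fz.
  have f1 : (0 < f `^ (1 - a))%R by exact: powR_gt0.
  have fE : (f = f `^ a * f `^ (1 - a))%R.
    rewrite -powRD; last by rewrite (gt_eqF fp) implybT.
    by rewrite addrC subrK powRr1// ltW.
  have : (f `^ a <= K / tau * om `^ a)%R.
    rewrite mulrAC ler_pdivlMr// -(ler_pM2r f1).
    by move: LH; rewrite {1}fE; nra.
  move=> /(ge0_ler_powR (_ : (0 <= a^-1)%R)); rewrite invr_ge0 ltW// => /(_ isT).
  rewrite !nnegrE powR_ge0 mulr_ge0 ?powR_ge0 ?divr_ge0 ?(ltW K0) ?(ltW tau0)// => /(_ isT isT).
  rewrite -powRrM mulfV ?gt_eqF// powRr1// powRM ?powR_ge0 ?divr_ge0 ?(ltW K0) ?(ltW tau0)//.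
  by rewrite -powRrM mulfV ?gt_eqF// powRr1.
have -> : F = \bigcup_i (F `&` S i) by rewrite -setI_bigcupr ST setIT.
have ndFS : nondecreasing_seq (fun i => F `&` S i).
  move=> i j ij; rewrite subsetEset; apply: setIS.
  by move: (ndS _ _ ij); rewrite subsetEset.
have mFS i : measurable (F `&` S i) by exact: measurableI.
have cv := ge0_nondecreasing_set_cvg_integral (mu := mu) ndFS
  mFS (fun i => @mwE (F `&` S i)) (fun i x _ => w0E x).
rewrite -(cvg_lim _ cv)//; apply: lime_le; first by apply/cvg_ex; eexists; exact: cv.
exact: nearW.
Qed.

(* Variables with defining equations rather than definitions, which unification
   would unfold at a high cost. *)
Variables (b th B t b2 : R).
Hypotheses (bdef : b = expR kappa) (Bdef : B = expR (kappa * beta)).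
Hypothesis thdef : th = expR (- (kappa * ((1 - beta) / 2))).
Hypotheses (tdef : t = (th `^ a^-1)%R) (b2def : b2 = (B `^ a^-1)%R).

Let b1 : (1 < b)%R. Proof. by rewrite bdef -expR0 ltr_expR. Qed.
Let b0 : (0 < b)%R. Proof. by rewrite bdef expR_gt0. Qed.
Let th0 : (0 < th)%R. Proof. by rewrite thdef expR_gt0. Qed.
Let th1 : (th < 1)%R.
Proof.
by rewrite thdef -[ltRHS]expR0 ltr_expR oppr_lt0 mulr_gt0// divr_gt0// subr_gt0.
Qed.

Let bE k : (b ^+ k = expR (kappa * k%:R))%R.
Proof. by rewrite bdef -expRM_natl mulr_natl mulr_natr. Qed.

Lemma sum_geometric_le (u : R) j : (0 < u)%R -> (u < 1)%R ->
  (\sum_(k < j) u ^+ (j - k) <= (1 - u)^-1)%R.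
Proof.
move=> u0 u1; have u10 : (0 < 1 - u)%R by rewrite subr_gt0.
rewrite -[leRHS]mul1r ler_pdivlMr//.
elim: j => [|j IH]; first by rewrite big_ord0 mul0r.
rewrite big_ord_recr/= subSnn expr1.
rewrite (eq_bigr (fun k : 'I_j => u * u ^+ (j - k))%R); last first.
  by move=> k _; rewrite subSn ?exprS// ltnW.
by rewrite -mulr_sumr; nra.
Qed.

(* Naor and Tao's level decomposition: at a point where every indicator average
   is below its threshold, the average of [f] is below [A l b^j]. *)
Lemma level_decomposition : exists A c0 : R, [/\ (0 < A)%R, (0 < c0)%R &
  forall f, measurable_fun setT f -> (forall x, 0 <= f x) ->
  forall l j x, (0 < l)%R ->
  (forall k, (k <= j)%N ->
    ball_int (j%:R + 1) (EFin \o \1_[set y | (l * b ^+ k)%:E < ball_int 2^-1 f y]) x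
      <= (c0 * (b * th) ^+ (j - k))%:E) ->
  ball_int j%:R f x <= (A * l * b ^+ j)%:E].
Proof.
have r40 : (0 < 4^-1 :> R)%R by [].
have [c [C [c_0 C_0 HV]]] := ball_growth GS r40.
(* A lower bound for the volume of every ball of radius 1/4. The threshold constant [c0] is taken
   below it, so that a single such ball inside the top level set already exceeds the threshold. *)
pose v := (c * expR (kappa * 4^-1))%R.
have v0 : (0 < v)%R by rewrite mulr_gt0// expR_gt0.
pose c0 := (v / 2)%R.
have c00 : (0 < c0)%R by rewrite divr_gt0.
pose A := ((C * expR (kappa * 4^-1) + b * c0 * (1 - th)^-1) / v)%R.
have A1 : (0 < C * expR (kappa * 4^-1))%R by rewrite mulr_gt0// expR_gt0.
have A2 : (0 < b * c0 * (1 - th)^-1)%R by rewrite mulr_gt0 ?invr_gt0 ?subr_gt0// mulr_gt0.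
exists A, c0; split => //; first by rewrite divr_gt0// addr_gt0.
move=> f mf f0 l j x l0 small.
(* Two radii are used so that [g y > c] forces [h > c] on the whole ball of radius 1/4 about [y]. *)
pose g := ball_int 4^-1 f; pose h := ball_int 2^-1 f.
pose H k := [set y | (l * b ^+ k)%:E < h y].
have mg : measurable_fun setT g by exact: (measurable_ball_int GS).
have mh : measurable_fun setT h by exact: (measurable_ball_int GS).
have mH k : measurable (H k) by exact: measurable_lte_set.
have g0 y : 0 <= g y by exact: ball_int_ge0.
have gh y z : ball y 4^-1 z -> g y <= h z.
  move=> yz; apply: ge0_subset_integralW => //; apply: (dball_sub GS).
  by move: yz; rewrite /dball/= (dist_sym GS) => yz; lra.
have lb k : (0 < l * b ^+ k)%R by rewrite mulr_gt0// exprn_gt0.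
have vB y : v%:E <= mu (ball y 4^-1) by have /andP[] := HV y 4^-1%R (lexx _).
(* No value of [g] exceeds level [j]: otherwise the level set [H j] would contain a ball of radius
   1/4, against the hypothesis for [k = j]. *)
have top y : ball x (j%:R + 4^-1) y -> g y <= (l * b ^+ j)%:E.
  move=> xy; rewrite leNgt; apply/negP => gy.
  have := small j (leqnn j); rewrite subnn expr0 mulr1 leNgt => /negP; apply.
  apply: (@lt_le_trans _ _ v%:E); first by rewrite lte_fin /c0; lra.
  apply: (le_trans (vB y)).
  rewrite -[leLHS]mul1e -integral_cst; last exact: (measurable_dball GS).
  rewrite integral_mkcond [leRHS]integral_mkcond.
  apply: ge0_le_integralW => z _; first exact: erestrict_ge0.
  rewrite /patch; case: ifPn => [|_]; last by case: ifP.
  rewrite inE => yz.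
  have -> : z \in ball x (j%:R + 1).
    by rewrite inE; apply: (dball_sub GS _ yz); move: xy; rewrite /dball/=; lra.
  by rewrite /= indicE mem_set// /H/=; apply: (lt_le_trans gy); exact: gh.
(* Either [g y <= l], or [g y] lies between levels [k] and [k + 1] for some [k < j]; in that case
   [y] belongs to [H k]. *)
pose S y : \bar R := l%:E + \sum_(k < j) ((l * b ^+ k.+1)%:E * (EFin \o \1_(H k)) y).
have gS y : ball x (j%:R + 4^-1) y -> g y <= S y.
  move=> /top gj.
  have s0 (k : 'I_j) : 0 <= (l * b ^+ k.+1)%:E * (EFin \o \1_(H k)) y.
    by rewrite mule_ge0 ?lee_fin ?(ltW (lb _)).
  have [gl|gl] := leP (g y) l%:E.
    by apply: (le_trans gl); rewrite leeDl// sume_ge0.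
  have gfin : g y \is a fin_num by rewrite ge0_fin_numE// (le_lt_trans gj)// ltry.
  have [k lk kl] : exists2 k : nat, (l * b ^+ k < fine (g y))%R &
      (fine (g y) <= l * b ^+ k.+1)%R.
    by apply: exists_level => //; rewrite -lte_fin fineK.
  have kj : (k < j)%N.
    rewrite -lte_fin fineK// in lk; have := lt_le_trans lk gj.
    by rewrite lte_fin ltr_pM2l// ltr_eXn2l.
  apply: (@le_trans _ _ ((l * b ^+ k.+1)%:E * (EFin \o \1_(H k)) y)).
    rewrite /= indicE mem_set ?mule1; first by rewrite -[g y]fineK// lee_fin.
    rewrite /H/=; apply: (@lt_le_trans _ _ (g y)).
      by rewrite -[g y]fineK// lte_fin.
    exact: (gh _ _ (dball_center GS _ _)).
  rewrite /S (bigD1 (Ordinal kj))//= addeCA leeDl// adde_ge0 ?lee_fin ?(ltW l0)//.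
  by apply: sume_ge0.
have mI k : measurable_fun setT (fun y => (l * b ^+ k.+1)%:E * (EFin \o \1_(H k)) y).
  by apply: emeasurable_funM => //; exact: mind.
have I0 k y : 0 <= (l * b ^+ k.+1)%:E * (EFin \o \1_(H k)) y.
  by rewrite mule_ge0 ?lee_fin ?(ltW (lb _)).
have mb := measurable_dball GS x (j%:R + 4^-1).
have jE : (expR (kappa * (j%:R + 4^-1)) = b ^+ j * expR (kappa * 4^-1))%R.
  by rewrite mulrDr expRD -bE.
(* The term [l] contributes the volume of the ball, of order b^j. The [k]-th level contributes at
   most l b^(k+1) c0 (b th)^(j-k) = l b^j (b c0) th^(j-k), which is summable uniformly in [j]. This
   is the origin of the constant [A]. *)
have main : ball_int (j%:R + 4^-1) g x <=
    (l * b ^+ j * (C * expR (kappa * 4^-1) + b * c0 * (1 - th)^-1))%:E.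
  apply: (@le_trans _ _ (\int[mu]_(y in ball x (j%:R + 4^-1)) S y)).
    by apply: ge0_le_integralW => y xy //; exact: gS.
  rewrite /S ge0_integralD//; last 3 first.
  - by move=> y _; rewrite lee_fin ltW.
  - by move=> y _; apply: sume_ge0.
  - by apply: emeasurable_sum => k; exact: measurable_funTS.
  rewrite mulrDr EFinD; apply: leeD.
    rewrite (eq_integral (cst l%:E))// integral_cst//.
    have j4 : (4^-1 <= j%:R + 4^-1 :> R)%R by rewrite lerDr.
    have /andP[_ HC] := HV x _ j4.
    rewrite -mulrA EFinM; apply: lee_wpmul2l; first by rewrite lee_fin ltW.
    by apply: (le_trans HC); rewrite jE lee_fin mulrCA.
  rewrite ge0_integral_sum//; last first.
    by move=> k; exact: measurable_funTS.
  apply: (@le_trans _ _ (\sum_(k < j) (l * b ^+ k.+1 * (c0 * (b * th) ^+ (j - k)))%:E)).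
    apply: lee_sum => k _; rewrite ge0_integralZl//; last 2 first.
    - by apply: measurable_funTS; exact: mind.
    - by rewrite lee_fin ltW.
    rewrite (EFinM (l * b ^+ k.+1)); apply: lee_wpmul2l; first by rewrite lee_fin ltW.
    apply: le_trans (small k (ltnW (ltn_ord k))).
    by apply: ge0_subset_integralW => //; apply: dball_subr; rewrite lerD2l; lra.
  rewrite sumEFin lee_fin.
  apply: (@le_trans _ _ (l * b ^+ j * (b * c0) * \sum_(k < j) th ^+ (j - k)))%R; last first.
    rewrite [leRHS](_ : _ = l * b ^+ j * (b * c0) * (1 - th)^-1)%R; last by ring.
    by rewrite ler_pM2l ?sum_geometric_le// mulr_gt0// mulr_gt0.
  rewrite mulr_sumr; apply: ler_sum => k _.
  have -> : (b ^+ j = b ^+ (j - k) * b ^+ k)%R by rewrite -exprD subnK// ltnW.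
  rewrite exprMn exprS.
  by apply: eq_leW; ring.
have := ball_int_comp GS j%:R x vB (ltW v0) mf f0.
move=> /le_trans/(_ main); rewrite -lee_pdivlMl// => /le_trans; apply.
rewrite -EFinM lee_fin /A; apply: eq_leW; ring.
Qed.

Let B0 : (0 < B)%R. Proof. by rewrite Bdef expR_gt0. Qed.
Let t0 : (0 < t)%R. Proof. by rewrite tdef powR_gt0. Qed.
Let t1 : (t < 1)%R.
Proof. by rewrite tdef powR_lt1// invr_gt0. Qed.
Let b20 : (0 < b2)%R. Proof. by rewrite b2def powR_gt0. Qed.

Let levelset f l := [set y | l%:E < ball_int 2^-1 f y].

Let mlevelset f l : measurable_fun setT f -> (forall x, 0 <= f x) ->
  measurable (levelset f l).
Proof. by move=> mf f0; apply: measurable_lte_set; exact: (measurable_ball_int GS). Qed.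

(** By contraposition of [level_decomposition], a large average forces one indicator average above
    its threshold. The restricted weak type inequality at radius j + 1 costs B^(j+1) / (b th)^(j-k)
    = B th^(j-k) B^k, since B / (b th) = th; its power 1 / a gives the factors in [t] and [b2]. *)
Lemma far_levels : exists A K : R, [/\ (0 < A)%R, (0 < K)%R &
  forall f, measurable_fun setT f -> (forall x, 0 <= f x) ->
  forall l j, (0 < l)%R ->
  \int[mu]_(x in [set x | (A * l * b ^+ j)%:E < ball_int j%:R f x]) (w x)%:E <=
  \sum_(k < j.+1) ((K * (t ^+ (j - k) * b2 ^+ k))%:E *
     \int[mu]_(x in levelset f (l * b ^+ k)) (w x)%:E)].
Proof.
have [A [c0 [A0 c00 H]]] := level_decomposition.
pose K := ((C1 * B / c0) `^ a^-1)%R.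
exists A, K; split => //; first by rewrite powR_gt0// divr_gt0// mulr_gt0.
move=> f mf f0 l j l0.
pose F (k : 'I_j.+1) := [set y | (c0 * (b * th) ^+ (j - k))%:E <
  ball_int (j%:R + 1) (EFin \o \1_(levelset f (l * b ^+ k))) y].
have mF k : measurable (F k).
  by apply: measurable_lte_set; apply: mT; exact: mlevelset.
have bth n : (0 < c0 * (b * th) ^+ n)%R by rewrite mulr_gt0// exprn_gt0// mulr_gt0.
have sub : [set x | (A * l * b ^+ j)%:E < ball_int j%:R f x] `<=`
    \big[setU/set0]_(k < j.+1) F k.
  move=> x /= jx; rewrite -bigcup_seq; apply: contrapT => nF.
  move: jx; rewrite ltNge => /negP; apply; apply: H => // k kj.
  rewrite leNgt; apply/negP => kF; apply: nF.
  have kj1 : (k < j.+1)%N by [].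
  by exists (Ordinal kj1) => //=; rewrite mem_index_enum.
apply: le_trans (ge0_subset_integralW mu (fun x _ => w0E x) sub) _.
apply: le_trans (ge0_integral_bigsetU_le mu (@mwE setT) w0E _ mF) _.
apply: lee_sum => k _.
have j1 : (1 <= j%:R + 1 :> R)%R by rewrite lerDr.
apply: le_trans (restricted_weak_type j1 (bth (j - k)%N) (mlevelset _ mf f0)) _.
apply: lee_wpmul2r; first exact: integral_ge0.
rewrite lee_fin; apply: eq_leW.
have kj : (k <= j)%N by rewrite -ltnS.
have -> : expR (kappa * (j%:R + 1) * beta) = (B * (B ^+ (j - k) * B ^+ k))%R.
  rewrite -exprD subnK// -exprS Bdef -expRM_natl -natr1; congr expR.
  by rewrite -mulr_natl; ring.
have -> : (C1 * (B * (B ^+ (j - k) * B ^+ k)) / (c0 * (b * th) ^+ (j - k)) =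
    (C1 * B / c0) * ((B / (b * th)) ^+ (j - k) * B ^+ k))%R.
  rewrite expr_div_n; field.
  by rewrite !gt_eqF// ?exprn_gt0// mulr_gt0.
have -> : (B / (b * th) = th)%R.
  rewrite Bdef bdef {1}thdef -expRD -expRN -expRD thdef; congr expR.
  by field.
rewrite powRM; last 2 first.
- by rewrite ltW// divr_gt0// mulr_gt0.
- by rewrite mulr_ge0// exprn_ge0// ltW.
by rewrite -/K powRM ?exprn_ge0 ?(ltW th0) ?(ltW B0)// !expn_powR ?(ltW th0) ?(ltW B0)// tdef b2def.
Qed.

Lemma sum_shifted_geometric_le (u : R) k : (0 <= u)%R -> (u < 1)%R ->
  \sum_(j <oo) (if (k <= j)%N then (u ^+ (j - k))%:E else 0) <= ((1 - u)^-1)%:E.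
Proof.
move=> u0 u1; have u10 : (0 < 1 - u)%R by rewrite subr_gt0.
apply: lime_le.
  by apply: is_cvg_nneseries => j _ _; case: ifP; rewrite // lee_fin exprn_ge0.
apply: nearW => N.
apply: (@le_trans _ _ ((1 - u ^+ (N - k)) / (1 - u))%:E); last first.
  by rewrite lee_fin ler_piMl ?invr_ge0 ?(ltW u10)// gerBl exprn_ge0.
elim: N => [|N IH].
  by rewrite big_geq// lee_fin divr_ge0 ?(ltW u10)// sub0n expr0 subrr.
rewrite big_nat_recr//=; apply: (le_trans (leeD IH (lexx _))).
case: leqP => kN.
  rewrite -EFinD lee_fin subSn// exprS; apply: eq_leW.
  by field; rewrite gt_eqF.
rewrite adde0 lee_fin; move: (kN); rewrite -subn_eq0 => /eqP ->.
by move: (ltnW kN); rewrite -subn_eq0 => /eqP ->.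
Qed.

Let mh f : measurable_fun setT f -> (forall x, 0 <= f x) ->
  measurable_fun setT (ball_int 2^-1 f).
Proof. by move=> mf f0; exact: (measurable_ball_int GS). Qed.

Let geomC0 : (0 < (1 - b `^ (- p))^-1)%R.
Proof.
have p0 : (0 < p)%R by exact: lt_trans p1.
rewrite invr_gt0 subr_gt0 powRN invf_lt1 ?powR_gt0//.
have : (1 `^ p < b `^ p)%R by rewrite gt0_ltr_powR ?nnegrE ?(ltW b0).
by rewrite powR1.
Qed.

Let b2E : (b2 = expR (kappa * (beta / a)))%R.
Proof. by rewrite b2def Bdef powR_expR mulrA. Qed.

Let bpE : (b `^ p = expR (kappa * p))%R.
Proof. by rewrite bdef powR_expR. Qed.

(** After the exchange of the sums, the sum over j >= k of t^(j-k) is bounded and leaves b2^k times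
    the mass of the [k]-th level set. The hypothesis means b2 <= b^p, and with b^(p k) in place of
    b2^k the series is a discretized L^p(w) norm of the average at radius 1/2. *)
Lemma far_weak_type : (beta / a <= p)%R -> exists A C : R, [/\ (0 < A)%R, (0 < C)%R &
  forall f, measurable_fun setT f -> (forall x, 0 <= f x) -> forall l, (0 < l)%R ->
  (l `^ p)%:E * \int[mu]_(x in \bigcup_j [set x | (A * l * b ^+ j)%:E < ball_int j%:R f x])
    (w x)%:E <= C%:E * \int[mu]_x (ball_int 2^-1 f x `^ p * (w x)%:E)].
Proof.
move=> bap; have [A [K [A0 K0 H]]] := far_levels.
have p0 : (0 < p)%R by exact: lt_trans p1.
have t10 : (0 < (1 - t)^-1)%R by rewrite invr_gt0 subr_gt0.
have b2b : (b2 <= b `^ p)%R by rewrite b2E bpE ler_expR ler_pM2l.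
exists A, (K * (1 - t)^-1 * (1 - b `^ (- p))^-1)%R; split => //.
  by rewrite mulr_gt0// mulr_gt0.
move=> f mf f0 l l0.
pose W k := \int[mu]_(x in levelset f (l * b ^+ k)) (w x)%:E.
have W0 k : 0 <= W k by exact: integral_ge0.
have mU j : measurable [set x | (A * l * b ^+ j)%:E < ball_int j%:R f x].
  by apply: measurable_lte_set; exact: (measurable_ball_int GS).
pose u j k : \bar R := if (k <= j)%N then (K * (t ^+ (j - k) * b2 ^+ k))%:E * W k else 0.
have u0 j k : 0 <= u j k.
  by rewrite /u; case: ifP => // _; rewrite mule_ge0// lee_fin !mulr_ge0 ?exprn_ge0 ?(ltW K0) ?(ltW t0) ?(ltW b20).
have main : \int[mu]_(x in \bigcup_j [set x | (A * l * b ^+ j)%:E < ball_int j%:R f x]) (w x)%:E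
    <= \sum_(k <oo) ((K * (1 - t)^-1 * b2 ^+ k)%:E * W k).
  apply: le_trans (ge0_integral_bigcup_le mu (@mwE setT) w0E mU) _.
  apply: (@le_trans _ _ (\sum_(j <oo) \sum_(k <oo) u j k)).
    apply: lee_nneseries => [j _ _|j _]; first exact: integral_ge0.
    apply: le_trans (H f mf f0 l j l0) _.
    apply: le_trans (nneseries_lim_ge j.+1 _) => [|k _ _]; last exact: u0.
    rewrite big_mkord; apply: lee_sum => k _.
    by rewrite /u -ltnS ltn_ord.
  rewrite nneseries_interchange//.
  apply: lee_nneseries => [k _ _|k _]; first exact: nneseries_ge0.
  rewrite (eq_eseriesr (g := fun j => ((if (k <= j)%N then (t ^+ (j - k))%:E else 0) * (K * b2 ^+ k)%:E) * W k)); last first.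
    move=> j _; rewrite /u; case: ifP => _; last by rewrite !mul0e.
    by rewrite -EFinM; congr (_%:E * _); ring.
  have v0 j : 0 <= (if (k <= j)%N then (t ^+ (j - k))%:E else 0) :> \bar R.
    by case: ifP => // _; rewrite lee_fin exprn_ge0// ltW.
  have Kb : (0 <= K * b2 ^+ k)%R by rewrite mulr_ge0 ?exprn_ge0 ?(ltW K0) ?(ltW b20).
  rewrite -nneseriesZr_ereal//; last by move=> j; rewrite mule_ge0.
  apply: lee_wpmul2r => //; rewrite -nneseriesZr_ereal//.
  apply: le_trans (lee_wpmul2r _ (sum_shifted_geometric_le k (ltW t0) t1)) _.
    by rewrite lee_fin.
  by rewrite -EFinM lee_fin; apply: eq_leW; ring.
apply: le_trans (lee_wpmul2l _ main) _; first by rewrite lee_fin powR_ge0.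
rewrite -nneseriesZl; last first.
  by move=> k _; rewrite mule_ge0// lee_fin !mulr_ge0 ?exprn_ge0 ?(ltW K0) ?(ltW t10) ?(ltW b20).
have KT : (0 < K * (1 - t)^-1)%R by rewrite mulr_gt0.
apply: (@le_trans _ _ (\sum_(k <oo) ((K * (1 - t)^-1)%:E * (((l * b ^+ k) `^ p)%:E * W k)))).
  apply: lee_nneseries => [k _ _|k _].
    by rewrite !mule_ge0// lee_fin ?powR_ge0// !mulr_ge0 ?exprn_ge0 ?(ltW K0) ?(ltW t10) ?(ltW b20).
  rewrite !muleA -!EFinM; apply: lee_wpmul2r => //; rewrite lee_fin.
  rewrite powRM ?(ltW l0) ?exprn_ge0 ?(ltW b0)//.
  rewrite [leRHS](_ : _ = l `^ p * (K / (1 - t) * (b ^+ k) `^ p))%R; last by ring.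
  rewrite ler_pM2l ?powR_gt0// ler_pM2l//.
  rewrite expn_powR ?(ltW b0)//.
  by apply: lerXn2r; rewrite // nnegrE ?powR_ge0 ?(ltW b20).
rewrite nneseriesZl; last by move=> k _; rewrite mule_ge0// lee_fin powR_ge0.
rewrite (EFinM (K * (1 - t)^-1)) -[leRHS]muleA; apply: lee_wpmul2l; first by rewrite lee_fin ltW.
have h0 x : 0 <= ball_int 2^-1 f x by exact: ball_int_ge0.
exact: (sum_level_sets_le mu b1 p0 h0 w0E (mh mf f0) (@mwE setT) l0).
Qed.

(** [far_levels] is summed over the levels l b^m. For fixed [k], the sets {h > l b^(m+k)} are those
    of b^(-k) h at the levels l b^m, which gains b^(-p k). Each of the j + 1 values of [k] thus
    carries t^(j-k) (b2 / b^p)^k, at most rho^j. *)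
Lemma far_strong_type : (beta / a < p)%R -> exists C rho : R,
  [/\ (0 < C)%R, (0 < rho)%R, (rho < 1)%R &
  forall f, measurable_fun setT f -> (forall x, 0 <= f x) -> forall j,
  \int[mu]_x ((((b ^+ j)^-1)%:E * ball_int j%:R f x) `^ p * (w x)%:E) <=
  (C * (j.+1%:R * rho ^+ j))%:E * \int[mu]_x (ball_int 2^-1 f x `^ p * (w x)%:E)].
Proof.
move=> bap; have [A [K [A0 K0 H]]] := far_levels.
have p0 : (0 < p)%R by exact: lt_trans p1.
pose rho2 := (b2 / b `^ p)%R.
have bp0 : (0 < b `^ p)%R by exact: powR_gt0.
have rho20 : (0 < rho2)%R by rewrite divr_gt0.
have rho21 : (rho2 < 1)%R by rewrite ltr_pdivrMr// mul1r b2E bpE ltr_expR ltr_pM2l.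
pose rho := Num.max t rho2.
have rho0 : (0 < rho)%R by rewrite lt_max t0.
have rho1 : (rho < 1)%R by rewrite gt_max t1.
pose G := ((1 - b `^ (- p))^-1)%R.
have G0 : (0 < G)%R := geomC0.
exists (A `^ p * (b `^ p * (K * G)))%R, rho; split => //.
  by rewrite !mulr_gt0// powR_gt0.
move=> f mf f0 j.
pose X x := ((A * b ^+ j)^-1)%:E * ball_int j%:R f x.
have bj0 i : (0 < b ^+ i)%R by exact: exprn_gt0.
have Abj : (0 < A * b ^+ j)%R by rewrite mulr_gt0.
have mTj : measurable_fun setT (ball_int j%:R f) by exact: (measurable_ball_int GS).
have Tj0 x : 0 <= ball_int j%:R f x by exact: ball_int_ge0.
have X0 x : 0 <= X x by rewrite mule_ge0// lee_fin invr_ge0 ltW.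
have mX : measurable_fun setT X by exact: emeasurable_funM.
have h0 x : 0 <= ball_int 2^-1 f x by exact: ball_int_ge0.
have -> : \int[mu]_x ((((b ^+ j)^-1)%:E * ball_int j%:R f x) `^ p * (w x)%:E) =
    (A `^ p)%:E * \int[mu]_x (X x `^ p * (w x)%:E).
  rewrite -(integral_poweR_scale _ _ (ltW A0) mX X0 mw w0).
  apply: eq_integral => x _; rewrite /X muleA -EFinM; congr ((_%:E * _) `^ _ * _).
  by field; rewrite !gt_eqF.
rewrite (_ : A `^ p * (b `^ p * (K * G)) * (j.+1%:R * rho ^+ j) =
  A `^ p * (b `^ p * (K * G * (j.+1%:R * rho ^+ j))))%R; last by ring.
rewrite (EFinM (A `^ p)) -[leRHS]muleA; apply: lee_wpmul2l; first by rewrite lee_fin powR_ge0.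
rewrite (EFinM (b `^ p)) -[leRHS]muleA; apply: (le_sum_level_sets b1 p0 X0 w0E mX (@mwE setT)).
move=> l l0; pose lm m := (l * b ^+ m)%R.
have lm0 m : (0 < lm m)%R by rewrite mulr_gt0.
pose W m k := \int[mu]_(x in levelset f (lm m * b ^+ k)) (w x)%:E.
have W0 m k : 0 <= W m k by exact: integral_ge0.
pose co k := (K * (t ^+ (j - k) * b2 ^+ k))%R.
have co0 k : (0 <= co k)%R by rewrite !mulr_ge0 ?exprn_ge0 ?(ltW K0) ?(ltW t0) ?(ltW b20).
apply: (@le_trans _ _ (\sum_(m <oo) \sum_(k < j.+1) ((co k)%:E * ((lm m `^ p)%:E * W m k)))).
  apply: lee_nneseries => [m _ _|m _].
    by rewrite mule_ge0 ?lee_fin ?powR_ge0//; exact: integral_ge0.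
  rewrite (_ : [set x | (l * b ^+ m)%:E < X x] =
      [set x | (A * lm m * b ^+ j)%:E < ball_int j%:R f x]); last first.
    apply/seteqP; split => x /=; rewrite /X lte_pdivlMl// -EFinM;
    by rewrite (_ : A * b ^+ j * (l * b ^+ m) = A * lm m * b ^+ j)%R// /lm; ring.
  apply: le_trans (lee_wpmul2l _ (H f mf f0 _ j (lm0 m))) _; first by rewrite lee_fin powR_ge0.
  rewrite ge0_sume_distrr; last first.
    move=> k _; apply: mule_ge0; first by rewrite lee_fin; exact: co0.
    exact: integral_ge0.
  by apply: lee_sum => k _; rewrite muleCA.
rewrite nneseries_sum; last by move=> k m _; rewrite !mule_ge0// lee_fin ?powR_ge0.
apply: (@le_trans _ _ (\sum_(k < j.+1) ((K * G * rho ^+ j)%:E *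
    \int[mu]_x (ball_int 2^-1 f x `^ p * (w x)%:E)))); last first.
  rewrite -ge0_sume_distrl; last first.
    by move=> k _; rewrite lee_fin !mulr_ge0 ?exprn_ge0 ?(ltW K0) ?(ltW G0) ?(ltW rho0).
  apply: lee_wpmul2r; first by apply: integral_ge0 => x _; rewrite mule_ge0 ?poweR_ge0.
  rewrite sumEFin lee_fin sumr_const card_ord -mulr_natl.
  by apply: eq_leW; ring.
apply: lee_sum => k _.
rewrite nneseriesZl; last by move=> m _; rewrite mule_ge0// lee_fin powR_ge0.
pose Y x := ((b ^+ k)^-1)%:E * ball_int 2^-1 f x.
have Y0 x : 0 <= Y x by rewrite mule_ge0// lee_fin invr_ge0 ltW.
have mY : measurable_fun setT Y by apply: emeasurable_funM => //; exact: mh.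
have WE m : W m k = \int[mu]_(x in [set x | (l * b ^+ m)%:E < Y x]) (w x)%:E.
  rewrite /W; congr (\int[mu]_(x in _) _); apply/seteqP; split => x /=;
  by rewrite /levelset/= /Y lte_pdivlMl// -EFinM mulrC.
under eq_eseriesr do rewrite WE.
apply: le_trans (lee_wpmul2l _ (sum_level_sets_le mu b1 p0 Y0 w0E mY (@mwE setT) l0)) _.
  by rewrite lee_fin.
have -> : \int[mu]_x (Y x `^ p * (w x)%:E) = (((b `^ p) ^+ k)^-1)%:E *
    \int[mu]_x (ball_int 2^-1 f x `^ p * (w x)%:E).
  have bk : (0 <= (b ^+ k)^-1)%R by rewrite invr_ge0 ltW.
  rewrite (integral_poweR_scale _ _ bk (mh mf f0) h0 mw w0).
  by rewrite invr_powR ?(ltW (bj0 _))// expn_powR// ltW.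
rewrite !muleA -!EFinM; apply: lee_wpmul2r.
  by apply: integral_ge0 => x _; rewrite mule_ge0 ?poweR_ge0.
rewrite lee_fin /co -/G.
rewrite (_ : K * (t ^+ (j - k) * b2 ^+ k) * G / (b `^ p) ^+ k =
  K * G * (t ^+ (j - k) * rho2 ^+ k))%R; last by rewrite /rho2 expr_div_n; ring.
rewrite ler_pM2l ?mulr_gt0//.
have kj : (k <= j)%N by rewrite -ltnS.
have -> : (rho ^+ j = rho ^+ (j - k) * rho ^+ k)%R by rewrite -exprD subnK.
apply: ler_pM; rewrite ?exprn_ge0 ?(ltW t0) ?(ltW rho20)//.
- by apply: lerXn2r; rewrite ?nnegrE ?(ltW t0) ?(ltW rho0)// le_max lexx.
- by apply: lerXn2r; rewrite ?nnegrE ?(ltW rho20) ?(ltW rho0)// le_max lexx orbT.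
Qed.

End far_theory.

(** * Duality between L^p(w) and L^p'(sigma) *)

Section duality.
Context d (T : measurableType d) (R : realType).
Variables (mu : {sigma_finite_measure set T -> \bar R}) (dist : T -> T -> R).
Variables (kappa : R) (GS : growth_space mu dist kappa).
Local Notation ball := (dball dist).
Local Notation ball_int := (ball_int mu dist).
Variables (p : R) (w : T -> R) (r N : R).
Hypotheses (p1 : (1 < p)%R) (mw : measurable_fun setT w).
Hypotheses (w0 : forall x, (0 < w x)%R) (N0 : (0 < N)%R).
Hypothesis bound : forall f : T -> R, measurable_fun setT f ->
  (forall x, (0 <= f x)%R) ->
  \int[mu]_x (ball_int r (EFin \o f) x `^ p * (w x)%:E) <=
  N%:E * \int[mu]_x ((f x)%:E `^ p * (w x)%:E).

Let p10 : (0 < p - 1)%R. Proof. by rewrite subr_gt0. Qed.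
Let p0 : (0 < p)%R. Proof. exact: lt_trans p1. Qed.
Variables (q : R) (s : T -> R).
Hypotheses (qE : q = (p / (p - 1))%R) (sE : s = dual_weight p w).
Let q1 : (1 < q)%R. Proof. by rewrite qE conj_expo1. Qed.
Let q0 : (0 < q)%R. Proof. exact: lt_trans q1. Qed.
Let s0 x : (0 < s x)%R. Proof. by rewrite sE dual_weight_gt0. Qed.
Let ms : measurable_fun setT s. Proof. by rewrite sE; exact: measurable_dual_weight. Qed.

Variable f : T -> R.
Hypotheses (mf : measurable_fun setT f) (f0 : forall x, (0 <= f x)%R).

Let Tf := ball_int r (EFin \o f).
Let Tf0 x : 0 <= Tf x. Proof. by apply: ball_int_ge0 => y; rewrite /= lee_fin. Qed.
Let mTf : measurable_fun setT Tf.
Proof.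
apply: (measurable_ball_int GS); first exact/measurable_EFinP.
by move=> y; rewrite /= lee_fin.
Qed.

(** The extremal test function is G = m^(q-1) s, for which the integral of G^p w is again [X].
    Symmetry, Hoelder's inequality and the bound on L^p(w) give X <= (N X)^(1/p) Y^(1/q). The
    truncation makes [X] finite, so that X^(1/p) can be cancelled. *)
Lemma dual_bound_truncated (m : T -> R) (S : set T) (i : R) :
  measurable_fun setT m -> (forall x, (0 <= m x <= i)%R) ->
  measurable S -> mu S < +oo -> (forall x, ~ S x -> m x = 0%R) ->
  (forall x, S x -> (s x <= i)%R) -> (forall x, (m x)%:E <= Tf x) ->
  \int[mu]_x ((m x)%:E `^ q * (s x)%:E) <=
  (N `^ (p - 1)^-1)%:E * \int[mu]_x ((f x)%:E `^ q * (s x)%:E).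
Proof.
move=> mm mi mS Sfin mS0 sS mT.
have m0 x : (0 <= m x)%R by case/andP: (mi x).
have i0 : (0 <= i)%R by have /andP[a b] := mi point; exact: le_trans a b.
have pow0 : (0 `^ q = 0 :> R)%R by rewrite powR0// gt_eqF.
set X := \int[mu]_x ((m x)%:E `^ q * (s x)%:E).
set Y := \int[mu]_x ((f x)%:E `^ q * (s x)%:E).
have X0 : 0 <= X by apply: integral_ge0 => x _; rewrite mule_ge0 ?poweR_ge0// lee_fin ltW.
have Y0 : 0 <= Y by apply: integral_ge0 => x _; rewrite mule_ge0 ?poweR_ge0// lee_fin ltW.
have Xfin : X < +oo.
  apply: (@le_lt_trans _ _ (\int[mu]_(x in S) (cst ((i `^ q * i)%:E) x))); last first.
    rewrite integral_cst//; apply: lte_mul_pinfty => //.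
    by rewrite lee_fin mulr_ge0// powR_ge0.
  rewrite [leRHS]integral_mkcond; apply: ge0_le_integralW => x _.
    by rewrite mule_ge0 ?poweR_ge0// lee_fin ltW.
  rewrite /patch; case: ifPn => [|]; last first.
    by rewrite notin_setE => /mS0 ->; rewrite poweR_EFin pow0 mul0e.
  rewrite inE => Sx; rewrite poweR_EFin -EFinM lee_fin.
  have /andP[_ mxi] := mi x.
  apply: ler_pM; rewrite ?powR_ge0 ?(ltW (s0 x))//; last exact: sS.
  by apply: ge0_ler_powR; rewrite ?nnegrE ?(ltW q0).
pose G x := (m x `^ (q - 1) * s x)%R.
have q10 : (0 < q - 1)%R by rewrite subr_gt0.
have G0 x : (0 <= G x)%R by rewrite mulr_ge0 ?powR_ge0// ltW.
have mG : measurable_fun setT G.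
  apply: measurable_funM => //; exact: (measurableT_comp (measurable_powR _)).
have Gi x : (G x <= i `^ (q - 1) * i)%R.
  have [Sx|/mS0 mx0] := pselect (S x).
    have /andP[_ mxi] := mi x.
    apply: ler_pM; rewrite ?powR_ge0 ?(ltW (s0 x))//; last exact: sS.
    by apply: ge0_ler_powR; rewrite ?nnegrE ?(ltW q10).
  by rewrite /G mx0 powR0 ?gt_eqF// mul0r mulr_ge0// powR_ge0.
have TGfin x : ball_int r (EFin \o G) x < +oo.
  apply: (@le_lt_trans _ _ (\int[mu]_(y in ball x r) (cst ((i `^ (q - 1) * i)%:E) y))).
    by apply: ge0_le_integralW => y _; rewrite /= lee_fin.
  rewrite integral_cst; last exact: (measurable_dball GS).
  apply: lte_mul_pinfty => //; last exact: (dball_measure_lty GS).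
  by rewrite lee_fin mulr_ge0// powR_ge0.
have TG0 x : 0 <= ball_int r (EFin \o G) x by apply: ball_int_ge0 => y; rewrite /= lee_fin.
have mGE : measurable_fun setT (EFin \o G) by exact/measurable_EFinP.
have mTG : measurable_fun setT (ball_int r (EFin \o G)).
  by apply: (measurable_ball_int GS) => // y; rewrite /= lee_fin.
pose u x := fine (ball_int r (EFin \o G) x).
have uE x : (u x)%:E = ball_int r (EFin \o G) x by rewrite fineK ?ge0_fin_numE ?TGfin ?TG0.
have u0 x : (0 <= u x)%R by exact: fine_ge0 (TG0 x).
have mu_ : measurable_fun setT u by apply: measurableT_comp mTG; exact: fine_measurable.
have XG : X = \int[mu]_x ((G x)%:E `^ p * (w x)%:E).
  apply: eq_integral => x _; rewrite !poweR_EFin -!EFinM; congr _%:E.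
  rewrite /G powRM ?powR_ge0 ?(ltW (s0 x))// -powRrM.
  have -> : ((q - 1) * p = q)%R by rewrite qE conj_expo_sub1// mulrC.
  rewrite -mulrA; congr (_ * _)%R.
  rewrite -[in RHS](subrK 1%R p) powRD; last by rewrite (gt_eqF (s0 x)) implybT.
  rewrite powRr1 ?(ltW (s0 x))// sE dual_weightK// mulrAC mulVf ?mul1r//.
  by rewrite gt_eqF.
have XY : X <= (N%:E * X) `^ p^-1 * Y `^ q^-1.
  apply: (@le_trans _ _ (\int[mu]_x (Tf x * (G x)%:E))).
    apply: ge0_le_integralW => x _; first by rewrite mule_ge0 ?poweR_ge0// lee_fin ltW.
    rewrite (_ : (m x)%:E `^ q * (s x)%:E = (m x)%:E * (G x)%:E); last first.
      rewrite poweR_EFin -!EFinM /G -(mulr_powRB1 (m0 x) q0); congr _%:E; ring.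
    by apply: lee_wpmul2r; rewrite ?lee_fin.
  have mfE : measurable_fun setT (EFin \o f) by exact/measurable_EFinP.
  have f0E x : 0 <= (EFin \o f) x by rewrite /= lee_fin.
  have G0E x : 0 <= (EFin \o G) x by rewrite /= lee_fin.
  rewrite [leLHS](ball_int_sym GS r mfE f0E mGE G0E).
  have -> : \int[mu]_x ((EFin \o f) x * ball_int r (EFin \o G) x) = \int[mu]_x (f x * u x)%:E.
    by apply: eq_integral => x _; rewrite EFinM uE.
  apply: le_trans (weighted_hoelder2 p1 mw w0 mu mf f0 mu_ u0) _.
  rewrite -qE -sE; have -> : \int[mu]_x (f x `^ q * s x)%:E = Y by [].
  apply: lee_wpmul2r; first exact: poweR_ge0.
  apply: lee_poweR; first by rewrite invr_ge0 ltW.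
    by apply: integral_ge0 => x _; rewrite lee_fin mulr_ge0 ?powR_ge0// ltW.
  rewrite XG; apply: le_trans (bound mG G0).
  apply: eq_leW; apply: eq_integral => x _.
  by rewrite -uE poweR_EFin -EFinM.
clear XG; have [Xz|Xz] := eqVneq X 0; first by rewrite Xz mule_ge0// lee_fin powR_ge0.
have Np0 : (0 < N `^ p^-1)%R by exact: powR_gt0.
have NE : 0 <= N%:E by rewrite lee_fin ltW.
move: XY; rewrite (poweRM _ NE X0) poweR_EFin.
case: X X0 Xfin Xz => [x| |]// x0 _ xz; rewrite poweR_EFin => XY.
have xp : (0 < x)%R by rewrite lt0r -lee_fin x0 andbT; apply: contra xz => /eqP ->.
have [Yoo|Yoo] := eqVneq Y +oo.
  by rewrite Yoo gt0_muley ?leey// lte_fin powR_gt0.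
case: Y Y0 Yoo XY => [y| |]// y0 _; rewrite poweR_EFin -!EFinM !lee_fin => XY.
rewrite lee_fin in y0.
have xV : (0 < x `^ p^-1)%R by exact: powR_gt0.
have pq : (p^-1 + q^-1 = 1)%R by rewrite qE; field; rewrite !gt_eqF.
have xx : (x = x `^ p^-1 * x `^ q^-1)%R.
  rewrite -powRD; last by rewrite (gt_eqF xp) implybT.
  by rewrite pq powRr1// ltW.
have : (x `^ q^-1 <= N `^ p^-1 * y `^ q^-1)%R.
  rewrite -(ler_pM2l xV) -xx; apply: (le_trans XY).
  by apply: eq_leW; ring.
have RHS0 : (0 <= N `^ p^-1 * y `^ q^-1)%R by rewrite mulr_ge0 ?powR_ge0.
move=> /(ge0_ler_powR (ltW q0)); rewrite !nnegrE powR_ge0 RHS0 => /(_ isT isT).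
rewrite powRM ?powR_ge0// -!powRrM !mulVf ?gt_eqF// !powRr1 ?(ltW xp)//.
by rewrite (_ : p^-1 * q = (p - 1)^-1)%R// qE; field; rewrite !gt_eqF.
Qed.

(** The truncations min(Tf, i) on [S i] increase to [Tf], also where it is infinite, so that
    monotone convergence removes them. *)
Lemma dual_bound :
  \int[mu]_x (Tf x `^ q * (s x)%:E) <=
  (N `^ (p - 1)^-1)%:E * \int[mu]_x ((f x)%:E `^ q * (s x)%:E).
Proof.
have [S [mS ndS ST Sfin Sw]] := exhaustion GS ms ms.
pose m (i : nat) x := fine (mine (Tf x) i%:R%:E * (\1_(S i) x)%:E).
have mE i x : (m i x)%:E = mine (Tf x) i%:R%:E * (\1_(S i) x)%:E.
  have mn0 : 0 <= mine (Tf x) i%:R%:E by rewrite le_min Tf0/= lee_fin ler0n.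
  rewrite fineK//; apply: fin_numM; last by [].
  by rewrite ge0_fin_numE// gt_min ltry orbT.
have m0 i x : (0 <= m i x)%R.
  by rewrite -lee_fin mE mule_ge0 ?lee_fin// le_min Tf0/= lee_fin ler0n.
have mm i : measurable_fun setT (m i).
  apply: measurableT_comp; first exact: fine_measurable.
  apply: emeasurable_funM; first exact: measurable_mine.
  by apply/measurable_EFinP; exact: measurable_indic.
have m1 i x : (m i x)%:E <= mine (Tf x) i%:R%:E.
  rewrite mE indicE; case: (x \in S i); rewrite ?mule1// mule0.
  by rewrite le_min Tf0/= lee_fin ler0n.
have key i : \int[mu]_x ((m i x)%:E `^ q * (s x)%:E) <=
    (N `^ (p - 1)^-1)%:E * \int[mu]_x ((f x)%:E `^ q * (s x)%:E).
  apply: (dual_bound_truncated (S := S i) (i := i%:R)) => //.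
  - move=> x; rewrite m0/= -lee_fin; apply: le_trans (m1 i x) _.
    by rewrite ge_min lexx orbT.
  - by move=> x nSx; apply/EFin_inj; rewrite mE indicE memNset// mule0.
  - by move=> x /Sw[].
  - by move=> x; apply: le_trans (m1 i x) _; rewrite ge_min lexx.
pose g i x := (m i x)%:E `^ q * (s x)%:E.
have mg i : measurable_fun setT (g i).
  apply: emeasurable_funM; last exact/measurable_EFinP.
  by apply: (measurableT_comp (measurable_poweR _)); exact/measurable_EFinP.
have g0 i x : setT x -> 0 <= g i x by rewrite mule_ge0 ?poweR_ge0// lee_fin ltW.
have ndm i j x : (i <= j)%N -> (m i x)%:E <= (m j x)%:E.
  move=> ij; rewrite !mE; apply: lee_pmul.
  - by rewrite le_min Tf0/= lee_fin ler0n.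
  - by rewrite lee_fin.
  - rewrite le_min !ge_min lexx/= !lee_fin ler_nat ij orbT//.
  - rewrite lee_fin !indicE; case: (boolP (x \in S i)) => // xi.
    suff -> : x \in S j by [].
    move: xi; rewrite !inE; move: (ndS _ _ ij); rewrite subsetEset; exact.
have ndg x : setT x -> nondecreasing_seq (g ^~ x).
  move=> _ i j ij; apply: lee_wpmul2r; first by rewrite lee_fin ltW.
  apply: lee_poweR; [exact: ltW|by rewrite lee_fin|exact: ndm].
have lim_ge i x : g i x <= limn (g ^~ x).
  have /cvg_lim -> // := ereal_nondecreasing_cvgn (ndg x Logic.I).
  by apply: ereal_sup_ubound; exists i.
apply: (@le_trans _ _ (\int[mu]_x limn (g ^~ x))); last first.
  rewrite monotone_convergence//; apply: lime_le; last exact: nearW.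
  apply: ereal_nondecreasing_is_cvgn => i j ij.
  by apply: ge0_le_integralW => x _; [exact: g0|exact: ndg].
apply: ge0_le_integralW => x _; first by rewrite mule_ge0 ?poweR_ge0// lee_fin ltW.
have [i0 _ Si0] : (\bigcup_i S i) x by rewrite ST.
have Sx i : (i0 <= i)%N -> x \in S i.
  by move=> ii; rewrite inE; move: (ndS _ _ ii); rewrite subsetEset; exact.
case Tx : (Tf x) => [t| |]; last by have := Tf0 x; rewrite Tx.
  have t0 : (0 <= t)%R by rewrite -lee_fin -Tx.
  pose i := maxn i0 (Num.truncn t).+1.
  apply: le_trans (lim_ge i x); rewrite /g mE indicE Sx ?leq_maxl// mule1 Tx.
  rewrite min_l// lee_fin (le_trans (ltW (truncnS_gt t)))// ler_nat leq_maxr//.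
rewrite poweRyr ?gt_eqF// gt0_mulye ?lte_fin// leye_eq; apply/eqP/eqyP => A A0.
pose z := ((A / s x) `^ q^-1)%R.
pose i := maxn i0 (Num.truncn z).+1.
have zi : (z <= i%:R)%R.
  by rewrite (le_trans (ltW (truncnS_gt z)))// ler_nat leq_maxr.
apply: le_trans (lim_ge i x); rewrite /g mE indicE Sx ?leq_maxl// mule1 Tx.
rewrite min_r ?leey// poweR_EFin -EFinM lee_fin.
rewrite -ler_pdivrMr//; apply: (@le_trans _ _ (z `^ q)%R).
  by rewrite -powRrM mulVf ?gt_eqF// powRr1// divr_ge0 ?(ltW A0) ?(ltW (s0 x)).
by apply: ge0_ler_powR; rewrite ?nnegrE ?(ltW q0) ?powR_ge0.
Qed.

End duality.

(** Half of the decay, rho^(j/2), absorbs the polynomial. It is written as u^(j (gamma + 1)), and (j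
    + 1) u^j is bounded by Bernoulli's inequality for 1 / u. The exponent gamma + 1 rather than
    gamma avoids a division by zero when gamma = 0. *)
Lemma polynomial_geometric_le (R : realType) (gamma rho : R) :
  (0 <= gamma)%R -> (0 < rho < 1)%R -> exists2 K : R, (0 < K)%R &
  forall j : nat, (j.+1%:R `^ gamma * rho ^+ j <= K * (rho `^ 2^-1) ^+ j)%R.
Proof.
move=> g0 /andP[rho0 rho1].
pose r := (rho `^ 2^-1)%R; pose g1 := (gamma + 1)%R.
have g10 : (0 < g1)%R by rewrite /g1; lra.
pose u := (r `^ g1^-1)%R.
have r0 : (0 < r)%R by exact: powR_gt0.
have r1 : (r < 1)%R by apply: powR_lt1.
have u0 : (0 < u)%R by exact: powR_gt0.
have u1 : (u < 1)%R by apply: powR_lt1; rewrite ?invr_gt0.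
pose c := Num.min 1%R (u^-1 - 1)%R.
have uV1 : (1 < u^-1)%R by rewrite invf_gt1.
have c0 : (0 < c)%R by rewrite lt_min ltr01 subr_gt0.
have c1 : (c <= 1)%R by rewrite ge_min lexx.
have cu : (c <= u^-1 - 1)%R by rewrite ge_min lexx orbT.
exists (c^-1 `^ g1)%R; first by rewrite powR_gt0// invr_gt0.
move=> j; have rr : (rho = r * r)%R.
  rewrite /r -powRD ?(gt_eqF rho0) ?implybT//.
  by rewrite (_ : 2^-1 + 2^-1 = 1)%R ?powRr1 ?(ltW rho0)//; lra.
rewrite {1}rr exprMn mulrA ler_pM2r ?exprn_gt0//.
have j1 : (1 <= j.+1%:R :> R)%R by rewrite ler1n.
have ju : (j.+1%:R * u ^+ j <= c^-1)%R.
  rewrite -[leRHS]mul1r ler_pdivlMr// mulrAC -ler_pdivlMr ?exprn_gt0//.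
  rewrite div1r -exprVn mulrC; apply: le_trans (bernoulli_le j uV1).
  rewrite -natr1 mulrDr mulr1 addrC; apply: lerD => //.
  by rewrite mulrC ler_wpM2l.
apply: (@le_trans _ _ ((j.+1%:R * u ^+ j) `^ g1)%R); last first.
  apply: ge0_ler_powR => //; rewrite ?nnegrE ?(ltW g10)//.
  - by rewrite mulr_ge0 ?exprn_ge0 ?(ltW u0).
  - by rewrite invr_ge0 ltW.
rewrite powRM ?exprn_ge0 ?(ltW u0)// expn_powR ?(ltW u0)//.
rewrite /u -powRrM mulVf ?gt_eqF// powRr1 ?(ltW r0)//.
rewrite ler_pM2r ?exprn_gt0//; apply: ler_powR => //.
by rewrite /g1 lerDl.
Qed.

(** * From the averages at integer radii to the maximal function *)

Section maximal_function.
Context d (T : measurableType d) (R : realType).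
Variables (mu : {sigma_finite_measure set T -> \bar R}) (dist : T -> T -> R).
Variables (kappa : R) (GS : growth_space mu dist kappa).
Local Notation ball := (dball dist).
Local Notation ball_int := (ball_int mu dist).

Definition centered_maximal (f : T -> \bar R) (x : T) : \bar R :=
  ereal_sup [set (mu (ball x r))^-1 * ball_int r f x | r in [set r : R | (0 < r)%R]].

Variables (b : R) (bdef : b = expR kappa).
Let b0 : (0 < b)%R. Proof. by rewrite bdef expR_gt0. Qed.

(** Normalized by exp(kappa j), which is comparable to the volume, instead of the volume itself: a
    constant factor passes through the symmetry of [ball_int]. *)
Definition discrete_mean (j : nat) (f : T -> \bar R) (x : T) : \bar R :=
  ((b ^+ j)^-1)%:E * ball_int j%:R f x.

Lemma discrete_mean_ge0 j f x : (forall y, 0 <= f y) -> 0 <= discrete_mean j f x.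
Proof.
move=> f0; apply: mule_ge0; last exact: ball_int_ge0.
by rewrite lee_fin invr_ge0 exprn_ge0// ltW.
Qed.

Lemma measurable_discrete_mean j f : measurable_fun setT f ->
  (forall y, 0 <= f y) -> measurable_fun setT (discrete_mean j f).
Proof. by move=> mf f0; apply: emeasurable_funM => //; exact: (measurable_ball_int GS). Qed.

(** The radius is rounded up to an integer j <= r + 1. In the constant, [b] pays for the rounding
    and [c] for the comparison of the volume with the exponential. *)
Lemma mean_le_discrete_mean : exists2 D : R, (0 < D)%R &
  forall f, (forall y, 0 <= f y) -> forall x r, (6^-1 <= r)%R ->
  exists j, (mu (ball x r))^-1 * ball_int r f x <= D%:E * discrete_mean j f x.
Proof.
have r60 : (0 < 6^-1 :> R)%R by [].
have [c [C [c0 C0 HV]]] := ball_growth GS r60.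
have k0 := growth_rate_gt0 GS.
exists (b / c)%R; first by rewrite divr_gt0.
move=> f f0 x r r6; exists (Num.truncn r).+1; set j := (Num.truncn r).+1.
have rj : (r <= j%:R)%R by rewrite ltW// truncnS_gt.
have jr : (j%:R <= r + 1)%R.
  by rewrite /j -natr1 lerD2r; rewrite truncn_le (le_trans _ r6).
have /andP[Hv _] := HV x r r6.
have v0 : 0 < mu (ball x r) by apply: (dball_measure_gt0 GS); exact: lt_le_trans r6.
have voo := dball_measure_lty GS x r.
have sub : ball_int r f x <= ball_int j%:R f x.
  by apply: ge0_subset_integralW => //; exact: dball_subr.
case: (mu (ball x r)) v0 voo Hv => [v| |]// v0 _; rewrite lee_fin => Hv.
rewrite lte_fin in v0; rewrite inver (gt_eqF v0) /discrete_mean muleA -EFinM.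
apply: lee_pmul => //; first by rewrite lee_fin invr_ge0 ltW.
  exact: ball_int_ge0.
rewrite lee_fin -[leLHS]mul1r ler_pdivrMr//.
have bj0 : (0 < b ^+ j)%R by exact: exprn_gt0.
rewrite (_ : b / c * (b ^+ j)^-1 * v = v * b / (c * b ^+ j))%R; last first.
  by field; rewrite !gt_eqF.
rewrite ler_pdivlMr ?mulr_gt0// mul1r.
apply: (@le_trans _ _ (c * expR (kappa * r) * b))%R; last by rewrite ler_pM2r.
rewrite -mulrA ler_pM2l// bdef -expRD -expRM_natl ler_expR -mulr_natl.
by nra.
Qed.

Lemma centered_maximal_le : exists2 D : R, (0 < D)%R &
  forall f (M : T -> \bar R) x, (forall y, 0 <= f y) ->
  (forall r, (0 < r < 6^-1)%R -> (mu (ball x r))^-1 * ball_int r f x <= M x) ->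
  centered_maximal f x <= maxe (M x)
    (D%:E * ereal_sup (range (fun j => discrete_mean j f x))).
Proof.
have [D D0 H] := mean_le_discrete_mean; exists D => //.
move=> f M x f0 HM; apply: ge_ereal_sup => _ [r /= r0 <-].
have [r6|r6] := ltP r 6^-1%R; rewrite le_max.
  by rewrite HM// r0.
apply/orP; right; have [j Hj] := H f f0 x r r6.
apply: (le_trans Hj); apply: lee_wpmul2l; first by rewrite lee_fin ltW.
by apply: ereal_sup_ubound; exists j.
Qed.

Section strong_type.
Variables (q A C rho : R) (v : T -> R).
Hypotheses (q1 : (1 < q)%R) (mv : measurable_fun setT v) (v0 : forall x, (0 < v x)%R).
Hypothesis A0 : (0 < A)%R.
Hypothesis Aq : forall x r, (0 < r <= 1)%R ->
  \int[mu]_(y in ball x r) (v y)%:E *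
  (\int[mu]_(y in ball x r) (dual_weight q v y)%:E) `^ (q - 1)
  <= A%:E * mu (ball x r) `^ q.
Hypotheses (C0 : (0 < C)%R) (rho01 : (0 < rho < 1)%R).
Hypothesis decay : forall f : T -> R, measurable_fun setT f ->
  (forall x, (0 <= f x)%R) -> forall j,
  \int[mu]_x (discrete_mean j (EFin \o f) x `^ q * (v x)%:E) <=
  (C * rho ^+ j)%:E * \int[mu]_x ((f x)%:E `^ q * (v x)%:E).

Let q0 : (0 < q)%R. Proof. exact: lt_trans q1. Qed.

(** The [q]-th power of a supremum is at most the sum of the [q]-th powers, and that sum converges
    by the decay. The majorant [U] is supplied because it is measurable, which allows the weight
    under its integral to be changed on a null set. *)
Lemma centered_maximal_strong_type : exists2 K : R, (0 < K)%R &
  forall f : T -> R, measurable_fun setT f -> (forall x, (0 <= f x)%R) ->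
  exists U : T -> \bar R, [/\ measurable_fun setT U,
    forall x, 0 <= centered_maximal (EFin \o f) x <= U x &
    \int[mu]_x (U x `^ q * (v x)%:E) <=
    K%:E * \int[mu]_x ((f x)%:E `^ q * (v x)%:E)].
Proof.
have /andP[rho0 rho1] := rho01.
have [M [K [K0 HM]]] := local_maximal_bound GS q1 mv v0 A0 Aq.
have [D D0 HD] := centered_maximal_le.
have rho10 : (0 < 1 - rho)%R by rewrite subr_gt0.
have Dq0 : (0 < D `^ q)%R by exact: powR_gt0.
exists (K + D `^ q * (C * (1 - rho)^-1))%R.
  by rewrite addr_gt0// mulr_gt0// mulr_gt0// invr_gt0.
move=> f mf f0.
have mfE : measurable_fun setT (EFin \o f) by exact/measurable_EFinP.
have f0E x : 0 <= (EFin \o f) x by rewrite /= lee_fin.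
have [mM M0 Mr HMf] := HM _ mfE f0E.
pose g j x := discrete_mean j (EFin \o f) x `^ q * (v x)%:E.
have dm0 j x : 0 <= discrete_mean j (EFin \o f) x by exact: discrete_mean_ge0.
have g0 j x : 0 <= g j x by rewrite mule_ge0 ?poweR_ge0// lee_fin ltW.
have mg j : measurable_fun setT (g j).
  apply: emeasurable_funM; last exact/measurable_EFinP.
  apply: (measurableT_comp (measurable_poweR _)); exact: measurable_discrete_mean.
have mMq : measurable_fun setT (fun x => M (EFin \o f) x `^ q * (v x)%:E).
  apply: emeasurable_funM; last exact/measurable_EFinP.
  exact: measurableT_comp (measurable_poweR _) mM.
have Mq0 x : 0 <= M (EFin \o f) x `^ q * (v x)%:E.
  by rewrite mule_ge0 ?poweR_ge0// lee_fin ltW.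
have cm0 x : 0 <= centered_maximal (EFin \o f) x.
  apply: (@le_trans _ _ ((mu (ball x 1%R))^-1 * ball_int 1%R (EFin \o f) x)).
    by rewrite mule_ge0 ?inve_ge0// ball_int_ge0.
  by apply: ereal_sup_ubound; exists 1%R => //=; exact: ltr01.
have mS : measurable_fun setT (fun x => \sum_(j <oo) g j x).
  exact: ge0_emeasurable_sum.
pose Sup x := ereal_sup (range (fun j => discrete_mean j (EFin \o f) x)).
have mSup : measurable_fun setT Sup.
  have -> : Sup = fun x => esups (fun j => discrete_mean j (EFin \o f) x) 0%N.
    apply/funext => x; rewrite /Sup /esups /=; congr ereal_sup.
    by apply/seteqP; split => [_ [j _ <-]|_ [j _ <-]]; exists j.
  by apply: measurable_fun_esups => j; exact: measurable_discrete_mean.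
pose U x := maxe (M (EFin \o f) x) (D%:E * Sup x).
have cmU x : centered_maximal (EFin \o f) x <= U x.
  exact: HD (EFin \o f) (M (EFin \o f)) x f0E (Mr x).
exists U; split.
- by apply: measurable_maxe => //; exact: emeasurable_funM.
- by move=> x; rewrite cm0 cmU.
apply: (@le_trans _ _ (\int[mu]_x (M (EFin \o f) x `^ q * (v x)%:E +
    (D `^ q)%:E * \sum_(j <oo) g j x))).
  apply: ge0_le_integralW => x _; first by rewrite mule_ge0 ?poweR_ge0// lee_fin ltW.
  pose Sx := Sup x.
  have S0 : 0 <= Sx.
    by apply: (le_trans (dm0 0%N x)); apply: ereal_sup_ubound; exists 0%N.
  have SS : Sx `^ q * (v x)%:E <= \sum_(j <oo) g j x.
    pose Z := \sum_(j <oo) (discrete_mean j (EFin \o f) x `^ q).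
    have Z0 : 0 <= Z by apply: nneseries_ge0 => j _ _; exact: poweR_ge0.
    rewrite -nneseriesZr_ereal; last 2 first.
    - by move=> j; exact: poweR_ge0.
    - by rewrite lee_fin ltW.
    apply: lee_wpmul2r; first by rewrite lee_fin ltW.
    have qV (y : \bar R) : 0 <= y -> y = (y `^ q) `^ q^-1.
      by move=> y0; rewrite -poweRrM mulfV ?gt_eqF// poweRe1.
    have qV' (y : \bar R) : 0 <= y -> y = (y `^ q^-1) `^ q.
      by move=> y0; rewrite -poweRrM mulVf ?gt_eqF// poweRe1.
    rewrite -/Z [leRHS]qV'//; apply: lee_poweR => //; first exact: ltW.
    apply: ge_ereal_sup => _ [j _ <-]; rewrite [leLHS]qV//.
    apply: lee_poweR; [by rewrite invr_ge0 ltW|exact: poweR_ge0|].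
    by apply: (nneseries_ge_term (u := fun j => discrete_mean j (EFin \o f) x `^ q)) => n; exact: poweR_ge0.
  have vx0 : 0 <= (v x)%:E by rewrite lee_fin ltW.
  have Dq : (D%:E * Sx) `^ q * (v x)%:E = (D `^ q)%:E * (Sx `^ q * (v x)%:E).
    by rewrite poweRM ?lee_fin ?(ltW D0)// poweR_EFin muleA.
  have DS : (D%:E * Sx) `^ q * (v x)%:E <= (D `^ q)%:E * \sum_(j <oo) g j x.
    by rewrite Dq; apply: lee_wpmul2l => //; rewrite lee_fin ltW.
  rewrite /U maxEle; case: ifP => _.
    apply: (le_trans DS); rewrite leeDr//.
  rewrite leeDl// mule_ge0 ?lee_fin ?(ltW Dq0)//.
  by apply: nneseries_ge0 => j _ _.
rewrite ge0_integralD; last 5 first.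
- exact: measurableT.
- by move=> x _; exact: Mq0.
- exact: mMq.
- move=> x _; rewrite mule_ge0 ?lee_fin ?(ltW Dq0)//.
  by apply: nneseries_ge0 => j _ _.
- exact: emeasurable_funM.
set Y := \int[mu]_x ((f x)%:E `^ q * (v x)%:E).
have Y0 : 0 <= Y by apply: integral_ge0 => x _; rewrite mule_ge0 ?poweR_ge0// lee_fin ltW.
rewrite EFinD ge0_muleDl ?lee_fin ?(ltW K0)//; last first.
  by rewrite !mulr_ge0 ?(ltW Dq0) ?(ltW C0)// invr_ge0 ltW.
apply: leeD; first exact: HMf.
rewrite ge0_integralZl; last 4 first.
- exact: measurableT.
- exact: mS.
- by move=> x _; apply: nneseries_ge0 => j _ _.
- by rewrite lee_fin ltW.
rewrite (EFinM (D `^ q)) -[leRHS]muleA; apply: lee_wpmul2l; first by rewrite lee_fin ltW.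
rewrite integral_nneseries//.
apply: (@le_trans _ _ (\sum_(j <oo) ((rho ^+ j)%:E * (C%:E * Y)))).
  apply: lee_nneseries => [j _ _|j _]; first exact: integral_ge0.
  by rewrite muleA -EFinM mulrC; exact: decay.
have CY0 : 0 <= C%:E * Y by rewrite mule_ge0// lee_fin ltW.
rewrite -nneseriesZr_ereal//; last by move=> j; rewrite lee_fin exprn_ge0// ltW.
rewrite (mulrC C) EFinM -muleA; apply: lee_wpmul2r => //.
by apply: nneseries_geometric_le; rewrite ?(ltW rho0).
Qed.

End strong_type.
End maximal_function.

(** * Geometry of hyperbolic space *)

Section hyperbolic_cosine.
Context (R : realType).
Implicit Types c r : R.
Local Open Scope ring_scope.

Definition cosh (r : R) : R := (expR r + expR (- r)) / 2.
Definition arcosh (c : R) : R := ln (c + Num.sqrt (c ^+ 2 - 1)).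

Lemma sqrt_cosh_sqr c : 1 <= c -> Num.sqrt (c ^+ 2 - 1) ^+ 2 = c ^+ 2 - 1.
Proof. by move=> c1; rewrite sqr_sqrtr// subr_ge0 expr_ge1//; lra. Qed.

Lemma arcosh_arg_ge1 c : 1 <= c -> 1 <= c + Num.sqrt (c ^+ 2 - 1).
Proof. by move=> c1; have := sqrtr_ge0 (c ^+ 2 - 1); lra. Qed.

Lemma arcosh_ge0 c : 1 <= c -> 0 <= arcosh c.
Proof. by move=> c1; apply: ln_ge0; exact: arcosh_arg_ge1. Qed.

Lemma arcosh1 : arcosh 1 = 0.
Proof. by rewrite /arcosh expr1n subrr sqrtr0 addr0 ln1. Qed.

(** With u = c + sqrt(c^2 - 1), whose inverse is c - sqrt(c^2 - 1), and v = exp(r), one has (v - u)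
    (1 - 1 / (u v)) = 2 (cosh r - c), and the second factor is nonnegative. *)
Lemma arcosh_lt c r : 1 <= c -> 0 < r -> (arcosh c < r) = (c < cosh r).
Proof.
move=> c1 r0; rewrite /arcosh /cosh.
have := sqrt_cosh_sqr c1; have := sqrtr_ge0 (c ^+ 2 - 1).
set S := Num.sqrt _ => S0 SE.
have u0 : 0 < c + S by lra.
rewrite -[in LHS](expRK r) ltr_ln ?posrE ?expR_gt0//.
have v1 : 1 < expR r by rewrite -expR0 ltr_expR.
have : expR r * expR (- r) = 1 by rewrite -expRD subrr expR0.
move: v1; set v := expR r; set v' := expR (- r) => v1 vv'.
have v'0 : 0 < v' by exact: expR_gt0.
have uS : (c + S) * (c - S) = 1.
  have -> : (c + S) * (c - S) = c ^+ 2 - S ^+ 2 by ring.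
  by rewrite SE; ring.
have cS0 : 0 < c - S by rewrite -(pmulr_rgt0 _ u0) uS.
rewrite ltr_pdivlMr//.
apply/idP/idP => [cv|].
  have : (v - (c + S)) * (1 - v' * (c - S)) > 0.
    rewrite mulr_gt0 ?subr_gt0//.
    have cS1 : c - S <= 1 by nra.
    have v'1 : v' < 1 by nra.
    by nra.
  have e : (v - (c + S)) * (1 - v' * (c - S)) = v - (c + S) - (v * v') * (c - S) + v' * ((c + S) * (c - S)) by ring.
  by rewrite e vv' uS; lra.
apply: contraTT; rewrite -!leNgt => vc.
have : (c + S - v) * (1 - v' * (c - S)) >= 0.
  rewrite mulr_ge0 ?subr_ge0//.
  have cS1 : c - S <= 1 by nra.
  have v'1 : v' < 1 by nra.
  by nra.
have e : (c + S - v) * (1 - v' * (c - S)) = c + S - v - v' * ((c + S) * (c - S)) + (v * v') * (c - S) by ring.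
by rewrite e vv' uS; lra.
Qed.

(** The addition formula of the hyperbolic cosine: for C = c1 c2 + s1 s2, the product (c1 + s1) (c2
    + s2) equals C + sqrt(C^2 - 1). *)
Lemma arcosh_le_add c1 c2 c3 : 1 <= c1 -> 1 <= c2 -> 1 <= c3 ->
  c3 <= c1 * c2 + Num.sqrt (c1 ^+ 2 - 1) * Num.sqrt (c2 ^+ 2 - 1) ->
  arcosh c3 <= arcosh c1 + arcosh c2.
Proof.
move=> h1 h2 h3; rewrite /arcosh.
have := sqrt_cosh_sqr h1; have := sqrtr_ge0 (c1 ^+ 2 - 1).
have := sqrt_cosh_sqr h2; have := sqrtr_ge0 (c2 ^+ 2 - 1).
set s1 := Num.sqrt (c1 ^+ 2 - 1); set s2 := Num.sqrt (c2 ^+ 2 - 1).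
move=> s20 E2 s10 E1 H.
rewrite -lnM ?posrE; [|lra|lra].
have C1 : 1 <= c1 * c2 + s1 * s2 by exact: le_trans h3 H.
rewrite ler_ln ?posrE; last 2 first.
- by have := sqrtr_ge0 (c3 ^+ 2 - 1); lra.
- by rewrite mulr_gt0//; lra.
have -> : (c1 + s1) * (c2 + s2) = (c1 * c2 + s1 * s2) + (c1 * s2 + s1 * c2) by ring.
apply: lerD => //.
rewrite -[leRHS]ger0_norm; last by rewrite addr_ge0// mulr_ge0//; lra.
rewrite -sqrtr_sqr ler_sqrt ?sqr_ge0//.
have -> : (c1 * s2 + s1 * c2) ^+ 2 = (c1 * c2 + s1 * s2) ^+ 2 - 1.
  have : s1 ^+ 2 * s2 ^+ 2 = (c1 ^+ 2 - 1) * (c2 ^+ 2 - 1) by rewrite E1 E2.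
  have : c1 ^+ 2 * s2 ^+ 2 = c1 ^+ 2 * (c2 ^+ 2 - 1) by rewrite E2.
  have : s1 ^+ 2 * c2 ^+ 2 = (c1 ^+ 2 - 1) * c2 ^+ 2 by rewrite E1.
  have -> : (c1 * s2 + s1 * c2) ^+ 2 = c1 ^+ 2 * s2 ^+ 2 + s1 ^+ 2 * c2 ^+ 2 + 2 * (c1 * c2 * s1 * s2) by ring.
  have -> : (c1 * c2 + s1 * s2) ^+ 2 = c1 ^+ 2 * c2 ^+ 2 + s1 ^+ 2 * s2 ^+ 2 + 2 * (c1 * c2 * s1 * s2) by ring.
  move=> -> -> ->; ring.
rewrite lerD2r; apply: lerXn2r => //; rewrite nnegrE; lra.
Qed.

Lemma cosh_sub1 r : cosh r - 1 = (expR (r / 2) - expR (- (r / 2))) ^+ 2 / 2.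
Proof.
rewrite /cosh; have e1 : expR r = expR (r / 2) ^+ 2.
  by rewrite -expRM_natl -mulr_natl; congr expR; field.
have e2 : expR (- r) = expR (- (r / 2)) ^+ 2.
  by rewrite -expRM_natl -mulr_natl; congr expR; field.
have e3 : expR (r / 2) * expR (- (r / 2)) = 1 by rewrite -expRD subrr expR0.
rewrite e1 e2; move: e3; set x := expR (r / 2); set y := expR _ => e3.
rewrite (_ : (x - y) ^+ 2 = x ^+ 2 - 2 * (x * y) + y ^+ 2); last by ring.
by rewrite e3; lra.
Qed.

Lemma expR_sub_ge r : 0 <= r -> r <= expR r - expR (- r).
Proof.
move=> r0; have := expR_ge1Dx r; have : expR (- r) <= 1 by rewrite expR_le1 oppr_le0.
by lra.
Qed.

Lemma expR_sub_le r : 0 <= r -> expR r - expR (- r) <= 2 * r * expR r.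
Proof.
move=> r0; have h1 := expR_ge1Dx (- r).
have e3 : expR r * expR (- r) = 1 by rewrite -expRD subrr expR0.
have r1 : 1 <= expR r by rewrite -expR0 ler_expR.
have : expR r * (1 + - r) <= 1 by rewrite -[leRHS]e3 ler_pM2l ?expR_gt0.
have : r <= r * expR r by rewrite ler_peMr.
by lra.
Qed.

Lemma cosh_sub1_ge r : 0 <= r -> r ^+ 2 / 8 <= cosh r - 1.
Proof.
move=> r0; rewrite cosh_sub1; have r20 : 0 <= r / 2 by lra.
have := expR_sub_ge r20 => h.
have : (r / 2) ^+ 2 <= (expR (r / 2) - expR (- (r / 2))) ^+ 2.
  by apply: lerXn2r => //; rewrite nnegrE//; lra.
have -> : (r / 2) ^+ 2 = r ^+ 2 / 4 by field.
by lra.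
Qed.

Lemma cosh_sub1_le r : 0 <= r -> cosh r - 1 <= (r * expR (r / 2)) ^+ 2 / 2.
Proof.
move=> r0; rewrite cosh_sub1; have r20 : 0 <= r / 2 by lra.
have := expR_sub_le r20 => h.
have h0 := expR_sub_ge r20.
have e : 2 * (r / 2) * expR (r / 2) = r * expR (r / 2) by field.
rewrite e in h.
have : (expR (r / 2) - expR (- (r / 2))) ^+ 2 <= (r * expR (r / 2)) ^+ 2.
  by apply: lerXn2r => //; rewrite nnegrE; lra.
by lra.
Qed.

End hyperbolic_cosine.

Section hyperbolic_distance.
Context (R : realType) (n : nat).
Local Notation H := (hyp R n).
Local Open Scope ring_scope.
Implicit Types x y z : H.

Definition hx x (i : 'I_n.-1) : R := tnth (val x).1 i.
Definition ht x : R := (val x).2.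
Definition hquad x y : R := \sum_(i < n.-1) (hx x i - hx y i) ^+ 2 + (ht x - ht y) ^+ 2.

Lemma ht_gt0 x : 0 < ht x. Proof. exact: (valP x). Qed.

Lemma hdistE x y : hdist x y = arcosh (1 + hquad x y / (2 * ht x * ht y)).
Proof.
rewrite /hdist /arcosh /hquad /hx /ht.
by case: (val x) => a t; case: (val y) => b s.
Qed.

Lemma hquad_ge0 x y : 0 <= hquad x y.
Proof. by rewrite addr_ge0 ?sqr_ge0// sumr_ge0// => i _; exact: sqr_ge0. Qed.

Lemma hcosh_ge1 x y : 1 <= 1 + hquad x y / (2 * ht x * ht y).
Proof.
by rewrite lerDl divr_ge0 ?hquad_ge0// !mulr_ge0// ltW// ht_gt0.
Qed.

Lemma hdist_ge0 x y : 0 <= hdist x y.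
Proof. by rewrite hdistE arcosh_ge0// hcosh_ge1. Qed.

Lemma hdistxx x : hdist x x = 0.
Proof.
rewrite hdistE (_ : hquad x x = 0) ?mul0r ?addr0 ?arcosh1//.
by rewrite /hquad subrr expr0n/= addr0 big1// => i _; rewrite subrr expr0n.
Qed.

Lemma hdistC x y : hdist x y = hdist y x.
Proof.
rewrite !hdistE; congr arcosh; congr (1 + _ / _); last by rewrite mulrAC.
by rewrite /hquad -(opprB (ht y)) sqrrN; congr (_ + _); apply: eq_bigr => i _; rewrite -opprB sqrrN.
Qed.

Lemma hdist_lt x y r : 0 < r ->
  (hdist x y < r) = (hquad x y < 2 * ht x * ht y * (cosh r - 1)).
Proof.
move=> r0; have h0 : 0 < 2 * ht x * ht y by rewrite !mulr_gt0 ?ht_gt0.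
rewrite hdistE arcosh_lt ?hcosh_ge1// -ltrBrDl ltr_pdivrMr// [X in _ < X]mulrC//.
Qed.

(** E (E D - N^2) is the squared norm of E f - N g, with [a] and [b] as additional coordinates of
    [f] and [g]; if E = 0, the second vector is zero. *)
Lemma cauchy_schwarz_sum k (f g : 'I_k -> R) (a b : R) :
  - (a * b + \sum_i f i * g i) <=
  Num.sqrt (a ^+ 2 + \sum_i f i ^+ 2) * Num.sqrt (b ^+ 2 + \sum_i g i ^+ 2).
Proof.
set D := a ^+ 2 + _; set E := b ^+ 2 + _; set N := a * b + _.
have P0 (h : 'I_k -> R) : 0 <= \sum_i h i ^+ 2 by apply: sumr_ge0 => i _; exact: sqr_ge0.
have D0 : 0 <= D by rewrite addr_ge0 ?sqr_ge0.
have E0 : 0 <= E by rewrite addr_ge0 ?sqr_ge0.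
have key : 0 <= E * (E * D - N ^+ 2).
  have -> : E * (E * D - N ^+ 2) = (E * a - N * b) ^+ 2 + \sum_i (E * f i - N * g i) ^+ 2.
    have -> : \sum_i (E * f i - N * g i) ^+ 2 =
        E ^+ 2 * (\sum_i f i ^+ 2) - 2 * E * N * (\sum_i f i * g i) + N ^+ 2 * (\sum_i g i ^+ 2).
      rewrite !mulr_sumr -sumrB -big_split/=; apply: eq_bigr => i _; ring.
    have -> : \sum_i f i ^+ 2 = D - a ^+ 2 by rewrite /D; ring.
    have -> : \sum_i g i ^+ 2 = E - b ^+ 2 by rewrite /E; ring.
    have -> : \sum_i f i * g i = N - a * b by rewrite /N; ring.
    ring.
  by rewrite addr_ge0 ?sqr_ge0.
apply: (@le_trans _ _ `|N|); first by rewrite -normrN ler_norm.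
rewrite -sqrtrM// -sqrtr_sqr ler_sqrt ?mulr_ge0//.
have [Ez|Ez] := eqVneq E 0; last first.
  have Ep : 0 < E by rewrite lt0r Ez.
  by move: key; rewrite pmulr_rge0// subr_ge0 mulrC.
have /andP[/eqP b2 /eqP g2] : (b ^+ 2 == 0) && (\sum_i g i ^+ 2 == 0).
  by rewrite -paddr_eq0 ?sqr_ge0//; apply/eqP.
have b0 : b = 0 by apply/eqP; rewrite -sqrf_eq0 b2.
have gi i : g i = 0.
  apply/eqP; rewrite -sqrf_eq0; apply/eqP.
  have /psumr_eq0P : forall i, true -> 0 <= g i ^+ 2 by move=> *; exact: sqr_ge0.
  by move/(_ g2 i isT).
rewrite /N b0 mulr0 add0r big1 ?expr0n ?mulr_ge0// => i _.
by rewrite gi mulr0.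
Qed.

(* With [y] as base point, [cosh d(x, y)] is the time coordinate of [x] in the
   hyperboloid model, so that [cosh d(x, z) = c1 c2 - <u, v>] with [|u|^2 =
   c1^2 - 1] and [|v|^2 = c2^2 - 1]. *)
Lemma hdist_triangle x y z : hdist x z <= hdist x y + hdist y z.
Proof.
rewrite (hdistC x y) !hdistE; apply: arcosh_le_add; rewrite ?hcosh_ge1//.
rewrite (_ : hquad y x = hquad x y) 1?(_ : 2 * ht y * ht x = 2 * ht x * ht y); last 2 first.
- by ring.
- rewrite /hquad -(opprB (ht x)) sqrrN; congr (_ + _).
  by apply: eq_bigr => i _; rewrite -opprB sqrrN.
rewrite (_ : hquad y z = hquad z y) 1?(_ : 2 * ht y * ht z = 2 * ht z * ht y); last 2 first.
- by ring.
- rewrite /hquad -(opprB (ht z)) sqrrN; congr (_ + _).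
  by apply: eq_bigr => i _; rewrite -opprB sqrrN.
have t0 := ht_gt0 x; have s0 := ht_gt0 z; have u0 := ht_gt0 y.
pose P := \sum_(i < n.-1) (hx x i - hx y i) ^+ 2.
pose Q := \sum_(i < n.-1) (hx z i - hx y i) ^+ 2.
pose W := \sum_(i < n.-1) (hx x i - hx y i) * (hx z i - hx y i).
set t := ht x in t0 *; set s := ht z in s0 *; set u := ht y in u0 *.
have qxz : hquad x z = P + Q - 2 * W + (t - s) ^+ 2.
  rewrite /hquad -/t -/s; congr (_ + _); rewrite /P /Q /W mulr_sumr -big_split/= -sumrB.
  by apply: eq_bigr => i _; ring.
have -> : hquad x y = P + (t - u) ^+ 2 by [].
have -> : hquad z y = Q + (s - u) ^+ 2 by [].
rewrite qxz.
(* These vectors are the space coordinates of [x] and [z] in the hyperboloid model based at [y]. The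
   identities that follow compute their squared norms, c1^2 - 1 and c2^2 - 1. *)
have := cauchy_schwarz_sum (fun i => (hx x i - hx y i) / t) (fun i => (hx z i - hx y i) / s)
  ((P + t ^+ 2 - u ^+ 2) / (2 * t * u)) ((Q + s ^+ 2 - u ^+ 2) / (2 * s * u)).
have -> : \sum_i ((hx x i - hx y i) / t) ^+ 2 = P / t ^+ 2.
  by rewrite /P mulr_suml; apply: eq_bigr => i _; rewrite expr_div_n.
have -> : \sum_i ((hx z i - hx y i) / s) ^+ 2 = Q / s ^+ 2.
  by rewrite /Q mulr_suml; apply: eq_bigr => i _; rewrite expr_div_n.
have -> : \sum_i (hx x i - hx y i) / t * ((hx z i - hx y i) / s) = W / (t * s).
  by rewrite /W mulr_suml; apply: eq_bigr => i _; rewrite mulf_div.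
have -> : ((P + t ^+ 2 - u ^+ 2) / (2 * t * u)) ^+ 2 + P / t ^+ 2 =
    (1 + (P + (t - u) ^+ 2) / (2 * t * u)) ^+ 2 - 1.
  by field; rewrite !gt_eqF.
have -> : ((Q + s ^+ 2 - u ^+ 2) / (2 * s * u)) ^+ 2 + Q / s ^+ 2 =
    (1 + (Q + (s - u) ^+ 2) / (2 * s * u)) ^+ 2 - 1.
  by field; rewrite !gt_eqF.
move=> CS; rewrite -lerBlDl; apply: le_trans CS.
apply: eq_leW.
by field; rewrite !gt_eqF.
Qed.

Lemma measurable_hx i : measurable_fun setT (fun x : H => hx x i).
Proof.
apply: (measurableT_comp (measurable_tnth i)).
exact: (measurableT_comp measurable_fst (@measurable_hyp_val R n)).
Qed.

Lemma measurable_ht : measurable_fun setT ht.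
Proof. exact: (measurableT_comp measurable_snd (@measurable_hyp_val R n)). Qed.

Lemma measurable_hdist_lt r : measurable [set xy : H * H | hdist xy.1 xy.2 < r].
Proof.
have [r0|r0] := ltP 0 r; last first.
  rewrite (_ : [set _ | _] = set0)//; apply/seteqP; split => // xy /=.
  by rewrite ltNge (le_trans r0)// hdist_ge0.
rewrite (_ : [set _ | _] = [set xy : H * H | hquad xy.1 xy.2 <
    2 * ht xy.1 * ht xy.2 * (cosh r - 1)]); last first.
  by apply/seteqP; split => xy /=; rewrite hdist_lt.
have m1 (f : H -> R) : measurable_fun setT f -> measurable_fun setT (fun xy : H * H => f xy.1).
  by move=> mf; exact: (measurableT_comp mf measurable_fst).
have m2 (f : H -> R) : measurable_fun setT f -> measurable_fun setT (fun xy : H * H => f xy.2).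
  by move=> mf; exact: (measurableT_comp mf measurable_snd).
rewrite -[X in measurable X]setTI.
apply: (measurable_fun_ltr (D := setT)) => //.
- rewrite /hquad; apply: measurable_funD.
    apply: (measurable_sum (index_enum _) (h := fun i (xy : H * H) => (hx xy.1 i - hx xy.2 i) ^+ 2)) => i.
    apply: measurable_funX; apply: measurable_funB.
      exact: (m1 _ (measurable_hx i)).
    exact: (m2 _ (measurable_hx i)).
  apply: measurable_funX; apply: measurable_funB; [exact: (m1 _ measurable_ht)|exact: (m2 _ measurable_ht)].
- apply: measurable_funM => //; apply: measurable_funM; last exact: (m2 _ measurable_ht).
  by apply: measurable_funM => //; exact: (m1 _ measurable_ht).
Qed.

End hyperbolic_distance.

(** * Volumes of boxes and balls *)

Section box_volume.
Context (R : realType).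

Definition tuple_box m (a : m.-tuple R) (rho : R) : set (m.-tuple R) :=
  [set b | forall i, (`|tnth b i - tnth a i| < rho)%R].

Lemma measurable_tuple_box m (a : m.-tuple R) rho : measurable (tuple_box a rho).
Proof.
rewrite (_ : tuple_box a rho =
    \bigcap_(i in [set: 'I_m]) [set b : m.-tuple R | (`|tnth b i - tnth a i| < rho)%R]); last first.
  by apply/seteqP; split => [b ab i _|b ab i]; [exact: ab|exact: ab i Logic.I].
apply: fin_bigcap_measurable => // i _.
rewrite -[X in measurable X]setTI.
apply: (measurable_fun_ltr (D := setT)) => //.
apply: (measurableT_comp (@normr_measurable R setT)).
apply: measurable_funB => //; exact: measurable_tnth.
Qed.

Lemma tuple_lebesgue_box m (a : m.-tuple R) (rho : R) : (0 < rho)%R ->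
  tuple_lebesgue R m (tuple_box a rho) = ((2 * rho) ^+ m)%:E.
Proof.
move=> rho0; elim: m a => [|m IH] a.
  rewrite /= /dirac/= expr0 indicE mem_set//.
  by case.
pose I := `](thead a - rho)%R, (thead a + rho)%R[%classic.
pose a' : m.-tuple R := [tuple of behead a].
have pre : @cons_pair R m @^-1` (tuple_box a rho) = I `*` tuple_box a' rho.
  have aE : a = cons_pair (thead a, a') by rewrite -[LHS]unconsK.
  apply/seteqP; split => -[x t] /=; rewrite /tuple_box /I /=.
    move=> H; split.
      have := H ord0; rewrite /cons_pair/= {1}aE /= tnth0 tnth0 in_itv/= ltr_norml.
      by move=> /andP[? ?]; apply/andP; split; lra.
    move=> i; have := H (lift ord0 i); rewrite /cons_pair/= {1}aE /=.
    by rewrite !tnthS.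
  move=> [+ H] i; rewrite in_itv/= => /andP[? ?].
  rewrite {1}aE /cons_pair/=; case: (unliftP ord0 i) => [j|] ->.
    by rewrite !tnthS; exact: H.
  by rewrite !tnth0 ltr_norml; apply/andP; split; lra.
rewrite /= /tuple_lebesgue_step /pushforward pre.
rewrite product_measure1E; last 2 first.
- exact: measurable_itv.
- exact: measurable_tuple_box.
rewrite IH exprS EFinM; congr (_ * _).
transitivity (@lebesgue_measure R I); first by [].
rewrite lebesgue_measure_itv/= lte_fin ifT; last by lra.
by rewrite -EFinB; congr _%:E; ring.
Qed.

Variable n : nat.
Local Notation H := (hyp R n).

(** Half-open in the height, like the intervals that [exists_level] provides, so that consecutive
    boxes leave no gap between them. *)
Definition hyp_box (a : n.-1.-tuple R) (rho l u : R) : set H :=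
  [set x | tuple_box a rho (val x).1 /\ (l < ht x <= u)%R].

Let image_box a rho l u : (0 <= l)%R ->
  (val : H -> _) @` (hyp_box a rho l u) = tuple_box a rho `*` `]l, u]%classic.
Proof.
move=> l0; apply/seteqP; split => [_ [x [xa xl] <-]|[b s] [/= ba]].
  by split => //=; rewrite in_itv.
rewrite in_itv/= => /andP[ls su].
have s0 : (0 < (b, s).2)%R by exact: le_lt_trans ls.
by exists (exist _ (b, s) s0) => //; split => //; rewrite /ht/= ls.
Qed.

Lemma measurable_hyp_box a rho l u : measurable (hyp_box a rho l u).
Proof.
rewrite (_ : hyp_box a rho l u = setT `&` val @^-1` (tuple_box a rho `*` `]l, u]%classic)).
  apply: measurable_hyp_val => //; apply: measurableX; first exact: measurable_tuple_box.
  exact: measurable_itv.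
by apply/seteqP; split => x; rewrite /hyp_box/= in_itv/= /ht; tauto.
Qed.

Let box_measure a rho l u : (0 < rho)%R -> (l < u)%R ->
  (tuple_lebesgue R n.-1 \x real_lebesgue R) (tuple_box a rho `*` `]l, u]%classic) =
  ((2 * rho) ^+ n.-1 * (u - l))%:E.
Proof.
move=> rho0 lu; rewrite product_measure1E; last 2 first.
- exact: measurable_tuple_box.
- exact: measurable_itv.
rewrite EFinM; congr (_ * _); first exact: tuple_lebesgue_box.
transitivity (@lebesgue_measure R `]l, u]%classic); first by [].
by rewrite lebesgue_measure_itv/= lte_fin lu EFinB.
Qed.

Let mbox (a : n.-1.-tuple R) (rho l u : R) :
  measurable (tuple_box a rho `*` `]l, u]%classic).
Proof. by apply: measurableX; [exact: measurable_tuple_box|exact: measurable_itv]. Qed.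

Let integral_box_cst (a : n.-1.-tuple R) (rho l u : R) (c : \bar R) :
  (0 < rho)%R -> (l < u)%R ->
  \int[tuple_lebesgue R n.-1 \x real_lebesgue R]_(p in
    tuple_box a rho `*` `]l, u]%classic) (cst c p) = c * ((2 * rho) ^+ n.-1 * (u - l))%:E.
Proof.
move=> rho0 lu; rewrite -(box_measure a rho0 lu).
exact: (integral_cst _ (mbox a rho l u)).
Qed.

Lemma hvol_box_le a rho l u : (0 < rho)%R -> (0 < l)%R -> (l < u)%R ->
  hvol (hyp_box a rho l u) <= ((2 * rho) ^+ n.-1 * (u - l) * l ^- n)%:E.
Proof.
move=> rho0 l0 lu; rewrite /hvol image_box ?(ltW l0)//.
apply: (@le_trans _ _ (\int[tuple_lebesgue R n.-1 \x real_lebesgue R]_(p in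
    tuple_box a rho `*` `]l, u]%classic) cst ((l ^- n)%:E) p)).
  apply: ge0_le_integralW => -[b s] [_ /=]; rewrite in_itv/= => /andP[ls _].
    by rewrite lee_fin invr_ge0 exprn_ge0// ltW// (lt_trans l0).
  have s0 := lt_trans l0 ls.
  by rewrite lee_fin lef_pV2 ?posrE ?exprn_gt0//; apply: lerXn2r; rewrite ?nnegrE ltW.
by rewrite integral_box_cst// -EFinM mulrC.
Qed.

Lemma hvol_box_ge a rho l u : (0 < rho)%R -> (0 < l)%R -> (l < u)%R ->
  ((2 * rho) ^+ n.-1 * (u - l) * u ^- n)%:E <= hvol (hyp_box a rho l u).
Proof.
move=> rho0 l0 lu; rewrite /hvol image_box ?(ltW l0)//.
apply: (@le_trans _ _ (\int[tuple_lebesgue R n.-1 \x real_lebesgue R]_(p in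
    tuple_box a rho `*` `]l, u]%classic) cst ((u ^- n)%:E) p)).
  by rewrite integral_box_cst// -EFinM mulrC.
apply: ge0_le_integralW => -[b s] [_ /=]; rewrite in_itv/= => /andP[ls su].
  by rewrite lee_fin invr_ge0 exprn_ge0// ltW// (lt_trans l0).
have s0 := lt_trans l0 ls; have u0 := lt_le_trans s0 su.
rewrite lee_fin lef_pV2 ?posrE ?exprn_gt0//.
by apply: lerXn2r => //; rewrite nnegrE ltW.
Qed.

End box_volume.

Section ball_volume.
Context (R : realType) (n : nat).
Hypothesis n2 : (2 <= n)%N.
Local Notation H := (hyp R n).
Local Notation box := (@hyp_box R n).
Let nS : n = n.-1.+1. Proof. by rewrite prednK// (leq_trans _ n2). Qed.
Let exprn_n (X : R) : (X ^+ n = X ^+ n.-1 * X)%R.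
Proof. by rewrite [in LHS]nS exprSr. Qed.
Let n0 : (0 < n%:R :> R)%R. Proof. by rewrite ltr0n (leq_trans _ n2). Qed.
Let n1n : (n.-1%:R + 1 = n%:R :> R)%R.
Proof. by rewrite natr1 prednK// (leq_trans _ n2). Qed.

Lemma measurable_hball (x : H) r : measurable (hball x r).
Proof.
have := measurable_xsection x (@measurable_hdist_lt R n r).
rewrite (_ : xsection _ _ = hball x r)//.
by apply/seteqP; split => y; rewrite /xsection/= inE.
Qed.

Let coord_le (x y : H) i : ((hx y i - hx x i) ^+ 2 + (ht x - ht y) ^+ 2 <= hquad x y)%R.
Proof.
rewrite /hquad lerD2r (bigD1 i)//= -opprB sqrrN lerDl sumr_ge0// => j _.
exact: sqr_ge0.
Qed.

Let quad_le (x y : H) (rho : R) : (0 <= rho)%R ->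
  (forall i, `|hx y i - hx x i| <= rho)%R ->
  (hquad x y <= n.-1%:R * rho ^+ 2 + (ht x - ht y) ^+ 2)%R.
Proof.
move=> rho0 xy; rewrite /hquad lerD2r.
apply: (@le_trans _ _ (\sum_(i < n.-1) rho ^+ 2)%R); last first.
  by rewrite sumr_const card_ord mulr_natl.
apply: ler_sum => i _; rewrite -opprB sqrrN -(real_normK (num_real _)).
by apply: lerXn2r; rewrite ?nnegrE.
Qed.

Let lt_norm (z rho : R) : (0 <= rho)%R -> (z ^+ 2 < rho ^+ 2)%R -> (`|z| < rho)%R.
Proof.
move=> rho0; rewrite -(real_normK (num_real z)) => zr; rewrite ltNge.
apply/negP => rz; move: zr; rewrite ltNge => /negP; apply.
by apply: lerXn2r; rewrite ?nnegrE.
Qed.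

(** Once the horizontal part is dropped, the condition on the distance reads (s - t e^r) (s - t
    e^-r) < 0, where t and s are the heights of [x] and [y]. *)
Let height_bounds (x y : H) r : (0 < r)%R -> hball x r y ->
  (ht x * expR (- r) < ht y)%R /\ (ht y < ht x * expR r)%R.
Proof.
move=> r0; rewrite /hball/= hdist_lt// /cosh.
have t0 := ht_gt0 x; have s0 := ht_gt0 y.
have P0 : (0 <= \sum_(i < n.-1) (hx x i - hx y i) ^+ 2)%R.
  by apply: sumr_ge0 => i _; exact: sqr_ge0.
rewrite /hquad; set P := (\sum_(i < n.-1) _)%R in P0 *.
have vv' : (expR r * expR (- r) = 1)%R by rewrite -expRD subrr expR0.
have v1 : (1 < expR r)%R by rewrite -expR0 ltr_expR.
have v'0 : (0 < expR (- r))%R by exact: expR_gt0.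
have v'1 : (expR (- r) < expR r)%R by rewrite ltr_expR; lra.
move: t0 s0 vv' v1 v'0 v'1; set t := ht x; set s := ht y.
set v := expR r; set v' := expR (- r) => t0 s0 vv' v1 v'0 v'1 Hq.
have key : ((s - t * v) * (s - t * v') < 0)%R.
  have -> : ((s - t * v) * (s - t * v') = s ^+ 2 - t * s * (v + v') + t ^+ 2 * (v * v'))%R by ring.
  rewrite vv'; have e : (2 * t * s * ((v + v') / 2 - 1) = t * s * (v + v') - 2 * t * s)%R by field.
  rewrite e in Hq.
  have e2 : ((t - s) ^+ 2 = t ^+ 2 + s ^+ 2 - 2 * t * s)%R by ring.
  rewrite e2 in Hq; lra.
have tvv : (t * v' < t * v)%R by rewrite ltr_pM2l.
split; rewrite ltNge; apply/negP => h; move: key; rewrite ltNge => /negP; apply.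
  by rewrite nmulr_rge0; lra.
by rewrite mulr_ge0//; lra.
Qed.

Lemma hball_small_subset (x : H) r : (0 < r <= 1)%R ->
  hball x r `<=` box (val x).1 (expR 1 * ht x * r) (ht x * expR (- r)) (ht x * expR r).
Proof.
move=> /andP[r0 r1] y xy; have [h1 h2] := height_bounds r0 xy.
split; last by rewrite h1 ltW.
move=> i; apply: lt_norm; first by rewrite !mulr_ge0 ?expR_ge0 ?ltW// ht_gt0.
move: xy; rewrite /hball/= hdist_lt// => xy.
have t0 := ht_gt0 x; have s0 := ht_gt0 y.
apply: (@le_lt_trans _ _ (hquad x y)).
  by apply: le_trans (coord_le x y i); rewrite lerDl sqr_ge0.
apply: (lt_le_trans xy).
have c0 : (0 <= cosh r - 1)%R.
  by apply: le_trans (cosh_sub1_ge (ltW r0)); rewrite divr_ge0 ?sqr_ge0.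
apply: (@le_trans _ _ (2 * ht x * (ht x * expR r) * (cosh r - 1)))%R.
  by rewrite ler_wpM2r// ler_wpM2l ?(ltW h2)// mulr_ge0// ltW.
apply: (@le_trans _ _ (2 * ht x * (ht x * expR r) * ((r * expR (r / 2)) ^+ 2 / 2)))%R.
  by rewrite ler_wpM2l ?cosh_sub1_le ?(ltW r0)// !mulr_ge0 ?expR_ge0 ?(ltW t0).
rewrite exprMn (_ : expR (r / 2) ^+ 2 = expR r)%R; last first.
  by rewrite -expRM_natl; congr expR; field.
rewrite (_ : _ * _ = (expR r * ht x * r) ^+ 2)%R; last by field.
apply: lerXn2r; rewrite ?nnegrE ?mulr_ge0 ?expR_ge0 ?(ltW t0) ?(ltW r0)//.
by rewrite ler_wpM2r ?(ltW r0)// ler_wpM2r ?(ltW t0)// ler_expR.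
Qed.

(** Chosen so that [n] displacements of size cn r t have squared length n (cn r t)^2 = (cn / 2) (r
    t)^2, strictly below the (r t)^2 / 4 that a ball of radius [r] admits. *)
Let cn : R := ((2 * n%:R)^-1)%R.
Let cn0 : (0 < cn)%R. Proof. by rewrite invr_gt0 mulr_gt0. Qed.
Let cn4 : (cn <= 4^-1)%R.
Proof.
rewrite /cn lef_pV2 ?posrE ?mulr_gt0// (_ : 4 = 2 * 2)%R; last by ring.
by rewrite ler_pM2l// ler_nat.
Qed.
Let cnn : (n%:R * cn = 2^-1)%R.
Proof. by rewrite /cn; field; rewrite gt_eqF. Qed.

(** The box sits above [x], so that 2 t s >= 2 t^2, and cosh r - 1 >= r^2 / 8 then leaves room for
    all coordinates. *)
Lemma small_box_subset_hball (x y : H) r : (0 < r <= 1)%R ->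
  (forall i, `|hx y i - hx x i| <= cn * r * ht x)%R ->
  (ht x <= ht y <= ht x + cn * r * ht x)%R -> hball x r y.
Proof.
move=> /andP[r0 r1] xy /andP[h1 h2]; rewrite /hball/= hdist_lt//.
have t0 := ht_gt0 x; have s0 := ht_gt0 y.
have rho0 : (0 < cn * r * ht x)%R by rewrite !mulr_gt0.
apply: le_lt_trans (quad_le (ltW rho0) xy) _.
have hs : ((ht x - ht y) ^+ 2 <= (cn * r * ht x) ^+ 2)%R.
  rewrite -sqrrN opprB; apply: lerXn2r; rewrite ?nnegrE ?(ltW rho0)//; lra.
have L : (n.-1%:R * (cn * r * ht x) ^+ 2 + (ht x - ht y) ^+ 2 <= cn / 2 * (r * ht x) ^+ 2)%R.
  apply: (@le_trans _ _ ((n.-1%:R + 1) * (cn * r * ht x) ^+ 2))%R.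
    by rewrite mulrDl mul1r lerD2l.
  rewrite n1n; have -> : (n%:R * (cn * r * ht x) ^+ 2 = (n%:R * cn) * cn * (r * ht x) ^+ 2)%R by ring.
  by rewrite cnn; apply: eq_leW; ring.
have rt : (0 < (r * ht x) ^+ 2)%R by rewrite exprn_gt0// mulr_gt0.
apply: (le_lt_trans L); apply: (@lt_le_trans _ _ ((r * ht x) ^+ 2 / 4))%R.
  by rewrite mulrC ltr_pM2l//; have := cn4; lra.
apply: (@le_trans _ _ (2 * ht x * ht x * (r ^+ 2 / 8)))%R.
  by rewrite exprMn; lra.
have c8 := cosh_sub1_ge (ltW r0).
apply: ler_pM => //.
- by rewrite !mulr_ge0// ltW.
- by rewrite divr_ge0// sqr_ge0.
- by rewrite ler_wpM2l// mulr_ge0// ltW.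
Qed.

Let box_hxE (x y : H) rho l u : box (val x).1 rho l u y ->
  (forall i, `|hx y i - hx x i| <= rho)%R.
Proof. by move=> [+ _] i => /(_ i) /ltW. Qed.

Lemma hball_small_volume : exists c C : R, exists nu : nat, (0 < c)%R /\
  forall (x : H) r, (0 < r <= 1)%R ->
  (c * r ^+ nu)%:E <= hvol (hball x r) <= (C * r ^+ nu)%:E.
Proof.
exists ((cn / 2) ^+ n)%R, ((2 * expR 1 * expR 1) ^+ n)%R, n.
split; first by rewrite exprn_gt0// divr_gt0.
move=> x r r01; have /andP[r0 r1] := r01; have t0 := ht_gt0 x.
have e0 : (0 < expR 1 :> R)%R by exact: expR_gt0.
apply/andP; split.
  have rho0 : (0 < cn * r * ht x)%R by rewrite !mulr_gt0.
  have lu : (ht x < ht x + cn * r * ht x)%R by rewrite ltrDl.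
  have sub : box (val x).1 (cn * r * ht x) (ht x) (ht x + cn * r * ht x) `<=` hball x r.
    move=> y yb; apply: small_box_subset_hball => //; first exact: box_hxE yb.
    by case: yb => _ /andP[/ltW -> ->].
  have : hvol (box (val x).1 (cn * r * ht x) (ht x) (ht x + cn * r * ht x)) <= hvol (hball x r).
    by apply: le_measure; rewrite ?inE//; [exact: measurable_hyp_box|exact: measurable_hball].
  apply: le_trans; apply: (le_trans _ (@hvol_box_ge R n (val x).1 _ _ _ rho0 t0 lu)).
  rewrite lee_fin -exprMn addrC addKr.
  have u0 : (0 < ht x + cn * r * ht x)%R by exact: lt_trans lu.
  rewrite ler_pdivlMr ?exprn_gt0// -exprMn.
  apply: (@le_trans _ _ ((cn * r * ht x) ^+ n))%R.
    apply: lerXn2r; rewrite ?nnegrE ?(ltW rho0)//.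
      by rewrite mulr_ge0 ?(ltW u0)// mulr_ge0 ?divr_ge0 ?(ltW cn0) ?(ltW r0).
    have crle : (cn * r <= 1)%R.
      by apply: mulr_ile1; rewrite ?(ltW cn0) ?(ltW r0)//; have := cn4; lra.
    have : (ht x + cn * r * ht x <= 2 * ht x)%R.
      by rewrite (_ : 2 * ht x = ht x + ht x)%R ?lerD2l ?ler_piMl ?(ltW t0)//; ring.
    have c2r : (0 < cn / 2 * r)%R by rewrite mulr_gt0// divr_gt0.
    move=> h; apply: (@le_trans _ _ (cn / 2 * r * (2 * ht x)))%R; first by rewrite ler_pM2l.
    by apply: eq_leW; field.
  rewrite exprn_n ler_pM2r//; apply: lerXn2r.
  - by rewrite nnegrE ltW.
  - by rewrite nnegrE mulr_ge0// ltW.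
  - by rewrite ler_peMl ?(ltW rho0)// ler1n.
have sub := @hball_small_subset x r r01.
have rho0 : (0 < expR 1 * ht x * r)%R by rewrite !mulr_gt0.
have l0 : (0 < ht x * expR (- r))%R by rewrite mulr_gt0// expR_gt0.
have lu : (ht x * expR (- r) < ht x * expR r)%R by rewrite ltr_pM2l// ltr_expR; lra.
apply: (@le_trans _ _ (hvol (box (val x).1 (expR 1 * ht x * r) (ht x * expR (- r)) (ht x * expR r)))).
  by apply: le_measure; rewrite ?inE//; [exact: measurable_hball|exact: measurable_hyp_box].
apply: le_trans (@hvol_box_le R n (val x).1 _ _ _ rho0 l0 lu) _.
rewrite lee_fin -exprMn ler_pdivrMr ?exprn_gt0// -exprMn.
have key : (ht x * expR r - ht x * expR (- r) <= 2 * (expR 1 * ht x * r))%R.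
  have := expR_sub_le (ltW r0); have : (expR r <= expR 1 :> R)%R by rewrite ler_expR.
  move=> h1 h2; rewrite -mulrBr.
  apply: (@le_trans _ _ (ht x * (2 * r * expR r)))%R; first by rewrite ler_pM2l.
  apply: (@le_trans _ _ (ht x * (2 * r * expR 1)))%R.
    by rewrite ler_pM2l// ler_pM2l// mulr_gt0.
  by apply: eq_leW; ring.
apply: (@le_trans _ _ ((2 * (expR 1 * ht x * r)) ^+ n))%R.
  by rewrite exprn_n ler_pM2l// exprn_gt0// mulr_gt0.
apply: lerXn2r; rewrite ?nnegrE.
- by rewrite mulr_ge0// ltW.
- by rewrite !mulr_ge0 ?(ltW e0) ?(ltW r0) ?(ltW l0)// ?expR_ge0 ?(ltW t0).
have er : (1 <= expR 1 * expR (- r) :> R)%R by rewrite -expRD -[leLHS]expR0 ler_expR; lra.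
have a0 : (0 < 2 * (expR 1 * ht x * r))%R by rewrite mulr_gt0.
have -> : (2 * expR 1 * expR 1 * r * (ht x * expR (- r)) =
  2 * (expR 1 * ht x * r) * (expR 1 * expR (- r)))%R by ring.
by rewrite ler_pMr.
Qed.

Let E : R := expR 2^-1.
Let E2 : (E ^+ 2 = expR 1)%R.
Proof. by rewrite /E -expRM_natl; congr expR; field. Qed.

(** At height s the ball extends horizontally by at most the square root of 2 t s e^r. In the slab
    where s is of order t e^-r e^j this is of order t e^(j/2), whence the factor [E ^+ j]. *)
Lemma hball_large_subset (x : H) r : (0 < r)%R ->
  hball x r `<=` \bigcup_j box (val x).1 (2 * expR 1 * ht x * E ^+ j)
    (ht x * expR (- r) * expR 1 ^+ j) (ht x * expR (- r) * expR 1 ^+ j.+1).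
Proof.
move=> r0 y xy; have [h1 h2] := height_bounds r0 xy.
have t0 := ht_gt0 x; have s0 := ht_gt0 y.
have e0 : (0 < expR 1 :> R)%R by exact: expR_gt0.
have e1 : (1 < expR 1 :> R)%R by rewrite -expR0 ltr_expR.
have l0 : (0 < ht x * expR (- r))%R by rewrite mulr_gt0// expR_gt0.
have [j lj uj] := exists_level e1 l0 h1; exists j => //; split; last by rewrite lj uj.
have Ej : (0 < E ^+ j)%R by rewrite exprn_gt0// expR_gt0.
move=> i; apply: lt_norm; first by rewrite !mulr_ge0 ?(ltW e0) ?(ltW t0) ?(ltW Ej).
move: xy; rewrite /hball/= hdist_lt// => xy.
apply: (@le_lt_trans _ _ (hquad x y)).
  by apply: le_trans (coord_le x y i); rewrite lerDl sqr_ge0.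
apply: (lt_le_trans xy).
apply: (@le_trans _ _ (2 * ht x * ht y * expR r))%R.
  rewrite ler_pM2l; last by rewrite !mulr_gt0.
  by rewrite /cosh; have : (expR (- r) < expR r)%R by [rewrite ltr_expR; lra]; lra.
apply: (@le_trans _ _ (2 * ht x * (ht x * expR (- r) * expR 1 ^+ j.+1) * expR r))%R.
  by rewrite ler_pM2r ?expR_gt0// ler_pM2l// mulr_gt0.
have vv' : (expR (- r) * expR r = 1)%R by rewrite -expRD addNr expR0.
have -> : (2 * ht x * (ht x * expR (- r) * expR 1 ^+ j.+1) * expR r =
  2 * expR 1 * (ht x ^+ 2 * expR 1 ^+ j) * (expR (- r) * expR r))%R by rewrite exprS; ring.
have -> : ((2 * expR 1 * ht x * E ^+ j) ^+ 2 =
  (2 * expR 1) * (2 * expR 1) * (ht x ^+ 2 * expR 1 ^+ j))%R.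
  have -> : (expR 1 ^+ j = (E ^+ j) ^+ 2)%R by rewrite -[in LHS]E2 -!exprM mulnC.
  ring.
rewrite vv' mulr1 ler_pM2r ?mulr_gt0 ?exprn_gt0//.
by rewrite ler_pMr ?mulr_gt0//; lra.
Qed.

(** The volume of a large ball concentrates near its lowest height t e^-r, at which the ball shrinks
    to a point. At two to three times this height it already has a width of order t, and such a box
    has volume of order e^((n-1) r). *)
Lemma large_box_subset_hball (x : H) r : (1 <= r)%R ->
  box (val x).1 (ht x * cn) (2 * (ht x * expR (- r))) (3 * (ht x * expR (- r)))
  `<=` hball x r.
Proof.
move=> r1 y yb; have xy := box_hxE yb; case: yb => _ /andP[h1 h2].
have t0 := ht_gt0 x; have s0 := ht_gt0 y.
rewrite /hball/= hdist_lt; last by lra.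
have rho0 : (0 < ht x * cn)%R by rewrite mulr_gt0.
apply: le_lt_trans (quad_le (ltW rho0) xy) _.
have vv' : (expR r * expR (- r) = 1)%R by rewrite -expRD subrr expR0.
have v2 : (2 <= expR r)%R by have := expR_ge1Dx r; lra.
have v'0 : (0 < expR (- r))%R by exact: expR_gt0.
rewrite /cosh; move: vv' v2 v'0 h1 h2 t0 s0.
set v := expR r; set v' := expR (- r); set t := ht x; set s := ht y.
move=> vv' v2 v'0 h1 h2 t0 s0.
have v'2 : (v' <= 2^-1)%R by nra.
have L : (n.-1%:R * (t * cn) ^+ 2 <= t ^+ 2 / 8)%R.
  have -> : (t ^+ 2 / 8 = (n%:R * cn) * (4^-1 * t ^+ 2))%R by rewrite cnn; field.
  have -> : (n.-1%:R * (t * cn) ^+ 2 = n.-1%:R * cn * (cn * t ^+ 2))%R by ring.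
  have t2 : (0 < t ^+ 2)%R by rewrite exprn_gt0.
  apply: ler_pM.
  - by rewrite mulr_ge0// ltW.
  - by rewrite mulr_ge0// ltW.
  - by rewrite ler_pM2r// -n1n; lra.
  - by rewrite ler_pM2r.
pose y0 := (s / (t * v'))%R.
have sE : (s = t * v' * y0)%R by rewrite /y0; field; rewrite !gt_eqF.
have tv0 : (0 < t * v')%R by rewrite mulr_gt0.
have y2 : (2 < y0)%R by rewrite /y0 ltr_pdivlMr.
have y3 : (y0 <= 3)%R by rewrite /y0 ler_pdivrMr.
have -> : (2 * t * s * ((v + v') / 2 - 1) = t ^+ 2 * y0 * (v * v') + t ^+ 2 * y0 * v' ^+ 2 - 2 * t * s)%R.
  by rewrite sE; field.
rewrite vv' mulr1.
have -> : ((t - s) ^+ 2 = t ^+ 2 + t ^+ 2 * v' ^+ 2 * y0 ^+ 2 - 2 * t * s)%R.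
  by rewrite [in LHS]sE [in RHS]sE; ring.
have t2 : (0 < t ^+ 2)%R by rewrite exprn_gt0.
have v'4 : (v' ^+ 2 <= 4^-1)%R.
  have -> : (4^-1 = 2^-1 ^+ 2 :> R)%R by rewrite exprVn -natrX.
  by apply: lerXn2r; rewrite ?nnegrE// ltW.
have v'20 : (0 < v' ^+ 2)%R by rewrite exprn_gt0.
(* With [y0] the height of [y] in units of t e^-r, this is the condition on the distance divided by
   t^2, with 1/8 bounding the horizontal part [L]. *)
have main : (8^-1 < (y0 - 1) * (1 - v' ^+ 2 * y0))%R.
  have : (v' ^+ 2 * y0 <= 3 / 4)%R by nra.
  by move=> h; nra.
have : (t ^+ 2 * 8^-1 < t ^+ 2 * ((y0 - 1) * (1 - v' ^+ 2 * y0)))%R by rewrite ltr_pM2l.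
have -> : (t ^+ 2 * ((y0 - 1) * (1 - v' ^+ 2 * y0)) =
  t ^+ 2 * y0 + t ^+ 2 * y0 * v' ^+ 2 - t ^+ 2 - t ^+ 2 * v' ^+ 2 * y0 ^+ 2)%R by ring.
by lra.
Qed.

(** Slab [j] has half-width of order t e^(j/2) and height of order t e^(j-r), hence volume of order
    e^((n-1) r) e^(-(n-1) j/2). The series of ratio [th = e^(-(n-1)/2)] converges because n >= 2. *)
Lemma hball_large_volume : exists c C : R, (0 < c)%R /\
  forall (x : H) r, (1 <= r)%R ->
  (c * expR (n.-1%:R * r))%:E <= hvol (hball x r) <= (C * expR (n.-1%:R * r))%:E.
Proof.
pose m := n.-1.
have m0 : (0 < m)%N by rewrite /m -ltnS -nS.
have e0 : (0 < expR 1 :> R)%R by exact: expR_gt0.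
have e1 : (1 < expR 1 :> R)%R by rewrite -expR0 ltr_expR.
have E0 : (0 < E)%R by exact: expR_gt0.
have E1 : (1 < E)%R by rewrite /E -expR0 ltr_expR.
pose th := (E^-1 ^+ m)%R.
have th0 : (0 < th)%R by rewrite exprn_gt0// invr_gt0.
have th1 : (th < 1)%R by rewrite exprn_ilt1 ?invr_ge0 ?(ltW E0)// -?lt0n// invf_lt1.
exists (cn ^+ m / 3 ^+ n)%R, ((4 * expR 1) ^+ m * (expR 1 - 1) * (1 - th)^-1)%R.
split; first by rewrite divr_gt0 ?exprn_gt0.
move=> x r r1; have t0 := ht_gt0 x; have r0 : (0 < r)%R by lra.
have expm : (expR (m%:R * r) = expR r ^+ m)%R by rewrite expRM_natl.
rewrite -/m expm.
have v'0 : (0 < expR (- r))%R by exact: expR_gt0.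
have v0 : (0 < expR r)%R by exact: expR_gt0.
have vv' : (expR r * expR (- r) = 1)%R by rewrite -expRD subrr expR0.
have L0 : (0 < ht x * expR (- r))%R by rewrite mulr_gt0.
apply/andP; split.
  have rho0 : (0 < ht x * cn)%R by rewrite mulr_gt0.
  have l0 : (0 < 2 * (ht x * expR (- r)))%R by rewrite mulr_gt0.
  have lu : (2 * (ht x * expR (- r)) < 3 * (ht x * expR (- r)))%R by rewrite ltr_pM2r//; lra.
  have : hvol (box (val x).1 (ht x * cn) (2 * (ht x * expR (- r))) (3 * (ht x * expR (- r))))
      <= hvol (hball x r).
    apply: le_measure; rewrite ?inE.
    - exact: measurable_hyp_box.
    - exact: measurable_hball.
    - exact: large_box_subset_hball.
  apply: le_trans; apply: (le_trans _ (@hvol_box_ge R n (val x).1 _ _ _ rho0 l0 lu)).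
  rewrite lee_fin -/m.
  have -> : (3 * (ht x * expR (- r)) - 2 * (ht x * expR (- r)) = ht x * expR (- r))%R by ring.
  rewrite ler_pdivlMr; last by rewrite exprn_gt0// mulr_gt0.
  rewrite (exprMn _ 3%R) (exprn_n (ht x * expR (- r))) -/m.
  rewrite (_ : cn ^+ m / 3 ^+ n * expR r ^+ m * (3 ^+ n * ((ht x * expR (- r)) ^+ m * (ht x * expR (- r)))) =
    (cn * (expR r * (ht x * expR (- r)))) ^+ m * (ht x * expR (- r)) * (3 ^+ n / 3 ^+ n))%R; last first.
    by rewrite !exprMn; ring.
  rewrite mulfV ?expf_neq0// mulr1 ler_pM2r//; apply: lerXn2r; rewrite ?nnegrE.
  - by rewrite !mulr_ge0// ltW.
  - by rewrite !mulr_ge0// ltW.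
  - have -> : (expR r * (ht x * expR (- r)) = ht x)%R by rewrite mulrCA vv' mulr1.
    have : (0 < ht x * cn)%R by []. lra.
pose F j := box (val x).1 (2 * expR 1 * ht x * E ^+ j)
    (ht x * expR (- r) * expR 1 ^+ j) (ht x * expR (- r) * expR 1 ^+ j.+1).
have mF j : measurable (F j) by exact: measurable_hyp_box.
have sub : hball x r `<=` \bigcup_j F j by exact: hball_large_subset.
have := measure_sigma_subadditive (hvol : {measure set H -> \bar R}) mF (measurable_hball x r) sub.
move=> /le_trans; apply.
pose K := ((4 * expR 1) ^+ m * (expR 1 - 1) * expR r ^+ m)%R.
have K0 : (0 <= K)%R.
  by rewrite !mulr_ge0 ?exprn_ge0 ?mulr_ge0 ?(ltW e0) ?(ltW v0)// subr_ge0 ltW.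
apply: (@le_trans _ _ (\sum_(j <oo) (K%:E * (th ^+ j)%:E))).
  apply: lee_nneseries => [j _ _|j _]; first exact: measure_ge0.
  have ej : (0 < expR 1 ^+ j :> R)%R by exact: exprn_gt0.
  have Ej : (0 < E ^+ j)%R by exact: exprn_gt0.
  have rho0 : (0 < 2 * expR 1 * ht x * E ^+ j)%R by rewrite !mulr_gt0.
  have l0 : (0 < ht x * expR (- r) * expR 1 ^+ j)%R by rewrite mulr_gt0.
  have lu : (ht x * expR (- r) * expR 1 ^+ j < ht x * expR (- r) * expR 1 ^+ j.+1)%R.
    by rewrite ltr_pM2l// exprS ltr_pMl.
  apply: le_trans (@hvol_box_le R n (val x).1 _ _ _ rho0 l0 lu) _.
  rewrite -EFinM lee_fin -/m exprn_n -/m.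
  apply: eq_leW.
  have -> : (ht x * expR (- r) * expR 1 ^+ j.+1 - ht x * expR (- r) * expR 1 ^+ j =
    (expR 1 - 1) * (ht x * expR (- r) * expR 1 ^+ j))%R by rewrite exprS; ring.
  set l := (ht x * expR (- r) * expR 1 ^+ j)%R.
  have -> : ((2 * (2 * expR 1 * ht x * E ^+ j)) ^+ m * ((expR 1 - 1) * l) / (l ^+ m * l) =
    (2 * (2 * expR 1 * ht x * E ^+ j) / l) ^+ m * (expR 1 - 1))%R.
    by rewrite expr_div_n; field; rewrite !gt_eqF// exprn_gt0.
  have -> : (2 * (2 * expR 1 * ht x * E ^+ j) / l = 4 * expR 1 * expR r * E^-1 ^+ j)%R.
    rewrite /l -E2 -exprM mulnC exprM.
    have -> : (expR r = (expR (- r))^-1)%R by rewrite expRN invrK.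
    rewrite exprVn; field.
    by rewrite !gt_eqF.
  have -> : (th ^+ j = (E^-1 ^+ j) ^+ m)%R by rewrite /th -!exprM mulnC.
  rewrite /K; move: (E^-1 ^+ j)%R => z.
  by rewrite !exprMn; ring.
rewrite nneseriesZl; last by move=> j _; rewrite lee_fin exprn_ge0// ltW.
apply: le_trans (lee_wpmul2l _ (nneseries_geometric_le (ltW th0) th1)) _; first by rewrite lee_fin.
by rewrite -EFinM lee_fin /K; apply: eq_leW; ring.
Qed.

End ball_volume.

(** * Consequences of the testing condition *)

Lemma weighted_markov d (T : measurableType d) (R : realType)
    (mu : {measure set T -> \bar R}) (X w : T -> \bar R) (p l : R) :
  measurable_fun setT X -> (forall x, 0 <= X x) ->
  measurable_fun setT w -> (forall x, 0 <= w x) ->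
  (0 < p)%R -> (0 < l)%R ->
  (l `^ p)%:E * \int[mu]_(x in [set x | l%:E < X x]) w x <=
  \int[mu]_x (X x `^ p * w x).
Proof.
move=> mX X0 mw w0 p0 l0.
have mA : measurable [set x | l%:E < X x] by exact: measurable_lte_set.
have lp0 : 0 <= (l `^ p)%:E by rewrite lee_fin powR_ge0.
rewrite -ge0_integralZl//; last exact: measurable_funTS.
apply: (@le_trans _ _ (\int[mu]_(x in [set x | l%:E < X x]) (X x `^ p * w x))).
  apply: ge0_le_integralW => x /= lX; first exact: mule_ge0.
  apply: lee_wpmul2r => //; rewrite -poweR_EFin; apply: lee_poweR; rewrite ?(ltW p0) ?(ltW lX)//.
  by rewrite lee_fin ltW.
apply: ge0_subset_integralW => // x _.
by rewrite mule_ge0 ?poweR_ge0.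
Qed.

Section testing_condition.
Context d (T : measurableType d) (R : realType).
Variables (mu : {sigma_finite_measure set T -> \bar R}) (dist : T -> T -> R).
Variables (kappa : R) (GS : growth_space mu dist kappa).
Local Notation ball := (dball dist).
Local Notation ball_int := (ball_int mu dist).
Variables (p beta a C1 : R) (w : T -> R).
Hypotheses (p1 : (1 < p)%R) (mw : measurable_fun setT w).
Hypotheses (beta1 : (beta < 1)%R) (a0 : (0 < a)%R) (C10 : (0 < C1)%R).
Hypothesis testing : forall r, (1 <= r)%R -> forall E F, measurable E -> measurable F ->
  \int[mu]_(y in F) (ball_int r (EFin \o \1_E) y * (w y)%:E) <=
  (C1 * expR (kappa * r * beta))%:E *
  ((\int[mu]_(y in E) (w y)%:E) `^ a * (\int[mu]_(y in F) (w y)%:E) `^ (1 - a)).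

(* The testing condition spreads a zero set of the weight to the whole space. *)
Lemma testing_vanishing : (forall x, (0 <= w x)%R) ->
  mu [set x | w x = 0%R] != 0 -> \int[mu]_x (w x)%:E = 0.
Proof.
move=> w0; set Z := [set x | w x = 0%R] => muZ.
have mwE : measurable_fun setT (fun x => (w x)%:E) by exact/measurable_EFinP.
have mZ : measurable Z.
  rewrite -[Z]setTI (_ : Z = w @^-1` [set 0%R])//; exact: mw.
have wZ : \int[mu]_(y in Z) (w y)%:E = 0.
  by apply: integral0_eq => x ->.
have h0 r x : 0 <= ball_int r (EFin \o \1_Z) x.
  by apply: ball_int_ge0 => y; rewrite /= lee_fin.
have mh r : measurable_fun setT (ball_int r (EFin \o \1_Z)).
  apply: (measurable_ball_int GS) => [|y]; last by rewrite /= lee_fin.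
  by apply/measurable_EFinP; exact: measurable_indic.
(* Testing with E = Z and F the whole space: the factor w(Z)^a is 0, and it annihilates the other
   one even if the total mass is infinite. *)
have hw r : (1 <= r)%R -> \int[mu]_y (ball_int r (EFin \o \1_Z) y * (w y)%:E) = 0.
  move=> r1; apply/eqP; rewrite eq_le; apply/andP; split; last first.
    by apply: integral_ge0 => y _; rewrite mule_ge0// lee_fin.
  apply: (le_trans (testing r1 mZ measurableT)).
  by rewrite wZ poweR0r ?gt_eqF// mul0e mule0.
have hE r x : ball_int r (EFin \o \1_Z) x = mu (Z `&` ball x r).
  rewrite /ball_int integral_indic//; exact: (measurable_dball GS).
pose B (k : nat) := ball point k%:R.
have mB k : measurable (B k) by exact: (measurable_dball GS).
have ndB : nondecreasing_seq B.
  move=> i j ij; rewrite subsetEset; apply: dball_subr.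
  by rewrite ler_nat.
have UB : \bigcup_k B k = setT.
  rewrite -subTset => x _; exists (Num.truncn `|dist point x|%R).+1 => //.
  by rewrite /B /dball/=; apply: le_lt_trans (ler_norm _) _; exact: truncnS_gt.
have [N ZN] : exists N, 0 < mu (Z `&` B N).
  apply: contrapT => /forallNP H; move/eqP: muZ; apply.
  have ZB : Z `<=` \bigcup_k (Z `&` B k) by rewrite -setI_bigcupr UB setIT.
  have mZB k : measurable (Z `&` B k) by exact: measurableI.
  apply/eqP; rewrite eq_le measure_ge0 andbT.
  apply: le_trans (measure_sigma_subadditive mu mZB mZ ZB) _.
  rewrite eseries0// => k _ _; apply/eqP; rewrite eq_le measure_ge0 andbT leNgt.
  by apply/negP; exact: H.
have BT := ge0_nondecreasing_set_cvg_integral (mu := mu) ndB mB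
  (fun i => measurable_funTS (D := B i) mwE) (fun i x _ => (w0 x : 0 <= (w x)%:E)).
rewrite UB in BT; rewrite -(cvg_lim _ BT)// (_ : (fun k => _) = cst 0) ?lim_cst//.
apply/funext => k /=.
(* Large enough for the ball of radius [r] about any point of [B k] to contain [B N]. The average of
   the indicator of [Z] is then positive on [B k], so [w] must vanish almost everywhere there. *)
pose r : R := (N%:R + k%:R + 1)%R.
have r1 : (1 <= r)%R by rewrite /r lerDr.
have ae := hw r r1.
have pos y : B k y -> 0 < ball_int r (EFin \o \1_Z) y.
  move=> By; rewrite hE; apply: (lt_le_trans ZN); apply: le_measure; rewrite ?inE.
  - exact: measurableI.
  - by apply: measurableI => //; exact: (measurable_dball GS).
  - apply: setIS; apply: (dball_sub GS).
    by move: By; rewrite /B /dball/= (dist_sym GS) /r; lra.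
have mhw : measurable_fun setT (fun y => ball_int r (EFin \o \1_Z) y * (w y)%:E).
  exact: emeasurable_funM.
have [H _] := ae_eq_integral_abs mu measurableT mhw.
have /H aeq : \int[mu]_x `|ball_int r (EFin \o \1_Z) x * (w x)%:E| = 0.
  by rewrite -[RHS]ae; apply: eq_integral => x _; rewrite gee0_abs// mule_ge0// lee_fin.
rewrite (ge0_ae_eq_integral (g := cst 0)) ?integral0//.
- exact: measurable_funTS.
- by move=> x _; rewrite lee_fin.
apply: filterS aeq => x /(_ Logic.I) hw0 Bx.
move/eqP : hw0; rewrite mule_eq0 => /orP[/eqP h0x|/eqP //].
by have := pos x Bx; rewrite h0x ltxx.
Qed.

Variable A : R.
Hypotheses (w0 : forall x, (0 < w x)%R) (A0 : (0 < A)%R).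
Hypothesis Ap : forall x r, (0 < r <= 1)%R ->
  \int[mu]_(y in ball x r) (w y)%:E *
  (\int[mu]_(y in ball x r) (dual_weight p w y)%:E) `^ (p - 1)
  <= A%:E * mu (ball x r) `^ p.
Variables (b : R) (bdef : b = expR kappa).

Let b0 : (0 < b)%R. Proof. by rewrite bdef expR_gt0. Qed.
Let w0' x : (0 <= w x)%R. Proof. exact: ltW. Qed.
Let p0 : (0 < p)%R. Proof. exact: lt_trans p1. Qed.
Let p10 : (0 < p - 1)%R. Proof. by rewrite subr_gt0. Qed.
Let mwE : measurable_fun setT (fun x => (w x)%:E). Proof. exact/measurable_EFinP. Qed.
Let wE0 x : 0 <= (w x)%:E. Proof. by rewrite lee_fin. Qed.

Let half0 : (0 < 2^-1 :> R)%R. Proof. by rewrite invr_gt0. Qed.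

Lemma testing_weak_type : (beta / a <= p)%R -> exists2 C : R, (0 < C)%R &
  forall f : T -> R, measurable_fun setT f -> (forall x, (0 <= f x)%R) ->
  forall l, (0 < l)%R ->
  (l `^ p)%:E * \int[mu]_(x in [set x | l%:E < centered_maximal mu dist (EFin \o f) x])
    (w x)%:E <= C%:E * \int[mu]_x ((f x)%:E `^ p * (w x)%:E).
Proof.
move=> bap.
have [B [C [B0 C0 HF]]] := far_weak_type GS p1 mw w0' beta1 a0 C10 testing bdef
  (erefl _) (erefl _) (erefl _) (erefl _) bap.
have [K K0 HK] := local_average_bound GS p1 mw w0 A0 Ap half0 (lexx _).
have [M [L [L0 HM]]] := local_maximal_bound GS p1 mw w0 A0 Ap.
have [D D0 HD] := centered_maximal_le GS bdef.
have DB0 : (0 < (D * B) `^ p)%R by rewrite powR_gt0// mulr_gt0.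
exists (L + (D * B) `^ p * (C * K))%R; first by rewrite addr_gt0// !mulr_gt0.
move=> f mf f0 l l0.
have mfE : measurable_fun setT (EFin \o f) by exact/measurable_EFinP.
have f0E x : 0 <= (EFin \o f) x by rewrite /= lee_fin.
have [mM M0 Mr HMf] := HM _ mfE f0E.
pose l' := (l / (D * B))%R.
have l'0 : (0 < l')%R by rewrite divr_gt0// mulr_gt0.
pose U1 := [set x | l%:E < M (EFin \o f) x].
pose U2 := \bigcup_j [set x | (B * l' * b ^+ j)%:E < ball_int j%:R (EFin \o f) x].
have mU1 : measurable U1 by exact: measurable_lte_set.
have mU2 : measurable U2.
  apply: bigcup_measurable => j _; apply: measurable_lte_set.
  exact: (measurable_ball_int GS).
have sub : [set x | l%:E < centered_maximal mu dist (EFin \o f) x] `<=` U1 `|` U2.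
  move=> x /= lx.
  have := lt_le_trans lx (HD (EFin \o f) (M (EFin \o f)) x f0E (Mr x)).
  rewrite lt_max => /orP[|]; first by left.
  rewrite -lte_pdivrMl// -EFinM => /ereal_sup_gt [_ [j _ <-]] lj; right; exists j => //=.
  move: lj; rewrite /discrete_mean -lte_pdivrMl ?invr_gt0 ?exprn_gt0// invrK -EFinM.
  rewrite (_ : b ^+ j * (D^-1 * l) = B * l' * b ^+ j)%R//.
  by rewrite /l'; field; rewrite !gt_eqF.
have lp0 : 0 <= (l `^ p)%:E by rewrite lee_fin powR_ge0.
apply: le_trans (lee_wpmul2l lp0 (ge0_subset_integralW mu (fun x _ => wE0 x) sub)) _.
apply: le_trans (lee_wpmul2l lp0 (ge0_integral_setU_le mu mwE wE0 mU1 mU2)) _.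
rewrite ge0_muleDr ?integral_ge0//.
have Y0 : 0 <= \int[mu]_x ((f x)%:E `^ p * (w x)%:E).
  by apply: integral_ge0 => x _; rewrite mule_ge0 ?poweR_ge0.
set Y := \int[mu]_x _ in Y0 HMf *.
have DCK : (0 <= (D * B) `^ p * (C * K))%R.
  by rewrite mulr_ge0 ?(ltW DB0)// mulr_ge0 ?(ltW C0) ?(ltW K0).
rewrite EFinD ge0_muleDl ?lee_fin ?(ltW L0)//.
apply: leeD.
  apply: le_trans HMf; exact: weighted_markov.
have -> : (l `^ p = (D * B) `^ p * l' `^ p)%R.
  rewrite -powRM ?(ltW l'0) ?mulr_ge0 ?(ltW D0) ?(ltW B0)//; congr (_ `^ _)%R.
  by rewrite /l'; field; rewrite !gt_eqF.
rewrite 2!EFinM -!muleA; apply: lee_wpmul2l; first by rewrite lee_fin ltW.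
apply: le_trans (HF _ mfE f0E _ l'0) _.
rewrite EFinM -muleA; apply: lee_wpmul2l; first by rewrite lee_fin ltW.
exact: HK.
Qed.

Hypothesis bap : (beta / a < p)%R.

Lemma discrete_mean_decay : exists C rho : R, [/\ (0 < C)%R, (0 < rho < 1)%R &
  forall f : T -> R, measurable_fun setT f -> (forall x, (0 <= f x)%R) -> forall j,
  \int[mu]_x (discrete_mean mu dist b j (EFin \o f) x `^ p * (w x)%:E) <=
  (C * rho ^+ j)%:E * \int[mu]_x ((f x)%:E `^ p * (w x)%:E)].
Proof.
have [C [rho [C0 rho0 rho1 HF]]] := far_strong_type GS p1 mw w0' beta1 a0 C10 testing bdef
  (erefl _) (erefl _) (erefl _) (erefl _) bap.
have [K K0 HK] := local_average_bound GS p1 mw w0 A0 Ap half0 (lexx _).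
have rho01 : (0 < rho < 1)%R by rewrite rho0.
(* The exponent 1 serves to absorb the factor [j.+1], at the price of the square root of the
   rate. *)
have [L L0 HL] := polynomial_geometric_le (ler01 : (0 <= 1 :> R)%R) rho01.
exists (C * L * K)%R, (rho `^ 2^-1)%R; split.
- by rewrite !mulr_gt0.
- by rewrite powR_gt0//= powR_lt1.
move=> f mf f0 j.
have mfE : measurable_fun setT (EFin \o f) by exact/measurable_EFinP.
have f0E x : 0 <= (EFin \o f) x by rewrite /= lee_fin.
apply: le_trans (HF _ mfE f0E j) _.
have Cj : (0 <= C * (j.+1%:R * rho ^+ j))%R.
  by rewrite mulr_ge0 ?(ltW C0)// mulr_ge0// exprn_ge0// ltW.
apply: le_trans (lee_wpmul2l _ (HK f mf f0)) _; first by rewrite lee_fin.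
rewrite muleA -EFinM; apply: lee_wpmul2r.
  by apply: integral_ge0 => x _; rewrite mule_ge0 ?poweR_ge0.
rewrite lee_fin (_ : C * L * K * _ = C * (L * (rho `^ 2^-1) ^+ j) * K)%R; last by ring.
rewrite ler_pM2r// ler_pM2l//; have := HL j.
by rewrite powRr1.
Qed.

Let q := (p / (p - 1))%R.
Let s := dual_weight p w.
Let q1 : (1 < q)%R. Proof. exact: conj_expo1. Qed.
Let q0 : (0 < q)%R. Proof. exact: lt_trans q1. Qed.

(** Duality raises the constant to the power 1 / (p - 1), which keeps it geometric in [j]. The
    normalization survives: (b^j)^p becomes (b^j)^q. *)
Lemma dual_discrete_mean_decay : exists C rho : R, [/\ (0 < C)%R, (0 < rho < 1)%R &
  forall f : T -> R, measurable_fun setT f -> (forall x, (0 <= f x)%R) -> forall j,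
  \int[mu]_x (discrete_mean mu dist b j (EFin \o f) x `^ q * (s x)%:E) <=
  (C * rho ^+ j)%:E * \int[mu]_x ((f x)%:E `^ q * (s x)%:E)].
Proof.
have [C [rho [C0 /andP[rho0 rho1] H]]] := discrete_mean_decay.
pose e := ((p - 1)^-1)%R.
have e0 : (0 < e)%R by rewrite invr_gt0.
exists (C `^ e)%R, (rho `^ e)%R; split.
- exact: powR_gt0.
- by rewrite powR_gt0//= powR_lt1.
move=> f mf f0 j.
have bj0 : (0 < b ^+ j)%R by exact: exprn_gt0.
pose N := ((b ^+ j) `^ p * (C * rho ^+ j))%R.
have N0 : (0 < N)%R by rewrite !mulr_gt0 ?powR_gt0 ?exprn_gt0.
have bound (g : T -> R) : measurable_fun setT g -> (forall x, (0 <= g x)%R) ->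
    \int[mu]_x (ball_int j%:R (EFin \o g) x `^ p * (w x)%:E) <=
    N%:E * \int[mu]_x ((g x)%:E `^ p * (w x)%:E).
  move=> mg g0; have g0E x : 0 <= (EFin \o g) x by rewrite /= lee_fin.
  have mgE : measurable_fun setT (EFin \o g) by exact/measurable_EFinP.
  have dm0 x : 0 <= discrete_mean mu dist b j (EFin \o g) x by exact: (discrete_mean_ge0 mu dist bdef).
  have -> : \int[mu]_x (ball_int j%:R (EFin \o g) x `^ p * (w x)%:E) =
      ((b ^+ j) `^ p)%:E * \int[mu]_x (discrete_mean mu dist b j (EFin \o g) x `^ p * (w x)%:E).
    have md := measurable_discrete_mean GS b j mgE g0E.
    rewrite -(integral_poweR_scale _ _ (ltW bj0) md dm0 mw w0').
    apply: eq_integral => x _; by rewrite /discrete_mean muleA -EFinM mulfV ?gt_eqF// mul1e.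
  rewrite /N EFinM -muleA; apply: lee_wpmul2l; first by rewrite lee_fin powR_ge0.
  exact: H.
have := dual_bound GS p1 mw w0 N0 bound (erefl q) (erefl s) mf f0.
have f0E x : 0 <= (EFin \o f) x by rewrite /= lee_fin.
have mfE : measurable_fun setT (EFin \o f) by exact/measurable_EFinP.
have T0 x : 0 <= ball_int j%:R (EFin \o f) x by exact: ball_int_ge0.
have s0 x : (0 < s x)%R by exact: dual_weight_gt0.
have -> : \int[mu]_x (discrete_mean mu dist b j (EFin \o f) x `^ q * (s x)%:E) =
    (((b ^+ j) `^ q)^-1)%:E * \int[mu]_x (ball_int j%:R (EFin \o f) x `^ q * (s x)%:E).
  have bjV : (0 <= (b ^+ j)^-1)%R by rewrite invr_ge0 ltW.
  have mT : measurable_fun setT (ball_int j%:R (EFin \o f)) by exact: (measurable_ball_int GS).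
  have ms := measurable_dual_weight p mw.
  by rewrite (integral_poweR_scale _ _ bjV mT T0 ms (fun x => ltW (s0 x))) invr_powR// ltW.
have bq0 : (0 < (b ^+ j) `^ q)%R by exact: powR_gt0.
move=> HB; rewrite lee_pdivrMl//; apply: (le_trans HB).
rewrite muleA -EFinM; apply: lee_wpmul2r.
  by apply: integral_ge0 => x _; rewrite mule_ge0 ?poweR_ge0// lee_fin ltW.
rewrite lee_fin /N -/e powRM ?powR_ge0 ?mulr_ge0 ?exprn_ge0 ?(ltW C0) ?(ltW rho0)//.
rewrite -powRrM -/q ler_pM2l// powRM ?exprn_ge0 ?(ltW C0) ?(ltW rho0)//.
by rewrite expn_powR// ltW.
Qed.

Let dual_Ap x r : (0 < r <= 1)%R ->
  \int[mu]_(y in ball x r) (s y)%:E *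
  (\int[mu]_(y in ball x r) (dual_weight q s y)%:E) `^ (q - 1)
  <= (A `^ (p - 1)^-1)%:E * mu (ball x r) `^ q.
Proof.
move=> r01; rewrite /s dual_dual_weight//.
apply: (dual_muckenhoupt p1 (ltW A0) _ _ (Ap x r01)); first exact: integral_ge0.
by apply: integral_ge0 => y _; rewrite lee_fin ltW// dual_weight_gt0.
Qed.

Lemma testing_strong_type : exists2 K : R, (0 < K)%R &
  forall f : T -> R, measurable_fun setT f -> (forall x, (0 <= f x)%R) ->
  exists U : T -> \bar R, [/\ measurable_fun setT U,
    forall x, 0 <= centered_maximal mu dist (EFin \o f) x <= U x &
    \int[mu]_x (U x `^ p * (w x)%:E) <=
    K%:E * \int[mu]_x ((f x)%:E `^ p * (w x)%:E)].
Proof.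
have [C [rho [C0 rho01 H]]] := discrete_mean_decay.
exact: (centered_maximal_strong_type GS bdef p1 mw w0 A0 Ap C0 rho01 H).
Qed.

Lemma testing_dual_strong_type : exists2 K : R, (0 < K)%R &
  forall f : T -> R, measurable_fun setT f -> (forall x, (0 <= f x)%R) ->
  exists U : T -> \bar R, [/\ measurable_fun setT U,
    forall x, 0 <= centered_maximal mu dist (EFin \o f) x <= U x &
    \int[mu]_x (U x `^ q * (s x)%:E) <=
    K%:E * \int[mu]_x ((f x)%:E `^ q * (s x)%:E)].
Proof.
have [C [rho [C0 rho01 H]]] := dual_discrete_mean_decay.
have ms : measurable_fun setT s by exact: measurable_dual_weight.
have s0 x : (0 < s x)%R by exact: dual_weight_gt0.
have A'0 : (0 < A `^ (p - 1)^-1)%R by exact: powR_gt0.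
exact: (centered_maximal_strong_type GS bdef q1 ms s0 A'0 dual_Ap C0 rho01 H).
Qed.

End testing_condition.

(** * Weights on hyperbolic space *)

Section hyperbolic_growth_space.
Context (R : realType) (n : nat).
Local Notation H := (hyp R n).

Lemma hdist_separable : (2 <= n)%N -> exists c : nat -> H,
  forall (x : H) e, (0 < e)%R -> exists i, (hdist x (c i) < e)%R.
Proof.
move=> n2.
(* Rational tuples of nonpositive height are sent to the base point; the approximations chosen below
   have positive height. *)
pose pt (z : n.-1.-tuple rat * rat) : H :=
  insubd (hyp_base R n) ([tuple of map ratr z.1], ratr z.2).
pose c k := if unpickle k is Some z then pt z else hyp_base R n.
exists c => x e e0.
pose r := Num.min e 1%R.
have r01 : (0 < r <= 1)%R by rewrite lt_min e0 ltr01 ge_min lexx orbT.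
have re : (r <= e)%R by rewrite ge_min lexx.
have t0 := ht_gt0 x.
have n0 : (0 < n%:R :> R)%R by rewrite ltr0n (leq_trans _ n2).
pose rho := ((2 * n%:R)^-1 * r * ht x)%R.
have rho0 : (0 < rho)%R.
  by rewrite mulr_gt0// mulr_gt0 ?invr_gt0 ?mulr_gt0//; case/andP: r01.
(* Approximation from above keeps the height at least that of [x], as [small_box_subset_hball]
   requires. *)
have near (z : R) : exists g : rat, (z < ratr g < z + rho)%R.
  have /rat_in_itvoo[g] : (z < z + rho)%R by rewrite ltrDl.
  by rewrite in_itv/=; exists g.
pose g (z : R) := sval (cid (near z)).
have gP z : (z < ratr (g z) < z + rho)%R by rewrite /g; case: cid.
pose q := ([tuple g (hx x i) | i < n.-1], g (ht x)).
exists (pickle q).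
have ptE : val (pt q) = ([tuple of map ratr q.1], ratr q.2).
  rewrite /pt insubdK//; rewrite unfold_in/=.
  by have /andP[+ _] := gP (ht x); exact: lt_trans.
apply: lt_le_trans re; rewrite /c pickleK.
apply: (small_box_subset_hball n2 r01) => [i|].
  rewrite /hx ptE/= tnth_map tnth_mktuple -/(hx x i) -/rho.
  have /andP[h1 h2] := gP (hx x i).
  by rewrite ger0_norm ?subr_ge0 ?(ltW h1)//; lra.
have /andP[h1 h2] := gP (ht x).
by rewrite {2 3}/ht ptE/= -/rho ltW//= ltW.
Qed.

Lemma hvol_sigma_finite : (2 <= n)%N -> sigma_finite setT (@hvol R n).
Proof.
move=> n2; have [c [C [c0 HV]]] := hball_large_volume R n2.
exists (fun k => hball (hyp_base R n) (k%:R + 1)%R).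
  apply/esym; rewrite -subTset => x _; exists (Num.truncn (hdist (hyp_base R n) x)).+1 => //.
  rewrite /hball/=; apply: lt_trans (truncnS_gt _) _; rewrite ltrDl//.
move=> k; split.
  exact: measurable_hball.
have k1 : (1 <= k%:R + 1 :> R)%R by rewrite lerDr.
have /andP[_ H1] := HV (hyp_base R n) _ k1.
exact: le_lt_trans H1 (ltry _).
Qed.

(* The unused argument lets instance inference find a proof of
   sigma-finiteness. *)
Definition hvol_sf (n2 : (2 <= n)%N) : set H -> \bar R := @hvol R n.

Section instance.
Variable n2 : (2 <= n)%N.

HB.instance Definition _ := Measure.copy (hvol_sf n2) (@hvol R n).

HB.instance Definition _ := Measure_isSigmaFinite.Build _ _ _
  (hvol_sf n2) (hvol_sigma_finite n2).

Lemma hyp_growth_space : growth_space (hvol_sf n2) (@hdist R n) (n.-1%:R : R).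
Proof.
split.
- exact: hdistxx.
- exact: hdistC.
- exact: hdist_triangle.
- exact: measurable_hdist_lt.
- exact: hdist_separable.
- by rewrite ltr0n -ltnS prednK// (leq_trans _ n2).
- exact: hball_small_volume.
- exact: hball_large_volume.
Qed.

End instance.
End hyperbolic_growth_space.

Lemma lee_poweRV_scale (R : realType) (K p : R) (X Y : \bar R) :
  (0 < K)%R -> (0 < p)%R -> 0 <= X -> 0 <= Y -> X <= K%:E * Y ->
  X `^ p^-1 <= (K `^ p^-1)%:E * Y `^ p^-1.
Proof.
move=> K0 p0 X0 Y0 XY; have KE : 0 <= K%:E by rewrite lee_fin ltW.
rewrite -poweR_EFin -(poweRM _ KE Y0); apply: lee_poweR => //.
by rewrite invr_ge0 ltW.
Qed.

Lemma ge0_integral_off_null d (T : measurableType d) (R : realType)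
    (mu : {measure set T -> \bar R}) (D N : set T) (f g : T -> \bar R) :
  measurable D -> measurable N -> mu N = 0 ->
  measurable_fun D f -> measurable_fun D g ->
  (forall x, 0 <= f x) -> (forall x, 0 <= g x) ->
  (forall x, ~ N x -> f x = g x) ->
  \int[mu]_(x in D) f x = \int[mu]_(x in D) g x.
Proof.
move=> mD mN N0 mf mg f0 g0 fg; apply: ge0_ae_eq_integral => //.
exists N; split=> // x /= nfg; apply: contrapT => /fg E.
by apply: nfg => _.
Qed.

(* Agrees with [w] almost everywhere unless [w] vanishes on a set of positive
   measure, and has no infinite negative powers. *)
Definition positive_weight (T : Type) (R : realType) (w : T -> R) (x : T) : R :=
  if w x == 0%R then 1%R else w x.

Section hyperbolic_weights.
Context (R : realType) (n : nat).
Hypothesis n2 : (2 <= n)%N.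
Local Notation H := (hyp R n).
Local Notation mu := (hvol_sf n2).
Let GS := @hyp_growth_space R n n2.
Variables (p : R) (w : H -> R).
Hypotheses (p1 : (1 < p)%R) (mw : measurable_fun setT w).
Hypothesis w0 : forall x, (0 <= w x)%R.

Let p0 : (0 < p)%R. Proof. exact: lt_trans p1. Qed.
Let p10 : (0 < p - 1)%R. Proof. by rewrite subr_gt0. Qed.
Let q := (p / (p - 1))%R.
Let q1 : (1 < q)%R. Proof. exact: conj_expo1. Qed.
Let q0 : (0 < q)%R. Proof. exact: lt_trans q1. Qed.
Let qE : (1 - q = - (p - 1)^-1)%R.
Proof. by rewrite -conj_expo_sub1// opprB. Qed.
Let mwE : measurable_fun setT (EFin \o w). Proof. exact/measurable_EFinP. Qed.
Let wE0 x : 0 <= (EFin \o w) x. Proof. by rewrite /= lee_fin. Qed.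

Let Z := [set x | w x = 0%R].
Let mZ : measurable Z.
Proof. by rewrite -[Z]setTI (_ : Z = w @^-1` [set 0%R])//; exact: mw. Qed.

Let sigma := wpow w (1 - q).
Let sigma_ge0 x : 0 <= sigma x.
Proof. by rewrite /sigma /wpow; case: ifP => // _; rewrite lee_fin powR_ge0. Qed.
Let msigma : measurable_fun setT sigma.
Proof.
rewrite /sigma /wpow; apply: measurable_fun_ifT => //.
  apply: measurable_and => //.
  apply: (measurable_fun_bool true); rewrite setTI.
  rewrite (_ : _ @^-1` _ = Z); first exact: mZ.
  by apply/seteqP; split => x /=; [move/eqP|move=> ->; rewrite eqxx].
by apply/measurable_EFinP; exact: (measurableT_comp (measurable_powR _)).
Qed.

Lemma hmaximalE (f : H -> R) :
  hmaximal f = centered_maximal mu (@hdist R n) (EFin \o (Num.norm \o f)).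
Proof. by []. Qed.

Lemma hmaximal_ge0 (f : H -> R) x : 0 <= hmaximal f x.
Proof.
apply: (@le_trans _ _ (havg 1 f x)).
  by rewrite mule_ge0 ?inve_ge0// integral_ge0.
by apply: ereal_sup_ubound; exists 1%R => //=; exact: ltr01.
Qed.

(** [g] need not be measurable: the integrand is at most [+oo * w x], whose integral is
    [+oo * 0 = 0]. *)
Lemma wLnorm_null (g : H -> \bar R) : \int[hvol]_x (w x)%:E = 0 ->
  wLnorm (EFin \o w) p g = 0.
Proof.
move=> wn; rewrite /wLnorm (_ : \int[hvol]_x _ = 0) ?poweR0r ?invr_neq0 ?gt_eqF//.
apply/eqP; rewrite eq_le; apply/andP; split; last first.
  by apply: integral_ge0 => x _; rewrite mule_ge0 ?poweR_ge0.
apply: (@le_trans _ _ (\int[hvol]_x (+oo * (w x)%:E))).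
  apply: ge0_le_integralW => x _; first by rewrite mule_ge0 ?poweR_ge0.
  by apply: lee_wpmul2r => //; exact: leey.
rewrite ge0_integralZl//; last by move=> x _; exact: wE0.
by rewrite wn mule0.
Qed.

Lemma wweakLnorm_null (g : H -> \bar R) : \int[hvol]_x (w x)%:E = 0 ->
  wweakLnorm (EFin \o w) p g <= 0.
Proof.
move=> wn; apply: ge_ereal_sup => _ [l /= l0 <-].
rewrite (_ : wvol _ _ = 0) ?poweR0r ?invr_neq0 ?gt_eqF// ?mule0//.
apply/eqP; rewrite eq_le; apply/andP; split; last exact: integral_ge0.
by rewrite -wn; apply: ge0_subset_integralW.
Qed.

(** Here [sigma] is infinite almost everywhere. Either [f] has integral zero, and then its maximal
    function vanishes identically, or the right side is infinite. *)
Lemma wLnorm_dual_null (f : H -> R) : measurable_fun setT f ->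
  \int[hvol]_x (w x)%:E = 0 ->
  wLnorm sigma q (hmaximal f) <= wLnorm sigma q (EFin \o f).
Proof.
move=> mf wn.
have mfE : measurable_fun setT (fun x => `|(f x)%:E|).
  by apply: measurableT_comp => //; exact/measurable_EFinP.
have mfq : measurable_fun setT (fun x => `|(f x)%:E| `^ q).
  exact: measurableT_comp (measurable_poweR _) mfE.
have [f0|fn0] := eqVneq (\int[hvol]_x `|(f x)%:E|) 0.
  have hm0 x : hmaximal f x = 0.
    apply/eqP; rewrite eq_le hmaximal_ge0 andbT; apply: ge_ereal_sup => _ [r _ <-].
    rewrite /havg (_ : \int[hvol]_(y in hball x r) _ = 0) ?mule0//.
    apply/eqP; rewrite eq_le; apply/andP; split; last exact: integral_ge0.
    by rewrite -f0; apply: ge0_subset_integralW.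
  rewrite {1}/wLnorm (_ : \int[hvol]_x _ = 0); first by rewrite poweR0r ?poweR_ge0 ?invr_neq0 ?gt_eqF.
  by apply: integral0_eq => x _; rewrite hm0 abse0 poweR0r ?gt_eqF// mul0e.
suff -> : wLnorm sigma q (EFin \o f) = +oo by exact: leey.
have wZ : hvol (~` Z) = 0.
  have [H1 _] := ae_eq_integral_abs hvol measurableT mwE.
  have /H1 : \int[hvol]_x `|(EFin \o w) x| = 0.
    by rewrite -wn; apply: eq_integral => x _; rewrite gee0_abs.
  move=> [N [mN N0 sN]]; apply/eqP; rewrite eq_le measure_ge0 andbT -N0.
  apply: le_measure; rewrite ?inE//; first exact: measurableC.
  by move=> x nZ; apply: sN => /= /(_ Logic.I) [E]; exact: nZ.
rewrite /wLnorm (ge0_integral_off_null (N := ~` Z) (g := fun x => `|(f x)%:E| `^ q * +oo))//; last 6 first.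
- exact: measurableC.
- exact: emeasurable_funM.
- exact: emeasurable_funM.
- by move=> x; rewrite mule_ge0 ?poweR_ge0.
- by move=> x; rewrite mule_ge0 ?poweR_ge0.
- move=> x /contrapT wx; rewrite /sigma /wpow wx eqxx qE oppr_lt0 invr_gt0 p10//.
rewrite ge0_integralZr//; last by move=> x _; exact: poweR_ge0.
have fq0 : 0 < \int[hvol]_x (`|(f x)%:E| `^ q).
  rewrite lt0e integral_ge0 ?andbT; last by move=> x _; exact: poweR_ge0.
  apply: contra fn0 => /eqP fq; apply/eqP.
  have [H1 _] := ae_eq_integral_abs hvol measurableT mfq.
  have mf' : measurable_fun setT (EFin \o f) by exact/measurable_EFinP.
  have [_ H2] := ae_eq_integral_abs hvol measurableT mf'.
  apply: H2.
  have /H1 : \int[hvol]_x `| `|(f x)%:E| `^ q| = 0.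
    by rewrite -[RHS]fq; apply: eq_integral => x _; rewrite gee0_abs ?poweR_ge0.
  apply: filterS => x /(_ Logic.I) /= fx _; apply/eqP.
  have /eqP := fx; rewrite -[_ == 0]/(`|(f x)%:E| `^ q == 0) poweR_eq0// => /andP[+ _].
  by rewrite abse_eq0.
by rewrite gt0_muley// poweRyr// invr_neq0// gt_eqF.
Qed.

Local Notation kappa := (n.-1%:R : R).
Local Notation T_ := (ball_int mu (@hdist R n)).

Lemma havg_bounds : exists c C : R, [/\ (0 < c)%R, (0 < C)%R &
  forall r (f : H -> R) x, (1 <= r)%R ->
  havg r f x <= ((c * expR (kappa * r))^-1)%:E * T_ r (EFin \o (Num.norm \o f)) x /\
  T_ r (EFin \o (Num.norm \o f)) x <= (C * expR (kappa * r))%:E * havg r f x].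
Proof.
have [c [C [c0 C0 HV]]] := ball_growth GS (@ltr01 R).
exists c, C; split => // r f x r1.
have : (c * expR (kappa * r))%:E <= hvol (hball x r) <= (C * expR (kappa * r))%:E.
  exact: HV.
rewrite /havg -[\int[hvol]_(y in hball x r) `|(f y)%:E|]/(T_ r (EFin \o (Num.norm \o f)) x).
have : 0 <= T_ r (EFin \o (Num.norm \o f)) x.
  by apply: ball_int_ge0 => y; rewrite lee_fin normr_ge0.
move: (T_ _ _ _) => I I0.
case: (hvol (hball x r)) => [v| |]; rewrite ?leye_eq ?leeNy_eq ?andbF//= !lee_fin.
move=> /andP[cv vC]; have ce : (0 < c * expR (kappa * r))%R by rewrite mulr_gt0 ?expR_gt0.
have v0 : (0 < v)%R by exact: lt_le_trans cv.
rewrite inver gt_eqF//; split.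
  by apply: lee_wpmul2r => //; rewrite lee_fin lef_pV2// posrE.
have -> : I = v%:E * ((v^-1)%:E * I) by rewrite muleA -EFinM mulfV ?gt_eqF// mul1e.
rewrite [(v^-1)%:E * (v%:E * _)]muleA -EFinM mulVf ?gt_eqF// mul1e.
apply: lee_wpmul2r; last by rewrite lee_fin.
by rewrite mule_ge0// lee_fin invr_ge0 ltW.
Qed.

Variables (beta a : R).
Hypotheses (beta1 : (beta < 1)%R) (a0 : (0 < a)%R) (w_Ap : Ap_loc p w).
Hypothesis w_testing : exists2 C : R, (0 < C)%R &
  forall r : R, (1 <= r)%R ->
  forall E F : set H, measurable E -> measurable F ->
  \int[hvol]_(y in F) (havg r \1_E y * (w y)%:E) <=
    (C * expR ((n%:R - 1) * r * (beta - 1)))%:E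
    * (wvol (EFin \o w) E `^ a * wvol (EFin \o w) F `^ (1 - a)).

(** Undoing the normalization multiplies by a volume of order exp(kappa r), which turns the exponent
    beta - 1 into beta. *)
Lemma testing_ball_int : exists2 C : R, (0 < C)%R &
  forall r : R, (1 <= r)%R ->
  forall E F : set H, measurable E -> measurable F ->
  \int[mu]_(y in F) (T_ r (EFin \o \1_E) y * (w y)%:E) <=
    (C * expR (kappa * r * beta))%:E
    * ((\int[mu]_(y in E) (w y)%:E) `^ a * (\int[mu]_(y in F) (w y)%:E) `^ (1 - a)).
Proof.
have [c [D [c0 D0 HB]]] := havg_bounds.
have [C C0 HC] := w_testing.
exists (D * C)%R; first by rewrite mulr_gt0.
move=> r r1 E F mE mF; have := HC r r1 E F mE mF.
rewrite /wvol -[\int[hvol]_(x in E) _]/(\int[mu]_(y in E) (w y)%:E).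
rewrite -[\int[hvol]_(x in F) (EFin \o w) x]/(\int[mu]_(y in F) (w y)%:E).
have : 0 <= (\int[mu]_(y in E) (w y)%:E) `^ a * (\int[mu]_(y in F) (w y)%:E) `^ (1 - a).
  by rewrite mule_ge0 ?poweR_ge0.
move: (_ `^ a * _) => X X0 HX.
pose k := (D * expR (kappa * r))%R.
have k0 : (0 < k)%R by rewrite mulr_gt0 ?expR_gt0.
have hT0 y : 0 <= T_ r (EFin \o \1_E) y.
  by apply: ball_int_ge0 => z; rewrite lee_fin.
have mT : measurable_fun setT (T_ r (EFin \o \1_E)).
  apply: (measurable_ball_int GS); first exact/measurable_EFinP.
  by move=> z; rewrite lee_fin.
have normE : EFin \o (Num.norm \o (\1_E : H -> R)) = EFin \o \1_E.
  by apply/funext => z /=; rewrite ger0_norm.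
have H1 : (k^-1)%:E * \int[mu]_(y in F) (T_ r (EFin \o \1_E) y * (w y)%:E) <=
    (C * expR ((n%:R - 1) * r * (beta - 1)))%:E * X.
  apply: le_trans HX.
  rewrite -ge0_integralZl; last 3 first.
  - by apply: measurable_funTS; apply: emeasurable_funM.
  - by move=> y _; exact: (mule_ge0 (hT0 y) (wE0 y)).
  - by rewrite lee_fin invr_ge0 ltW.
  - apply: ge0_le_integralW => y _.
      apply: mule_ge0; first by rewrite lee_fin invr_ge0 ltW.
      exact: (mule_ge0 (hT0 y) (wE0 y)).
    rewrite muleA; apply: lee_wpmul2r; first exact: wE0.
    have [_] := HB r (\1_E) y r1; rewrite normE -/k => HT.
    rewrite -[leRHS]mul1e -(mulVf (lt0r_neq0 k0)) EFinM -muleA.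
    by apply: lee_wpmul2l => //; rewrite lee_fin invr_ge0 ltW.
  - exact: mF.
have -> : (D * C * expR (kappa * r * beta))%:E =
    k%:E * (C * expR ((n%:R - 1) * r * (beta - 1)))%:E.
  rewrite -EFinM; congr (_%:E); rewrite /k -subn1 natrB ?(leq_trans _ n2)//.
  rewrite -[RHS]mulrACA -expRD; congr (_ * expR _)%R; ring.
rewrite -[leRHS]muleA.
have kE : 0 <= k%:E by rewrite lee_fin ltW.
apply: le_trans (lee_wpmul2l kE H1).
by rewrite muleA -EFinM mulfV ?lt0r_neq0// mul1e.
Qed.

Hypothesis Z0 : mu Z = 0.
Local Notation v := (positive_weight w).

Lemma positive_weight_gt0 x : (0 < v x)%R.
Proof. by rewrite /positive_weight; case: eqVneq => // wx; rewrite lt0r wx w0. Qed.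

(** A pointwise inequality is wanted, since equality almost everywhere could not be used under the
    integral of a maximal function not known to be measurable. *)
Let wv x : (w x <= v x)%R.
Proof. by rewrite /positive_weight; case: eqVneq => // ->. Qed.

Let vE x : ~ Z x -> v x = w x.
Proof. by rewrite /positive_weight; case: eqVneq. Qed.

Lemma measurable_positive_weight : measurable_fun setT v.
Proof.
apply: measurable_fun_ifT => //.
apply: (measurable_fun_bool true); rewrite setTI (_ : _ @^-1` _ = Z); first exact: mZ.
by apply/seteqP; split => x /=; [move/eqP|move=> ->; rewrite eqxx].
Qed.

Let mvE : measurable_fun setT (EFin \o v).
Proof. by apply/measurable_EFinP; exact: measurable_positive_weight. Qed.

Let vE0 x : 0 <= (v x)%:E.
Proof. by rewrite lee_fin ltW// positive_weight_gt0. Qed.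

Lemma integral_positive_weight (D : set H) (g : H -> \bar R) :
  measurable D -> measurable_fun setT g -> (forall x, 0 <= g x) ->
  \int[mu]_(x in D) (g x * (v x)%:E) = \int[mu]_(x in D) (g x * (w x)%:E).
Proof.
move=> mD mg g0; apply: (ge0_integral_off_null mD mZ Z0).
- by apply: measurable_funTS; exact: emeasurable_funM.
- by apply: measurable_funTS; exact: emeasurable_funM.
- by move=> x; exact: (mule_ge0 (g0 x) (vE0 x)).
- by move=> x; exact: (mule_ge0 (g0 x) (wE0 x)).
- by move=> x nZ; rewrite vE.
Qed.

Lemma integral_dual_positive_weight (D : set H) (g : H -> \bar R) :
  measurable D -> measurable_fun setT g -> (forall x, 0 <= g x) ->
  \int[mu]_(x in D) (g x * (dual_weight p v x)%:E) = \int[mu]_(x in D) (g x * sigma x).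
Proof.
move=> mD mg g0; have md : measurable_fun setT (EFin \o dual_weight p v).
  apply/measurable_EFinP; apply: measurable_dual_weight.
  exact: measurable_positive_weight.
have d0 x : 0 <= (dual_weight p v x)%:E by rewrite lee_fin powR_ge0.
apply: (ge0_integral_off_null mD mZ Z0).
- by apply: measurable_funTS; exact: emeasurable_funM.
- by apply: measurable_funTS; exact: emeasurable_funM.
- by move=> x; apply: mule_ge0.
- by move=> x; apply: mule_ge0.
move=> x nZ; rewrite /sigma /wpow qE /dual_weight vE//.
by case: eqVneq.
Qed.

Lemma integral1_positive_weight (D : set H) : measurable D ->
  \int[mu]_(x in D) (v x)%:E = \int[mu]_(x in D) (w x)%:E.
Proof.
move=> mD; have := @integral_positive_weight D (cst 1) mD (measurable_cst _) (fun=> lee01).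
by under eq_integral do rewrite mul1e; under [RHS]eq_integral do rewrite mul1e.
Qed.

Lemma integral1_dual_positive_weight (D : set H) : measurable D ->
  \int[mu]_(x in D) (dual_weight p v x)%:E = \int[mu]_(x in D) sigma x.
Proof.
move=> mD.
have := @integral_dual_positive_weight D (cst 1) mD (measurable_cst _) (fun=> lee01).
by under eq_integral do rewrite mul1e; under [RHS]eq_integral do rewrite mul1e.
Qed.

(** Multiplication by V^p clears the normalizing volumes: one factor V goes to the weight and
    V^(p-1) to its dual. *)
Lemma muckenhoupt_positive_weight : exists2 A : R, (0 < A)%R &
  forall x r, (0 < r <= 1)%R ->
  \int[mu]_(y in hball x r) (v y)%:E *
  (\int[mu]_(y in hball x r) (dual_weight p v y)%:E) `^ (p - 1)
  <= A%:E * mu (hball x r) `^ p.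
Proof.
have [A A0 HA] : exists2 A : R, (0 < A)%R & forall z : H * R, (0 < z.2 <= 1)%R ->
    ((hvol (hball z.1 z.2))^-1 * \int[hvol]_(x in hball z.1 z.2) (w x)%:E)
    * ((hvol (hball z.1 z.2))^-1 * \int[hvol]_(x in hball z.1 z.2) sigma x) `^ (p - 1)
    <= A%:E.
  move: w_Ap; rewrite /Ap_loc -qE -/sigma.
  set S := ereal_sup _ => Soo.
  have [A A0 SA] : exists2 A : R, (0 < A)%R & S <= A%:E.
    case: S Soo => [s _| |_] //.
      by exists (Num.max s 1)%R; rewrite ?lee_fin ?lt_max ?le_max ?ltr01 ?lexx ?orbT.
    by exists 1%R => //; exact: leNye.
  by exists A => // z z01; apply: le_trans SA; apply: ereal_sup_ubound; exists z.
exists A => // x r r01; have := HA (x, r) r01; rewrite /=.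
have r0 : (0 < r)%R by case/andP: r01.
have mB : measurable (hball x r) := measurable_hball x r.
rewrite integral1_positive_weight// integral1_dual_positive_weight//.
rewrite -[\int[hvol]_(x in _) (w x)%:E]/(\int[mu]_(y in hball x r) (w y)%:E).
rewrite -[\int[hvol]_(x in _) sigma x]/(\int[mu]_(y in hball x r) sigma y).
have I0 : 0 <= \int[mu]_(y in hball x r) (w y)%:E by apply: integral_ge0 => y _; exact: wE0.
have J0 : 0 <= \int[mu]_(y in hball x r) sigma y by apply: integral_ge0 => y _; exact: sigma_ge0.
move: (\int[mu]_(y in _) _) I0 (\int[mu]_(y in _) _) J0 => I I0 J J0.
have V0 : 0 < hvol (hball x r) := dball_measure_gt0 GS x r0.
have Voo : hvol (hball x r) < +oo := dball_measure_lty GS x r.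
rewrite -[mu _]/(hvol (hball x r)).
case: (hvol (hball x r)) V0 Voo => [V| |]//; rewrite lte_fin => V0 _.
have VE : 0 <= V%:E by rewrite lee_fin ltW.
have ViE : 0 <= (V^-1)%:E by rewrite lee_fin invr_ge0 ltW.
have scale X : X = V%:E * ((V^-1)%:E * X).
  by rewrite muleA -EFinM mulfV ?mul1e// gt_eqF.
rewrite inver gt_eqF// => HI.
rewrite [in leLHS](scale I) [in leLHS](scale J) (poweRM _ VE (mule_ge0 ViE J0)) muleACA.
rewrite [V%:E * _]muleC (mule_poweRB1 p1 VE) muleC.
by apply: lee_wpmul2r => //; exact: poweR_ge0.
Qed.

Lemma testing_positive_weight : exists2 C : R, (0 < C)%R &
  forall r : R, (1 <= r)%R ->
  forall E F : set H, measurable E -> measurable F ->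
  \int[mu]_(y in F) (T_ r (EFin \o \1_E) y * (v y)%:E) <=
    (C * expR (kappa * r * beta))%:E
    * ((\int[mu]_(y in E) (v y)%:E) `^ a * (\int[mu]_(y in F) (v y)%:E) `^ (1 - a)).
Proof.
have [C C0 HC] := testing_ball_int; exists C => // r r1 E F mE mF.
rewrite !integral1_positive_weight// integral_positive_weight//; first exact: HC.
  apply: (measurable_ball_int GS); first exact/measurable_EFinP.
  by move=> z; rewrite lee_fin.
by move=> y; apply: ball_int_ge0 => z; rewrite lee_fin.
Qed.

Let mv := measurable_positive_weight.
Let v0 := positive_weight_gt0.

Let norm_ge0 (f : H -> R) x : (0 <= (Num.norm \o f) x)%R.
Proof. exact: normr_ge0. Qed.

Let wLnormE (f : H -> R) : measurable_fun setT f ->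
  \int[mu]_x ((`|f x|%:E) `^ p * (v x)%:E) = \int[hvol]_x (`|(f x)%:E| `^ p * (w x)%:E).
Proof.
move=> mf; rewrite integral_positive_weight//; last by move=> x; exact: poweR_ge0.
apply: (measurableT_comp (measurable_poweR _)).
by apply/measurable_EFinP; exact: measurableT_comp.
Qed.

Lemma hyperbolic_weak_type : (beta / a <= p)%R -> exists2 C : R, (0 < C)%R &
  forall f : H -> R, measurable_fun setT f ->
  wweakLnorm (EFin \o w) p (hmaximal f)
    <= C%:E * wLnorm (EFin \o w) p (EFin \o f).
Proof.
move=> bap; have [A A0 HA] := muckenhoupt_positive_weight.
have [C1 C10 HC1] := testing_positive_weight.
have [C C0 HC] := testing_weak_type GS p1 mv beta1 a0 C10 HC1 v0 A0 HA (erefl _) bap.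
exists (C `^ p^-1)%R; first exact: powR_gt0.
move=> f mf; apply: ge_ereal_sup => _ [l /= l0 <-].
have mnf : measurable_fun setT (Num.norm \o f) by exact: measurableT_comp.
have := HC _ mnf (norm_ge0 f) l l0; rewrite wLnormE//.
rewrite -hmaximalE; set S := [set x | _] => HS.
have lpE : 0 <= (l `^ p)%:E by rewrite lee_fin powR_ge0.
have wS0 : 0 <= wvol (EFin \o w) [set x | l%:E < `|hmaximal f x|] by apply: integral_ge0.
have HS' : (l `^ p)%:E * wvol (EFin \o w) [set x | l%:E < `|hmaximal f x|] <=
    C%:E * \int[hvol]_x (`|(f x)%:E| `^ p * (w x)%:E).
  apply: le_trans HS; apply: lee_wpmul2l => //.
  rewrite /wvol (_ : [set x | _] = S); last first.
    by apply/seteqP; split => x; rewrite /S/= gee0_abs// hmaximal_ge0.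
  by apply: ge0_le_integralW => x _ //=; rewrite lee_fin.
have := lee_poweRV_scale C0 p0 (mule_ge0 lpE wS0) _ HS'.
rewrite (poweRM _ lpE wS0) poweR_EFin -powRrM mulfV ?gt_eqF// powRr1 ?(ltW l0)//.
apply; apply: integral_ge0 => x _; exact: (mule_ge0 (poweR_ge0 _ _) (wE0 x)).
Qed.

Section strong_type.
Hypothesis bap : (beta / a < p)%R.

Lemma hyperbolic_strong_type : exists2 C : R, (0 < C)%R &
  forall f : H -> R, measurable_fun setT f ->
  wLnorm (EFin \o w) p (hmaximal f) <= C%:E * wLnorm (EFin \o w) p (EFin \o f).
Proof.
have [A A0 HA] := muckenhoupt_positive_weight.
have [C1 C10 HC1] := testing_positive_weight.
have [C C0 HC] := testing_strong_type GS p1 mv beta1 a0 C10 HC1 v0 A0 HA (erefl _) bap.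
exists (C `^ p^-1)%R; first exact: powR_gt0.
move=> f mf; apply: lee_poweRV_scale => //.
- by apply: integral_ge0 => x _; exact: (mule_ge0 (poweR_ge0 _ _) (wE0 x)).
- by apply: integral_ge0 => x _; exact: (mule_ge0 (poweR_ge0 _ _) (wE0 x)).
have mnf : measurable_fun setT (Num.norm \o f) by exact: measurableT_comp.
have [U [mU HU]] := HC _ mnf (norm_ge0 f); rewrite wLnormE//; apply: le_trans.
apply: ge0_le_integralW => x _; first by exact: (mule_ge0 (poweR_ge0 _ _) (wE0 x)).
apply: lee_pmul => //; rewrite ?poweR_ge0 ?lee_fin ?wv//.
by apply: lee_poweR; rewrite ?(ltW p0)// gee0_abs ?hmaximal_ge0//; case/andP: (HU x).
Qed.

(** On the zeros of [w] the weight [sigma] is infinite and not bounded by the dual of the modified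
    weight. The exchange of the weights is therefore made under the integral of the measurable
    majorant [U]. *)
Lemma hyperbolic_dual_strong_type : exists2 C : R, (0 < C)%R &
  forall f : H -> R, measurable_fun setT f ->
  wLnorm sigma q (hmaximal f) <= C%:E * wLnorm sigma q (EFin \o f).
Proof.
have [A A0 HA] := muckenhoupt_positive_weight.
have [C1 C10 HC1] := testing_positive_weight.
have [C C0 HC] := testing_dual_strong_type GS p1 mv beta1 a0 C10 HC1 v0 A0 HA (erefl _) bap.
exists (C `^ q^-1)%R; first exact: powR_gt0.
move=> f mf; apply: lee_poweRV_scale => //.
- by apply: integral_ge0 => x _; exact: (mule_ge0 (poweR_ge0 _ _) (sigma_ge0 x)).
- by apply: integral_ge0 => x _; exact: (mule_ge0 (poweR_ge0 _ _) (sigma_ge0 x)).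
have mnf : measurable_fun setT (Num.norm \o f) by exact: measurableT_comp.
have [U [mU HU]] := HC _ mnf (norm_ge0 f).
have U0 x : 0 <= U x by have /andP[] := HU x; exact: le_trans.
rewrite !integral_dual_positive_weight//; first last.
- by move=> x; exact: poweR_ge0.
- exact: (measurableT_comp (measurable_poweR _)).
- by move=> x; exact: poweR_ge0.
- apply: (measurableT_comp (measurable_poweR _)).
  by apply/measurable_EFinP; exact: measurableT_comp.
apply: le_trans.
apply: ge0_le_integralW => x _; first by exact: (mule_ge0 (poweR_ge0 _ _) (sigma_ge0 x)).
apply: lee_wpmul2r => //.
by apply: lee_poweR; rewrite ?(ltW q0)// gee0_abs ?hmaximal_ge0//; case/andP: (HU x).
Qed.

Lemma hyperbolic_mean_decay : exists C rho : R, [/\ (0 < C)%R, (0 < rho < 1)%R &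
  forall f : H -> R, measurable_fun setT f -> forall j : nat, (0 < j)%N ->
  wLnorm (EFin \o w) p (havg j%:R f) <= (C * rho ^+ j)%:E * wLnorm (EFin \o w) p (EFin \o f)].
Proof.
have [A A0 HA] := muckenhoupt_positive_weight.
have [C1 C10 HC1] := testing_positive_weight.
have [C [rho [C0 /andP[rho0 rho1] HC]]] :=
  discrete_mean_decay GS p1 mv beta1 a0 C10 HC1 v0 A0 HA (erefl _) bap.
have [c [D [c0 D0 HB]]] := havg_bounds.
have pV0 : (0 < p^-1)%R by rewrite invr_gt0.
exists (c^-1 * C `^ p^-1)%R, (rho `^ p^-1)%R; split.
- by rewrite mulr_gt0 ?invr_gt0 ?powR_gt0.
- by rewrite powR_gt0//= powR_lt1.
move=> f mf j j0.
have mnf : measurable_fun setT (Num.norm \o f) by exact: measurableT_comp.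
have := HC _ mnf (norm_ge0 f) j; rewrite wLnormE//.
set X := \int[mu]_x _; set Y := \int[hvol]_x _ => XY.
have Y0 : 0 <= Y by apply: integral_ge0 => x _; exact: (mule_ge0 (poweR_ge0 _ _) (wE0 x)).
have j1 : (1 <= j%:R :> R)%R by rewrite ler1n.
have dm0 x : 0 <= discrete_mean mu (@hdist R n) (expR kappa) j (EFin \o (Num.norm \o f)) x.
  by apply: (discrete_mean_ge0 _ _ (erefl (expR kappa))) => y; rewrite lee_fin.
have ci : (0 <= c^-1)%R by rewrite invr_ge0 ltW.
have avg0 x : 0 <= havg j%:R f x.
  by rewrite mule_ge0 ?inve_ge0// integral_ge0.
have avgle x : havg j%:R f x <=
    (c^-1)%:E * discrete_mean mu (@hdist R n) (expR kappa) j (EFin \o (Num.norm \o f)) x.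
  by have [+ _] := HB j%:R f x j1; rewrite expRM_natr invfM EFinM -muleA.
have mdm : measurable_fun setT
    (discrete_mean mu (@hdist R n) (expR kappa) j (EFin \o (Num.norm \o f))).
  apply: (measurable_discrete_mean GS); first exact/measurable_EFinP.
  by move=> y; rewrite lee_fin.
have cpE : 0 <= (c^-1 `^ p)%:E by rewrite lee_fin powR_ge0.
have rj0 : (0 < rho ^+ j)%R by rewrite exprn_gt0.
rewrite (_ : (c^-1 * C `^ p^-1 * (rho `^ p^-1) ^+ j)%R =
    ((c^-1 `^ p * (C * rho ^+ j)) `^ p^-1)%R); last first.
  rewrite powRM ?powR_ge0 ?mulr_ge0 ?(ltW C0) ?(ltW rj0)// powRM ?(ltW C0) ?(ltW rj0)//.
  rewrite -powRrM mulfV ?gt_eqF// powRr1// mulrA; congr (_ * _)%R.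
  by rewrite expn_powR// ltW.
apply: lee_poweRV_scale => //.
- by rewrite mulr_gt0 ?powR_gt0 ?invr_gt0// mulr_gt0.
- by apply: integral_ge0 => x _; exact: (mule_ge0 (poweR_ge0 _ _) (wE0 x)).
rewrite EFinM -muleA; apply: le_trans (lee_wpmul2l cpE XY).
rewrite /X -(integral_poweR_scale _ _ ci mdm dm0 mv (fun x => ltW (v0 x))).
apply: ge0_le_integralW => x _; first exact: (mule_ge0 (poweR_ge0 _ _) (wE0 x)).
apply: lee_pmul; [exact: poweR_ge0|exact: wE0| |by rewrite lee_fin wv].
by apply: lee_poweR; rewrite ?(ltW p0)// gee0_abs.
Qed.

End strong_type.
End hyperbolic_weights.

Lemma polynomial_decay_series_le (R : realType) (gamma C rho : R) :
  (0 <= gamma)%R -> (0 < C)%R -> (0 < rho < 1)%R ->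
  exists2 K : R, (0 < K)%R & forall (u : nat -> \bar R) (Y : \bar R), 0 <= Y ->
  (forall j, 0 <= u j) ->
  (forall j : nat, (0 < j)%N -> u j <= (C * rho ^+ j)%:E * Y) ->
  \sum_(1 <= j <oo) ((j%:R `^ gamma)%:E * u j) <= K%:E * Y.
Proof.
move=> g0 C0 rho01; have [K K0 HK] := polynomial_geometric_le g0 rho01.
case/andP: rho01 => rho0 rho1.
pose s := (rho `^ 2^-1)%R.
have s0 : (0 < s)%R by exact: powR_gt0.
have s1 : (s < 1)%R by apply: powR_lt1; rewrite ?invr_gt0.
have CK : (0 < C * K)%R by rewrite mulr_gt0.
have s10 : (0 < (1 - s)^-1)%R by rewrite invr_gt0 subr_gt0.
exists (C * K * (1 - s)^-1)%R; first by rewrite mulr_gt0.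
move=> u Y Y0 u0 Hu.
have sE0 j : 0 <= (s ^+ j)%:E by rewrite lee_fin exprn_ge0// ltW.
have CKE : 0 <= (C * K)%:E by rewrite lee_fin ltW.
have nn j : 0 <= (j%:R `^ gamma)%:E * u j.
  by apply: mule_ge0 => //; rewrite lee_fin powR_ge0.
apply: (@le_trans _ _ ((C * K)%:E * ((\sum_(j <oo) (s ^+ j)%:E) * Y))); last first.
  rewrite [in leRHS]EFinM -muleA; apply: lee_wpmul2l => //.
  by apply: lee_wpmul2r => //; exact: nneseries_geometric_le (ltW s0) s1.
rewrite (nneseriesZr_ereal sE0 Y0) -nneseriesZl; last first.
  by move=> j _; exact: mule_ge0.
(* The shift makes [j.+1] the base of the polynomial factor, as in [polynomial_geometric_le]; the
   surplus factor [rho] is bounded by 1. *)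
rewrite -(nneseries_addn 1)//.
apply: lee_nneseries => [j _ _|j _]; first exact: nn.
rewrite addn1; have uj := Hu j.+1 isT.
apply: (@le_trans _ _ ((j.+1%:R `^ gamma)%:E * ((C * rho ^+ j.+1)%:E * Y))).
  by apply: lee_wpmul2l => //; rewrite lee_fin powR_ge0.
rewrite !muleA -!EFinM; apply: lee_wpmul2r => //; rewrite lee_fin.
rewrite mulrCA -mulrA ler_pM2l//.
apply: le_trans (HK j); apply: ler_wpM2l; first exact: powR_ge0.
by apply: ler_wiXn2l; rewrite ?(ltW rho0) ?(ltW rho1).
Qed.

Theorem theorem1p2 (R : realType) (n : nat) (n2 : (2 <= n)%N)
    (p : R) (p1 : (1 < p)%R)
    (w : hyp R n -> R) (mw : measurable_fun setT w)
    (w0 : forall x, (0 <= w x)%R)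
    (w_Ap : Ap_loc p w)
    (beta alpha : R) (beta0 : (0 < beta)%R) (beta1 : (beta < 1)%R)
    (beta_alpha : (beta <= alpha)%R) (alpha_p : (alpha < p)%R)
    (w_testing : exists2 C : R, (0 < C)%R &
      forall r : R, (1 <= r)%R ->
      forall E F : set (hyp R n), measurable E -> measurable F ->
      \int[hvol]_(y in F) (havg r \1_E y * (w y)%:E) <=
        (C * expR ((n%:R - 1) * r * (beta - 1)))%:E
        * (wvol (EFin \o w) E `^ (alpha / p)
           * wvol (EFin \o w) F `^ (1 - alpha / p))) :
  let p' : R := (p / (p - 1))%R in
  let sigma : hyp R n -> \bar R := wpow w (1 - p') in
  (exists2 C : R, (0 < C)%R &
    forall f : hyp R n -> R, measurable_fun setT f ->
    wweakLnorm (EFin \o w) p (hmaximal f)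
      <= C%:E * wLnorm (EFin \o w) p (EFin \o f)) /\
  ((beta < alpha)%R ->
    [/\ forall gamma : R, (0 <= gamma)%R ->
          exists2 C : R, (0 < C)%R &
          forall f : hyp R n -> R, measurable_fun setT f ->
          \sum_(1 <= j <oo)
             ((j%:R `^ gamma)%:E * wLnorm (EFin \o w) p (havg j%:R f))
            <= C%:E * wLnorm (EFin \o w) p (EFin \o f),
        exists2 C : R, (0 < C)%R &
          forall f : hyp R n -> R, measurable_fun setT f ->
          wLnorm (EFin \o w) p (hmaximal f)
            <= C%:E * wLnorm (EFin \o w) p (EFin \o f)
      & exists2 C : R, (0 < C)%R &
          forall f : hyp R n -> R, measurable_fun setT f ->
          wLnorm sigma p' (hmaximal f)
            <= C%:E * wLnorm sigma p' (EFin \o f)]).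

Proof.
have p0 : (0 < p)%R by exact: lt_trans p1.
have alpha0 : (0 < alpha)%R by exact: lt_le_trans beta_alpha.
have a0 : (0 < alpha / p)%R by rewrite divr_gt0.
(* So the condition beta / a <= p of the general theory is beta <= alpha, and the strict
   inequalities correspond as well. *)
have apE : (beta / (alpha / p) = p * (beta / alpha))%R by rewrite invf_div mulrCA.
move=> p' sigma.
have wE0 x : 0 <= (EFin \o w) x by rewrite /= lee_fin.
have Y0 f : 0 <= wLnorm (EFin \o w) p (EFin \o f) by exact: poweR_ge0.
(* If [w] vanishes on a set of positive measure, its total mass is zero: the left sides for [w] are
   at most 0, and the constant 1 serves everywhere. *)
have [Z0|Z0] := eqVneq (hvol_sf n2 [set x | w x = 0%R]) 0; last first.
  have [C1 C10 HC1] := testing_ball_int n2 mw w0 w_testing.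
  have wn : \int[hvol]_x (w x)%:E = 0.
    exact: (testing_vanishing (hyp_growth_space R n2) mw a0 HC1 w0 Z0).
  split.
    exists 1%R => // f mf; rewrite mul1e; apply: le_trans (Y0 f).
    exact: (wweakLnorm_null p1 w0).
  move=> _; split => [gamma g0||].
  - exists 1%R => // f mf; rewrite mul1e; apply: le_trans (Y0 f).
    rewrite (_ : \sum_(1 <= j <oo) _ = 0)//; apply: eseries0 => j _ _.
    by rewrite (wLnorm_null p1 mw w0)// mule0.
  - exists 1%R => // f mf; rewrite mul1e (wLnorm_null p1 mw w0)//.
  - exists 1%R => // f mf; rewrite mul1e; exact: (wLnorm_dual_null p1 mw w0).
split.
  apply: (hyperbolic_weak_type p1 mw w0 beta1 a0 w_Ap w_testing Z0).
  by rewrite apE ger_pMr// ler_pdivrMr// mul1r.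
move=> ba; have bap : (beta / (alpha / p) < p)%R.
  by rewrite apE gtr_pMr// ltr_pdivrMr// mul1r.
split => [gamma g0||].
- have [C [rho [C0 rho01 HC]]] :=
    hyperbolic_mean_decay p1 mw w0 beta1 a0 w_Ap w_testing Z0 bap.
  have [K K0 HK] := polynomial_decay_series_le g0 C0 rho01.
  exists K => // f mf; apply: HK => // [j|j j0]; [exact: poweR_ge0|exact: HC].
- exact: (hyperbolic_strong_type p1 mw w0 beta1 a0 w_Ap w_testing Z0 bap).
- exact: (hyperbolic_dual_strong_type p1 mw w0 beta1 a0 w_Ap w_testing Z0 bap).
Qed.
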